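(* Let $\mathcal P_t=e^{t\mathcal L}$ be a primitive quantum Markov semigroup satisfying the $\sigma$-GNS detailed balance condition for its full-rank invariant state $\sigma$. Then $$\alpha_1(\mathcal L)=\lim_{p\to1^+}\alpha_p(\mathcal L),$$ where $\alpha_p(\mathcal L)$, $p\in(1,2]$, is the optimal constant in the $p$-Beckner inequality and $\alpha_1(\mathcal L)$ is the optimal constant in the modified log-Sobolev inequality.
   Context: $\mathcal H$ is a finite-dimensional Hilbert space, $\mathcal B(\mathcal H)$ the operators on it. A quantum Markov semigroup (QMS) is a $C_0$-semigroup $(\mathcal P_t)_{t\ge0}$ of completely positive unital maps on $\mathcal B(\mathcal H)$, with generator $\mathcal L$; $\dagger$ is the adjoint for the Hilbert–Schmidt inner product. It is primitive if it has a unique invariant state $\sigma$ ($\mathcal P_t^\dagger(\sigma)=\sigma$ for all $t$) and $\sigma$ has full rank. The $\sigma$-GNS detailed balance condition means that $\mathcal L$ is self-adjoint for $\langle X,Y\rangle_{\sigma,1}=\mathrm{Tr}(\sigma X^*Y)$. Put $\langle X,Y\rangle_{\sigma,1/2}=\mathrm{Tr}(\sigma^{1/2}X^*\sigma^{1/2}Y)$. Let $\Gamma_\sigma^{s}(X)=\sigma^{s/2}X\sigma^{s/2}$ for $s\in\mathbb R$ ($\Gamma_\sigma=\Gamma_\sigma^1$), $\|X\|_{p,\sigma}=\mathrm{Tr}\big(|\Gamma_\sigma^{1/p}(X)|^p\big)^{1/p}$, $\hat p=p/(p-1)$. For $X>0$ and $p>1$, $$\mathcal E_{p,\mathcal L}(X)=-\frac{\hat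 p\,p}{4}\Big\langle \Gamma_\sigma^{-1/\hat p}\big((\Gamma_\sigma^{1/p}(X))^{p-1}\big),\mathcal L(X)\Big\rangle_{\sigma,1/2},$$ while $\mathcal E_{1,\mathcal L}(X)=-\frac14\langle\log\Gamma_\sigma(X)-\log\sigma,\mathcal L(X)\rangle_{\sigma,1/2}$ and $$\mathrm{Ent}_{1,\sigma}(X)=\mathrm{Tr}\big(\Gamma_\sigma(X)(\log\Gamma_\sigma(X)-\log\sigma)\big)-\|X\|_{1,\sigma}\log\|X\|_{1,\sigma}.$$ The $p$-Beckner inequality with constant $\alpha_p$ is $\alpha_p\,\hat p\,(\|X\|_{p,\sigma}^p-\|X\|_{1,\sigma}^p)\le\mathcal E_{p,\mathcal L}(X)$ for all $X>0$. The modified log-Sobolev inequality with constant $\alpha_1$ is $\alpha_1\,\mathrm{Ent}_{1,\sigma}(X)\le\mathcal E_{1,\mathcal L}(X)$ for all $X>0$. Optimal constants are the largest constants for which the inequalities hold. *)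

(* Defs.v *)
From HB Require Import structures.
From mathcomp Require Import all_boot all_order all_algebra.
From mathcomp Require Import complex.
From mathcomp Require Import all_classical all_reals all_analysis.

Set Implicit Arguments.
Unset Strict Implicit.
Unset Printing Implicit Defensive.

Import Order.TTheory GRing.Theory Num.Theory.
Import numFieldNormedType.Exports.

Local Open Scope ring_scope.
Local Open Scope classical_set_scope.
Local Open Scope complex_scope.
Local Open Scope sesquilinear_scope.

(* With H = C^n, operators on H are the matrices 'M[R[i]]_n and X^* is X^t*. *)

Section Operators.
Variable R : realType.

(* In the order of R[i], 0 <= z means that z is real and nonnegative, so these
   predicates force A to be Hermitian. *)
Definition psd n (A : 'M[R[i]]_n) : Prop :=
  forall v : 'cV[R[i]]_n, 0 <= (v^t* *m A *m v) 0 0.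

Definition posdef n (A : 'M[R[i]]_n) : Prop :=
  forall v : 'cV[R[i]]_n, v != 0 -> 0 < (v^t* *m A *m v) 0 0.

(* Functional calculus f(A), meaningful for Hermitian A: then
   A = U^-1 *m diag_mx d *m U with U unitary and d real, and the value does not
   depend on the diagonalization selected by spectralmx. *)
Definition mxfun n (f : R -> R) (A : 'M[R[i]]_n) : 'M[R[i]]_n :=
  invmx (spectralmx A)
    *m diag_mx (\row_i (f (complex.Re (spectral_diag A 0 i)))%:C)
    *m spectralmx A.

Definition mxpow n (A : 'M[R[i]]_n) (s : R) : 'M[R[i]]_n :=
  mxfun (fun x => x `^ s) A.

Definition mxlog n (A : 'M[R[i]]_n) : 'M[R[i]]_n := mxfun (@ln R) A.

Definition mxabs n (A : 'M[R[i]]_n) : 'M[R[i]]_n :=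
  mxfun Num.sqrt (A^t* *m A).

Definition hs_ip n (X Y : 'M[R[i]]_n) : R[i] := \tr (X^t* *m Y).

Definition hs_norm n (X : 'M[R[i]]_n) : R :=
  Num.sqrt (complex.Re (hs_ip X X)).

(* The (i, j) entry of Phi^dagger(Y) is
   <E_ij, Phi^dagger(Y)> = <Phi(E_ij), Y>; see hs_adjP. *)
Definition hs_adj n (Phi : 'M[R[i]]_n -> 'M[R[i]]_n) (Y : 'M[R[i]]_n) :
    'M[R[i]]_n :=
  \matrix_(i, j) hs_ip (Phi (delta_mx i j)) Y.

Lemma hs_adjP n (Phi : {linear 'M[R[i]]_n -> 'M[R[i]]_n})
    (X Y : 'M[R[i]]_n) :
  hs_ip (Phi X) Y = hs_ip X (hs_adj Phi Y).
Proof.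
have ipDl (A B : 'M[R[i]]_n) : hs_ip (A + B) Y = hs_ip A Y + hs_ip B Y.
  by rewrite /hs_ip linearD /= map_mxD mulmxDl linearD.
have ip0l : hs_ip (0 : 'M[R[i]]_n) Y = 0.
  by rewrite /hs_ip linear0 map_mx0 mul0mx linear0.
have ipZl c (A : 'M[R[i]]_n) : hs_ip (c *: A) Y = Num.conj c * hs_ip A Y.
  by rewrite /hs_ip linearZ /= map_mxZ -scalemxAl linearZ.
have ip_sum (F : 'I_n -> 'M[R[i]]_n) :
    hs_ip (Phi (\sum_i F i)) Y = \sum_i hs_ip (Phi (F i)) Y.
  by rewrite linear_sum (big_morph (fun A => hs_ip A Y) ipDl ip0l).
rewrite {1}(matrix_sum_delta X) ip_sum.
rewrite {2}/hs_ip /mxtrace; under [RHS]eq_bigr do rewrite mxE.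
rewrite [RHS]exchange_big; apply: eq_bigr => i _ /=.
rewrite ip_sum; apply: eq_bigr => j _.
by rewrite linearZ /= ipZl !mxE.
Qed.

(* The maps id_k (x) Phi on M_k (x) B(H), read as k x k block matrices. *)
Definition ampliation n k (Phi : 'M[R[i]]_n -> 'M[R[i]]_n)
    (A : 'M[R[i]]_(\sum_(i < k) n)) : 'M[R[i]]_(\sum_(i < k) n) :=
  \mxblock_(i < k, j < k) Phi (submxblock A i j).

Definition completely_positive n (Phi : 'M[R[i]]_n -> 'M[R[i]]_n) : Prop :=
  forall k (A : 'M[R[i]]_(\sum_(i < k) n)), psd A -> psd (ampliation Phi A).

End Operators.

Section Semigroups.
Variables (R : realType) (n : nat).
Implicit Types (P : R -> {linear 'M[R[i]]_n -> 'M[R[i]]_n})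
  (L : 'M[R[i]]_n -> 'M[R[i]]_n) (sigma rho X Y : 'M[R[i]]_n).

(* Only the values P t with 0 <= t matter. *)
Record quantum_markov_semigroup P : Prop := QuantumMarkovSemigroup {
  qms0 : forall X, P 0 X = X;
  qmsD : forall s t X, 0 <= s -> 0 <= t -> P (s + t) X = P s (P t X);
  qms_continuous : forall X, hs_norm (P t X - X) @[t --> 0^'+] --> (0 : R);
  qms_cp : forall t, 0 <= t -> completely_positive (P t);
  qms_unital : forall t, 0 <= t -> P t 1%:M = 1%:M
}.

Definition generator P L : Prop :=
  forall X,
    hs_norm ((t^-1)%:C *: (P t X - X) - L X) @[t --> 0^'+] --> (0 : R).

Definition is_state rho : Prop := psd rho /\ \tr rho = 1.

Definition invariant_state P rho : Prop :=
  is_state rho /\ forall t, 0 <= t -> hs_adj (P t) rho = rho.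

Definition primitive P sigma : Prop :=
  [/\ invariant_state P sigma,
      forall rho, invariant_state P rho -> rho = sigma &
      \rank sigma = n].

Definition gns_ip sigma X Y : R[i] := \tr (sigma *m X^t* *m Y).

Definition kms_ip sigma X Y : R[i] :=
  \tr (mxpow sigma (2^-1) *m X^t* *m mxpow sigma (2^-1) *m Y).

Definition gns_detailed_balance sigma L : Prop :=
  forall X Y, gns_ip sigma (L X) Y = gns_ip sigma X (L Y).

Definition Gamma sigma (s : R) X : 'M[R[i]]_n :=
  mxpow sigma (s / 2) *m X *m mxpow sigma (s / 2).

Definition hat (p : R) : R := p / (p - 1).

(* The traces and inner products below are real (for Hermitian sigma and X and
   Hermitian-preserving L); complex.Re only moves them from R[i] to R. *)
Definition pnorm sigma (p : R) X : R :=
  complex.Re (\tr (mxpow (mxabs (Gamma sigma p^-1 X)) p)) `^ p^-1.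

Definition dirichlet_p sigma L (p : R) X : R :=
  - (hat p * p / 4) *
  complex.Re
    (kms_ip sigma
       (Gamma sigma (- (hat p)^-1) (mxpow (Gamma sigma p^-1 X) (p - 1)))
       (L X)).

Definition dirichlet_1 sigma L X : R :=
  - 4^-1 *
  complex.Re (kms_ip sigma (mxlog (Gamma sigma 1 X) - mxlog sigma) (L X)).

Definition ent_1 sigma X : R :=
  complex.Re (\tr (Gamma sigma 1 X *m (mxlog (Gamma sigma 1 X) - mxlog sigma)))
  - pnorm sigma 1 X * ln (pnorm sigma 1 X).

Definition beckner sigma L (p a : R) : Prop :=
  forall X, posdef X ->
    a * hat p * (pnorm sigma p X `^ p - pnorm sigma 1 X `^ p)
      <= dirichlet_p sigma L p X.

Definition mlsi sigma L (a : R) : Prop :=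
  forall X, posdef X -> a * ent_1 sigma X <= dirichlet_1 sigma L X.

(* The inequalities below are closed conditions on a, so a finite supremum is a
   maximum.  The value +oo occurs for n = 1, where both sides vanish. *)
Definition optimal_constant (C : R -> Prop) : \bar R :=
  ereal_sup [set a%:E | a in [set a : R | C a]].

Definition alpha_p sigma L (p : R) : \bar R :=
  optimal_constant (beckner sigma L p).

Definition alpha_1 sigma L : \bar R := optimal_constant (mlsi sigma L).

End Semigroups.

(* Main.v *)
Require Import Defs.
From mathcomp Require Import all_boot all_order all_algebra.
From mathcomp Require Import complex.
From mathcomp Require Import all_classical all_reals all_analysis.
From mathcomp Require Import ring lra.
Import Order.TTheory GRing.Theory Num.Theory.
Import numFieldNormedType.Exports.
Local Open Scope ring_scope.
Local Open Scope classical_set_scope.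
Local Open Scope complex_scope.
Local Open Scope sesquilinear_scope.

Set Implicit Arguments.
Unset Strict Implicit.
Unset Printing Implicit Defensive.

(** Write ln_q x = (x^(q-1) - 1) / (q - 1) for q > 1 and ln_1 = ln. For X > 0 put
    Y = Gamma^(1/q) X, S = sigma^(1/q) and
      D_q(X) = q Re Tr ((ln_q Y - ln_q S) Y),
      E_q(X) = - (q^2 / 4) Re Tr ((ln_q Y - ln_q S) Gamma^(1/q) (L X)).
    When Tr (sigma X) = 1, these are the two sides of the q-Beckner inequality for
    q > 1 and of the modified log-Sobolev inequality for q = 1, and homogeneity
    reduces both inequalities to such X ([qbecknerP], [mlsiP]). In this form
    nothing is singular at q = 1: on eigenvectors of sigma the differences of
    q-logarithms become divided differences, and D_q, E_q become quadratic
    expressions in Gamma^(1/q) (X - 1) ([qentropyE], [qdirichletE]). The mean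
    value theorem gives the continuity of the divided differences up to q = 1.

    Hence, for fixed X, an inequality valid for exponents q tending to 1 holds at
    q = 1 ([qbeckner_limit]), and alpha_1 is at least the upper limit.

    For the lower limit, suppose that a' > a is valid at exponent 1 while a fails
    for exponents accumulating at 1. Choose normalized X_q violating the
    inequality; along an ultrafilter they converge to some X0 ([density_mcvg]),
    since the Gamma X_q are density matrices. There are two cases.

    If X0 is positive definite, divide both functionals by the square of the size
    of X_q - 1, so that the case X0 = 1 is covered too. The quotients converge to
    the same quadratic forms as those for the constant exponent 1, and the first
    form is positive; the inequality with a' and its failure with a < a'
    contradict each other ([limit_singular]).

    If X0 is singular, D_q (X_q) stays bounded while E_q (X_q) tends to infinity
    ([limit_posdef]). Eigenvalues of Y tending to 0 have q-logarithm tending to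
    minus infinity, and enter E_q with weight the flow of L X_q into the
    eigenvector. Complete positivity bounds this flow below by the eigenvalue
    times a bounded rate ([eigenvector_rate]), so the terms of E_q are bounded
    below, and irreducibility makes some flow positive in the limit
    ([generator_irreducible]).

    Irreducibility uses primitivity and detailed balance. If no mass flows into
    the kernel of a state, with projection Q, the carre du champ of Q vanishes
    on the complement of the kernel ([generator_kernel]), so that
    L (X Q) (1 - Q) = X L(Q) (1 - Q) for all X.
    GNS symmetry makes L commute with the modular operator of sigma and turns this
    identity into its mirror image; together they force L Q = 0
    ([generator_projection]). Then sigma^(1/2) Q sigma^(1/2) is invariant, and
    primitivity makes Q a scalar. *)

(** * Adjoints and sesquilinear forms *)

Section Adjoint.
Variable R : realType.
Local Notation C := R[i].

Lemma ReD (x y : C) : complex.Re (x + y) = complex.Re x + complex.Re y.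
Proof. by case: x; case: y. Qed.

Lemma ReN (x : C) : complex.Re (- x) = - complex.Re x.
Proof. by case: x. Qed.

Lemma ReZ (a : R) (x : C) : complex.Re (a%:C * x) = a * complex.Re x.
Proof. by case: x => x y /=; rewrite mul0r subr0. Qed.

Lemma Re_sum I (r : seq I) (Q : pred I) (F : I -> C) :
  complex.Re (\sum_(i <- r | Q i) F i) = \sum_(i <- r | Q i) complex.Re (F i).
Proof. exact: (big_morph (@complex.Re R) ReD). Qed.

Lemma Re_conj (x : C) : complex.Re (Num.conj x) = complex.Re x.
Proof. by case: x. Qed.

Lemma Im_conj (x : C) : complex.Im (Num.conj x) = - complex.Im x.
Proof. by case: x. Qed.

Lemma conj_real (a : R) : Num.conj (a%:C : C) = a%:C.
Proof. exact: conjc_real. Qed.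

Lemma ge0_ReP (x : C) : 0 <= x -> x = (complex.Re x)%:C.
Proof. by case: x => a b; rewrite lecE /= => /andP[/eqP ->]. Qed.

Lemma Re_ge0 (x : C) : 0 <= x -> 0 <= complex.Re x.
Proof. by case: x => a b; rewrite lecE /= => /andP[]. Qed.

Lemma Re_gt0 (x : C) : 0 < x -> 0 < complex.Re x.
Proof. by case: x => a b; rewrite ltcE /= => /andP[]. Qed.

Lemma adjM m n p (A : 'M[C]_(m, n)) (B : 'M[C]_(n, p)) :
  (A *m B)^t* = B^t* *m A^t*.
Proof. by rewrite trmx_mul map_mxM. Qed.

Lemma adjD m n (A B : 'M[C]_(m, n)) : (A + B)^t* = A^t* + B^t*.
Proof. by rewrite linearD map_mxD. Qed.

Lemma adjN m n (A : 'M[C]_(m, n)) : (- A)^t* = - A^t*.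
Proof. by rewrite linearN map_mxN. Qed.

Lemma adjZ m n (c : C) (A : 'M[C]_(m, n)) : (c *: A)^t* = Num.conj c *: A^t*.
Proof. by rewrite linearZ map_mxZ. Qed.

Lemma adj1 n : (1%:M : 'M[C]_n)^t* = 1%:M.
Proof. by rewrite tr_scalar_mx map_scalar_mx rmorph1. Qed.

(** Dirac's <u|A|v>. *)
Definition bra n (u : 'cV[C]_n) (A : 'M[C]_n) (v : 'cV[C]_n) : C :=
  (u^t* *m A *m v) 0 0.

Lemma braDl n (u u' : 'cV[C]_n) A v : bra (u + u') A v = bra u A v + bra u' A v.
Proof. by rewrite /bra adjD !mulmxDl mxE. Qed.
Lemma braDr n (u : 'cV[C]_n) A v v' : bra u A (v + v') = bra u A v + bra u A v'.
Proof. by rewrite /bra !mulmxDr mxE. Qed.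
Lemma braD n (u : 'cV[C]_n) A B v : bra u (A + B) v = bra u A v + bra u B v.
Proof. by rewrite /bra mulmxDr mulmxDl mxE. Qed.
Lemma braN n (u : 'cV[C]_n) A v : bra u (- A) v = - bra u A v.
Proof. by rewrite /bra mulmxN mulNmx mxE. Qed.
Lemma braB n (u : 'cV[C]_n) A B v : bra u (A - B) v = bra u A v - bra u B v.
Proof. by rewrite braD braN. Qed.
Lemma braZl n c (u : 'cV[C]_n) A v : bra (c *: u) A v = Num.conj c * bra u A v.
Proof. by rewrite /bra adjZ -!scalemxAl mxE. Qed.
Lemma braZr n c (u : 'cV[C]_n) A v : bra u A (c *: v) = c * bra u A v.
Proof. by rewrite /bra -scalemxAr mxE. Qed.
Lemma braZ n c (u : 'cV[C]_n) A v : bra u (c *: A) v = c * bra u A v.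
Proof. by rewrite /bra -scalemxAr -scalemxAl mxE. Qed.
Lemma braMr n (u : 'cV[C]_n) A B v : bra u (A *m B) v = bra u A (B *m v).
Proof. by rewrite /bra !mulmxA. Qed.
Lemma braMl n (u : 'cV[C]_n) A B v : bra u (A *m B) v = bra (A^t* *m u) B v.
Proof. by rewrite /bra adjM trmxCK !mulmxA. Qed.
Lemma bra_tr n (u : 'cV[C]_n) A v : bra u A v = \tr (A *m (v *m u^t*)).
Proof. by rewrite mulmxA mxtrace_mulC mulmxA /bra trace_mx11. Qed.
Lemma bra_adj n (u : 'cV[C]_n) A v : bra v (A^t*) u = Num.conj (bra u A v).
Proof.
rewrite /bra; have -> : v^t* *m A^t* *m u = (u^t* *m A *m v)^t*.
  by rewrite !adjM trmxCK mulmxA.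
by rewrite mxE [in LHS]mxE.
Qed.

Lemma bra1_ge0 n (v : 'cV[C]_n) : 0 <= bra v 1%:M v.
Proof.
rewrite /bra mulmx1 mxE; apply: sumr_ge0 => i _.
by rewrite !mxE mulrC mul_conjC_ge0.
Qed.

Lemma bra1_eq0 n (v : 'cV[C]_n) : bra v 1%:M v = 0 -> v = 0.
Proof.
rewrite /bra mulmx1 mxE => /eqP.
rewrite psumr_eq0; last by move=> i _; rewrite !mxE mulrC mul_conjC_ge0.
move=> /allP v0; apply/colP => i; rewrite mxE.
have := v0 i (mem_index_enum i); rewrite !mxE mulrC mul_conjC_eq0.
by move=> /eqP.
Qed.

Lemma posdef_psd n (A : 'M[C]_n) : posdef A -> psd A.
Proof.
move=> A0 v; have [->|/A0/ltW//] := eqVneq v 0.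
by rewrite mulmx0 mxE.
Qed.

(** Polarization, with the vectors u + v and u + i v. *)
Lemma bra_diag0 n (B : 'M[C]_n) : (forall v, bra v B v = 0) -> B = 0.
Proof.
move=> B0.
have Bi u v : bra u B v = 0.
  have e1 : bra u B v + bra v B u = 0.
    by have := B0 (u + v); rewrite braDl !braDr !B0 add0r addr0.
  have e2 : 'i * (bra u B v - bra v B u) = 0.
    have := B0 (u + 'i *: v); rewrite braDl !braDr !braZl !braZr !B0.
    rewrite !mulr0 add0r addr0 mulrBr => <-; congr (_ + _).
    rewrite -mulNr; congr (_ * _).
    by apply/eqP; rewrite eq_complex /= !oppr0 !eqxx.
  have e3 : bra u B v = bra v B u.
    move/eqP: e2; rewrite mulf_eq0 subr_eq0 => /orP[|/eqP//].
    by rewrite eq_complex /= oner_eq0 andbF.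
  move/eqP: e1; rewrite -e3 -mulr2n mulrn_eq0 /= => /eqP //.
apply/matrixP => i j; rewrite mxE.
have := Bi (delta_mx i 0) (delta_mx j 0).
rewrite /bra trmx_delta map_delta_mx -rowE -colE.
by rewrite !mxE.
Qed.

Lemma psd_herm n (A : 'M[C]_n) : psd A -> A^t* = A.
Proof.
move=> A0; apply/eqP; rewrite -subr_eq0; apply/eqP; apply: bra_diag0 => v.
rewrite braB bra_adj; have := A0 v; rewrite -/(bra v A v) => /ge0_ReP ->.
by rewrite conj_real subrr.
Qed.

End Adjoint.

(** * Functional calculus of Hermitian matrices *)

Lemma mulmx_cancel (K : pzSemiRingType) n (V D U W E X : 'M[K]_n) :
  U *m W = 1%:M -> V *m D *m U *m (W *m E *m X) = V *m (D *m E) *m X.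
Proof. by move=> UW; rewrite !mulmxA -(mulmxA (V *m D) U W) UW mulmx1. Qed.

Lemma mulmx_intertwine (K : pzSemiRingType) n (U' V' D E U V W : 'M[K]_n) :
  U = W *m V -> U' *m W = V' -> D *m W = W *m E ->
  U' *m D *m U = V' *m E *m V.
Proof.
by move=> -> <- DW; rewrite mulmxA -(mulmxA U' D W) DW !mulmxA.
Qed.

Section FunctionalCalculus.
Variable R : realType.
Variable n : nat.
Local Notation C := R[i].
Implicit Types (A B : 'M[C]_n) (U V : 'M[C]_n) (d e : 'I_n -> R).

(** The Hermitian matrix whose eigenvectors are the adjoints of the rows of the
    unitary U, with eigenvalues d. *)
Definition sform U d : 'M[C]_n :=
  U^t* *m diag_mx (\row_i (d i)%:C) *m U.

Lemma eq_diag_conj (V U : 'M[C]_n) (D E : 'rV[C]_n) :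
  D = E -> V *m diag_mx D *m U = V *m diag_mx E *m U.
Proof. by move=> ->. Qed.

Definition eigvec U i : 'cV[C]_n := (row i U)^t*.

Lemma unitary_adjl U : U \is unitarymx -> U^t* *m U = 1%:M.
Proof. by move=> /[dup] /invmx_unitary <- /unitarymx_unit /mulVmx. Qed.

Lemma unitary_adjr U : U \is unitarymx -> U *m U^t* = 1%:M.
Proof. by move/unitarymxP. Qed.

Lemma eq_sform U d e : d =1 e -> sform U d = sform U e.
Proof. by move=> de; apply: eq_diag_conj; apply/rowP => i; rewrite !mxE de. Qed.

Lemma sformM U d e : U \is unitarymx ->
  sform U d *m sform U e = sform U (fun i => d i * e i).
Proof.
move=> /unitary_adjr UU; rewrite /sform (mulmx_cancel _ _ _ _ UU) mulmx_diag.
apply: eq_diag_conj.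
by apply/rowP => i; rewrite !mxE rmorphM.
Qed.

Lemma sformD U d e : sform U d + sform U e = sform U (fun i => d i + e i).
Proof.
rewrite /sform -mulmxDl -mulmxDr -linearD /=; apply: eq_diag_conj.
by apply/rowP => i; rewrite !mxE rmorphD.
Qed.

Lemma sformZ U d (c : R) : c%:C *: sform U d = sform U (fun i => c * d i).
Proof.
rewrite /sform scalemxAl scalemxAr -linearZ /=; apply: eq_diag_conj.
by apply/rowP => i; rewrite !mxE rmorphM.
Qed.

Lemma sform_cst U (c : R) : U \is unitarymx -> sform U (fun=> c) = (c%:C)%:M.
Proof.
move=> /unitary_adjl UU; rewrite /sform.
have -> : (\row_(i < n) c%:C) = const_mx (c%:C) by apply/rowP => i; rewrite !mxE.
by rewrite diag_const_mx -mulmxA mul_scalar_mx -scalemxAr UU scalemx1.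
Qed.

Lemma sform_adj U d : (sform U d)^t* = sform U d.
Proof.
rewrite /sform !adjM trmxCK mulmxA tr_diag_mx map_diag_mx.
apply: eq_diag_conj.
by apply/rowP => i; rewrite !mxE; exact: conj_real.
Qed.

Lemma tr_sform U d : U \is unitarymx -> \tr (sform U d) = (\sum_i d i)%:C.
Proof.
move=> /unitary_adjr UU; rewrite /sform -mulmxA mxtrace_mulC -mulmxA UU mulmx1.
by rewrite mxtrace_diag rmorph_sum; apply: eq_bigr => i _; rewrite mxE.
Qed.

Lemma sformE U d i j :
  sform U d i j = \sum_k (d k)%:C * (Num.conj (U k i) * U k j).
Proof.
rewrite /sform -mulmxA mxE; apply: eq_bigr => k _.
by rewrite mul_diag_mx !mxE mulrCA.
Qed.

Lemma eigvecE U i : eigvec U i = U^t* *m delta_mx i 0.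
Proof. by rewrite /eigvec rowE adjM trmx_delta map_delta_mx. Qed.

Lemma unitary_eigvec U i : U \is unitarymx -> U *m eigvec U i = delta_mx i 0.
Proof. by move=> /unitary_adjr UU; rewrite eigvecE mulmxA UU mul1mx. Qed.

Lemma sform_eigvec U d i : U \is unitarymx ->
  sform U d *m eigvec U i = (d i)%:C *: eigvec U i.
Proof.
move=> Uu; rewrite /sform -!mulmxA unitary_eigvec // eigvecE scalemxAr; congr (_ *m _).
apply/colP => k; rewrite mul_diag_mx !mxE eqxx andbT.
by have [->|] := eqVneq k i; rewrite // !mulr0.
Qed.

Lemma bra_eigvec U i j : U \is unitarymx ->
  bra (eigvec U i) 1%:M (eigvec U j) = (i == j)%:R.
Proof.
move=> Uu; rewrite /bra mulmx1 {1}/eigvec trmxCK -row_mul unitary_eigvec //.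
by rewrite !mxE eqxx andbT.
Qed.

Lemma bra_sform U d v :
  bra v (sform U d) v = (\sum_i d i * complex.Re (`|(U *m v) i 0| ^+ 2))%:C.
Proof.
rewrite rmorph_sum /bra /sform !mulmxA -[_ *m U^t*]trmxCK adjM !trmxCK.
rewrite -mulmxA mxE; apply: eq_bigr => i _.
rewrite mul_mx_diag !mxE rmorphM /=; set w := \sum_j _.
have <- : `|w| ^+ 2 = (complex.Re (`|w| ^+ 2))%:C by apply: ge0_ReP; rewrite exprn_ge0.
by rewrite normCK -mulrA mulrCA [_^* * _]mulrC.
Qed.

Lemma sum_eigvec U : U \is unitarymx -> \sum_i eigvec U i *m (eigvec U i)^t* = 1%:M.
Proof.
move=> /unitary_adjl <-; apply/matrixP => i j; rewrite summxE mxE.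
apply: eq_bigr => k _; rewrite mxE big_ord1 !mxE.
by rewrite conjCK.
Qed.

Lemma tr_bra U A : U \is unitarymx ->
  \tr A = \sum_i bra (eigvec U i) A (eigvec U i).
Proof.
move=> Uu; rewrite -{1}[A]mulmx1 -(sum_eigvec Uu) mulmx_sumr raddf_sum.
by apply: eq_bigr => i _; rewrite bra_tr.
Qed.

Lemma herm_sform A : A^t* = A -> A = sform (spectralmx A)
  (fun i => complex.Re (spectral_diag A 0 i)).
Proof.
move=> Ah.
have Ahs : A \is hermsymmx.
  by apply/is_hermitianmxP; rewrite expr0 scale1r Ah.
rewrite [LHS](orthomx_spectralP (hermitian_normalmx Ahs)).
rewrite (invmx_unitary (spectral_unitarymx A)); apply: eq_diag_conj.
apply/rowP => i; rewrite !mxE RRe_real //.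
by have /mxOverP := hermitian_spectral_diag_real Ahs; apply.
Qed.

Lemma mxfun_spectral f A : mxfun f A = sform (spectralmx A)
  (fun i => f (complex.Re (spectral_diag A 0 i))).
Proof. by rewrite /mxfun (invmx_unitary (spectral_unitarymx A)). Qed.

Lemma mul_swap (D : idomainType) (a b w : D) : a * w = w * b -> a = b \/ w = 0.
Proof.
move=> /eqP; rewrite (mulrC w) -subr_eq0 -mulrBl mulf_eq0 subr_eq0.
by case/orP => /eqP ->; [left|right].
Qed.

(** The change of basis between two diagonalizations only links equal
    eigenvalues, so it intertwines f of one with f of the other. *)
Lemma sform_fun_unique U V d e (f : R -> R) :
  U \is unitarymx -> V \is unitarymx -> sform U d = sform V e ->
  sform U (f \o d) = sform V (f \o e).
Proof.
move=> Uu Vu Ude.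
pose W := U *m V^t*.
have int g h : sform U g = sform V h ->
    diag_mx (\row_i (g i)%:C) *m W = W *m diag_mx (\row_i (h i)%:C).
  move=> gh; have : U *m sform U g *m V^t* = U *m sform V h *m V^t* by rewrite gh.
  rewrite /sform !mulmxA (unitary_adjr Uu) mul1mx -!mulmxA => ->.
  by rewrite (unitary_adjr Vu) mulmx1 !mulmxA.
have dW := int _ _ Ude.
have fW : diag_mx (\row_i ((f \o d) i)%:C) *m W = W *m diag_mx (\row_i ((f \o e) i)%:C).
  apply/matrixP => i j; move/matrixP: dW => /(_ i j).
  rewrite !mul_diag_mx !mul_mx_diag !mxE /= -/W => /mul_swap[/complexI ->|->].
    exact: mulrC.
  by rewrite mulr0 mul0r.
have UE : U = W *m V by rewrite /W -mulmxA (unitary_adjl Vu) mulmx1.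
have UW : U^t* *m W = V^t* by rewrite /W mulmxA (unitary_adjl Uu) mul1mx.
exact: mulmx_intertwine UE UW fW.
Qed.

Lemma mxfun_sform f U d : U \is unitarymx ->
  mxfun f (sform U d) = sform U (f \o d).
Proof.
move=> Uu; rewrite mxfun_spectral; symmetry.
apply: sform_fun_unique; rewrite ?spectral_unitarymx //.
by rewrite -herm_sform // sform_adj.
Qed.

Lemma herm_sformP A : A^t* = A -> exists U d, U \is unitarymx /\ A = sform U d.
Proof.
move=> /herm_sform Ah; do 2 eexists; split; last exact: Ah.
exact: spectral_unitarymx.
Qed.

Lemma eigval_bra U d i : U \is unitarymx ->
  bra (eigvec U i) (sform U d) (eigvec U i) = (d i)%:C.
Proof.
move=> Uu; rewrite -[sform U d]mul1mx braMr sform_eigvec // braZr bra_eigvec //.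
by rewrite eqxx mulr1.
Qed.

Lemma eigvec_neq0 U i : U \is unitarymx -> eigvec U i != 0.
Proof.
move=> Uu; apply/eqP => e0; have := bra_eigvec i i Uu.
by rewrite e0 /bra mulmx0 mxE eqxx => /eqP; rewrite eq_sym oner_eq0.
Qed.

Lemma psd_sform U d : U \is unitarymx ->
  psd (sform U d) <-> (forall i, 0 <= d i).
Proof.
move=> Uu; split=> [A0 i|d0 v].
  by rewrite -ler0c -(eigval_bra d i Uu) A0.
rewrite -/(bra v _ v) bra_sform ler0c; apply: sumr_ge0 => i _.
by rewrite mulr_ge0 // Re_ge0 // exprn_ge0.
Qed.

Lemma posdef_sform U d : U \is unitarymx ->
  posdef (sform U d) <-> (forall i, 0 < d i).
Proof.
move=> Uu; split=> [A0 i|d0 v vn0].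
  by rewrite -ltcR -(eigval_bra d i Uu) A0 // eigvec_neq0.
rewrite -/(bra v _ v) bra_sform ltcR lt_neqAle; apply/andP; split; last first.
  apply: sumr_ge0 => i _.
  by rewrite mulr_ge0 ?(ltW (d0 i)) // Re_ge0 // exprn_ge0.
rewrite eq_sym; apply: contra vn0; rewrite psumr_eq0 => [/allP H|]; last first.
  by move=> i _; rewrite mulr_ge0 ?(ltW (d0 i)) // Re_ge0 // exprn_ge0.
suff : U *m v = 0.
  by move=> Uv; rewrite -[v]mul1mx -(unitary_adjl Uu) -mulmxA Uv mulmx0.
apply/colP => i; have := H i (mem_index_enum i).
rewrite mulf_eq0 gt_eqF // orFb => /eqP Re0.
have /ge0_ReP : 0 <= `|(U *m v) i 0| ^+ 2 by rewrite exprn_ge0.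
rewrite Re0 => /eqP; rewrite sqrf_eq0 normr_eq0 => /eqP ->.
by rewrite mxE.
Qed.

Lemma psd_sformP A : psd A ->
  exists U d, [/\ U \is unitarymx, A = sform U d & forall i, 0 <= d i].
Proof.
move=> A0; have [U [d [Uu AE]]] := herm_sformP (psd_herm A0).
by exists U, d; split=> //; apply/(psd_sform _ Uu); rewrite -AE.
Qed.

Lemma posdef_sformP A : posdef A ->
  exists U d, [/\ U \is unitarymx, A = sform U d & forall i, 0 < d i].
Proof.
move=> A0; have [U [d [Uu AE]]] := herm_sformP (psd_herm (posdef_psd A0)).
by exists U, d; split=> //; apply/(posdef_sform _ Uu); rewrite -AE.
Qed.

Lemma mxfun_herm f A : (mxfun f A)^t* = mxfun f A.
Proof. by rewrite mxfun_spectral sform_adj. Qed.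

Lemma mxfunM f g A : mxfun f A *m mxfun g A = mxfun (fun x => f x * g x) A.
Proof. by rewrite !mxfun_spectral sformM ?spectral_unitarymx. Qed.

Lemma mxfunD f g A : mxfun f A + mxfun g A = mxfun (fun x => f x + g x) A.
Proof. by rewrite !mxfun_spectral sformD. Qed.

Lemma mxfunB f g A : mxfun f A - mxfun g A = mxfun (fun x => f x - g x) A.
Proof.
rewrite !mxfun_spectral -scaleN1r -[-1](rmorphN1 (real_complex R)) sformZ sformD.
by apply: eq_sform => i; rewrite mulN1r.
Qed.

Lemma mxfunZ c f A : c%:C *: mxfun f A = mxfun (fun x => c * f x) A.
Proof. by rewrite !mxfun_spectral sformZ. Qed.

Lemma mxfun_cst c A : mxfun (fun=> c) A = (c%:C)%:M.
Proof. by rewrite mxfun_spectral sform_cst ?spectral_unitarymx. Qed.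

Lemma mxfun_subC f c A : mxfun f A - (c%:C)%:M = mxfun (fun x => f x - c) A.
Proof. by rewrite -(mxfun_cst c A) mxfunB. Qed.

Lemma mxfun_id A : A^t* = A -> mxfun id A = A.
Proof. by move=> /herm_sform Ah; rewrite mxfun_spectral -Ah. Qed.

Lemma sub_scalar_mxfun c A : A^t* = A -> A - (c%:C)%:M = mxfun (fun x => x - c) A.
Proof. by move=> Ah; rewrite -mxfun_subC (mxfun_id Ah). Qed.

Lemma eq_mxfun f g A : posdef A -> (forall x, 0 < x -> f x = g x) ->
  mxfun f A = mxfun g A.
Proof.
move=> /posdef_sformP [U [d [Uu -> d0]]] fg; rewrite !(mxfun_sform _ _ Uu).
by apply: eq_sform => i /=; rewrite fg.
Qed.

Lemma mxfun_comp f g A : mxfun f (mxfun g A) = mxfun (f \o g) A.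
Proof. by rewrite !(mxfun_spectral _ A) mxfun_sform ?spectral_unitarymx. Qed.

Lemma posdef_mxfun f A : posdef A -> (forall x, 0 < x -> 0 < f x) ->
  posdef (mxfun f A).
Proof.
move=> /posdef_sformP [U [d [Uu -> d0]]] f0; rewrite mxfun_sform //.
by apply/posdef_sform => // i; apply: f0.
Qed.

Lemma psd_tr_ge0 A : psd A -> 0 <= \tr A.
Proof.
move=> /psd_sformP[U [d [Uu -> d0]]]; rewrite tr_sform // ler0c.
by apply: sumr_ge0 => i _.
Qed.

Lemma posdef_tr_gt0 A : (0 < n)%N -> posdef A -> 0 < \tr A.
Proof.
move=> n0 /posdef_sformP[U [d [Uu -> d0]]]; rewrite tr_sform // ltcR.
rewrite (bigD1 (Ordinal n0)) //= ltr_wpDr //.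
by apply: sumr_ge0 => i _; exact: ltW.
Qed.

Lemma psd_gramP (A : 'M[C]_n) : psd A -> exists B, A = B *m B^t*.
Proof.
move=> /psd_sformP[U [d [Uu -> d0]]]; exists (sform U (Num.sqrt \o d)).
rewrite sform_adj (sformM _ _ Uu); apply: eq_sform => i /=.
by rewrite -expr2 sqr_sqrtr.
Qed.

Lemma gram_psd m (B : 'M[C]_(n, m)) : psd (B *m B^t*).
Proof.
move=> v; have := bra1_ge0 (B^t* *m v).
by rewrite /bra adjM trmxCK mulmx1 !mulmxA.
Qed.

Lemma psd_conj A B : psd A -> psd (B *m A *m B^t*).
Proof.
move=> /psd_gramP[D ->]; rewrite !mulmxA -mulmxA -adjM; exact: gram_psd.
Qed.

Lemma posdef_conj A B : B \in unitmx -> posdef A -> posdef (B *m A *m B^t*).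
Proof.
move=> Bu A0 v v0; rewrite -/(bra v _ v) -mulmxA braMl braMr.
apply: A0; apply: contra v0 => /eqP Bv; apply/eqP.
have : (invmx B)^t* *m (B^t* *m v) = 0 by rewrite Bv mulmx0.
by rewrite mulmxA -adjM mulmxV // adj1 mul1mx.
Qed.

Lemma posdef_unit A : posdef A -> A \in unitmx.
Proof.
move=> /posdef_sformP[U [d [Uu -> d0]]].
have : sform U d *m sform U (fun i => (d i)^-1) = 1%:M.
  rewrite (sformM _ _ Uu) -(sform_cst 1 Uu); apply: eq_sform => i.
  by rewrite mulfV // gt_eqF.
by move=> /mulmx1_unit[H _]; exact: H.
Qed.

Lemma psd_unit_posdef A : psd A -> A \in unitmx -> posdef A.
Proof.
move=> /psd_sformP[U [d [Uu AE d0]]] Au; rewrite AE; apply/posdef_sform => // i.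
rewrite lt_neqAle d0 andbT eq_sym; apply/eqP => di0.
have := sform_eigvec d i Uu; rewrite di0 scale0r -AE => Ae.
by have := eigvec_neq0 i Uu; rewrite -[eigvec U i]mul1mx -(mulVmx Au) -mulmxA Ae mulmx0 eqxx.
Qed.

End FunctionalCalculus.

(** * Entrywise convergence of matrices *)

(** Real and imaginary parts are handled separately, so that all limits are taken
    in the topology of R. *)
Definition ccvg (R : realType) (T : Type) (F : set_system T) (z : T -> R[i])
    (l : R[i]) : Prop :=
  complex.Re (z t) @[t --> F] --> complex.Re l /\
  complex.Im (z t) @[t --> F] --> complex.Im l.

Definition mcvg (R : realType) (T : Type) (F : set_system T) m n
    (A : T -> 'M[R[i]]_(m, n)) (L : 'M[R[i]]_(m, n)) : Prop :=
  forall i j, ccvg F (fun t => A t i j) (L i j).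

Section Limits.
Variables (R : realType) (T : Type) (F : set_system T).
Context {FF : ProperFilter F}.
Local Notation C := R[i].

Lemma ccvg_cst (l : C) : ccvg F (fun=> l) l.
Proof. by split; exact: cvg_cst. Qed.

Lemma eq_ccvg (z w : T -> C) l : z =1 w -> ccvg F z l -> ccvg F w l.
Proof. by move=> /funext ->. Qed.

Lemma ccvgD (z w : T -> C) k l :
  ccvg F z k -> ccvg F w l -> ccvg F (fun t => z t + w t) (k + l).
Proof.
have ImD (x y : C) : complex.Im (x + y) = complex.Im x + complex.Im y.
  by case: x; case: y.
move=> [z1 z2] [w1 w2]; split.
  by rewrite ReD; under eq_fun do rewrite ReD; exact: cvgD.
by rewrite ImD; under eq_fun do rewrite ImD; exact: cvgD.
Qed.

Lemma ccvgM (z w : T -> C) k l :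
  ccvg F z k -> ccvg F w l -> ccvg F (fun t => z t * w t) (k * l).
Proof.
have ReM (x y : C) :
    complex.Re (x * y) = complex.Re x * complex.Re y - complex.Im x * complex.Im y.
  by case: x; case: y.
have ImM (x y : C) :
    complex.Im (x * y) = complex.Re x * complex.Im y + complex.Im x * complex.Re y.
  by case: x; case: y.
move=> [z1 z2] [w1 w2]; split.
  by rewrite ReM; under eq_fun do rewrite ReM; apply: cvgB; exact: cvgM.
by rewrite ImM; under eq_fun do rewrite ImM; apply: cvgD; exact: cvgM.
Qed.

Lemma ccvg_conj (z : T -> C) l :
  ccvg F z l -> ccvg F (fun t => Num.conj (z t)) (Num.conj l).
Proof.
move=> [z1 z2]; split.
  by rewrite Re_conj; under eq_fun do rewrite Re_conj.
by rewrite Im_conj; under eq_fun do rewrite Im_conj; exact: cvgN.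
Qed.

Lemma ccvg_real (r : T -> R) (l : R) :
  r t @[t --> F] --> l -> ccvg F (fun t => (r t)%:C) (l%:C).
Proof. by move=> rl; split => //=; exact: cvg_cst. Qed.

Lemma ccvg_sum (I : finType) (z : I -> T -> C) (l : I -> C) :
  (forall i, ccvg F (z i) (l i)) ->
  ccvg F (fun t => \sum_i z i t) (\sum_i l i).
Proof.
move=> zl; elim: (index_enum I) => [|i s IHs].
  by apply: (@eq_ccvg (fun=> 0)) => [t|]; rewrite big_nil //; exact: ccvg_cst.
apply: (@eq_ccvg (fun t => z i t + \sum_(j <- s) z j t)) => [t|].
  by rewrite big_cons.
by rewrite big_cons; exact: ccvgD.
Qed.

Lemma ccvg_unique (z : T -> C) k l : ccvg F z k -> ccvg F z l -> k = l.
Proof.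
move=> [z1 z2] [w1 w2]; apply/eqP; rewrite eq_complex.
by rewrite (cvg_unique _ z1 w1) ?(cvg_unique _ z2 w2) ?eqxx //; exact: norm_hausdorff.
Qed.

Lemma mcvg_cst m n (L : 'M[C]_(m, n)) : mcvg F (fun=> L) L.
Proof. by move=> i j; exact: ccvg_cst. Qed.

Lemma eq_mcvg m n (A B : T -> 'M[C]_(m, n)) L :
  A =1 B -> mcvg F A L -> mcvg F B L.
Proof. by move=> /funext ->. Qed.

Lemma mcvgM m n p (A : T -> 'M[C]_(m, n)) (B : T -> 'M[C]_(n, p)) K L :
  mcvg F A K -> mcvg F B L -> mcvg F (fun t => A t *m B t) (K *m L).
Proof.
move=> AK BL i j; rewrite mxE.
apply: (@eq_ccvg (fun t => \sum_k A t i k * B t k j)) => [t|]; first by rewrite mxE.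
by apply: ccvg_sum => k; exact: ccvgM.
Qed.

Lemma mcvgZ m n (z : T -> C) (A : T -> 'M[C]_(m, n)) l L :
  ccvg F z l -> mcvg F A L -> mcvg F (fun t => z t *: A t) (l *: L).
Proof.
move=> zl AL i j; rewrite mxE.
by apply: eq_ccvg (ccvgM zl (AL i j)) => t; rewrite mxE.
Qed.

Lemma mcvg_adj m n (A : T -> 'M[C]_(m, n)) L :
  mcvg F A L -> mcvg F (fun t => (A t)^t*) (L^t*).
Proof.
move=> AL i j; rewrite mxE [in X in ccvg _ _ X]mxE.
by apply: eq_ccvg (ccvg_conj (AL j i)) => t; rewrite !mxE.
Qed.

Lemma mcvg_sum (I : finType) m n (A : I -> T -> 'M[C]_(m, n)) L :
  (forall i, mcvg F (A i) (L i)) -> mcvg F (fun t => \sum_i A i t) (\sum_i L i).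
Proof.
move=> AL i j; rewrite summxE.
apply: (@eq_ccvg (fun t => \sum_k A k t i j)) => [t|]; first by rewrite summxE.
by apply: ccvg_sum => k; exact: AL.
Qed.

Lemma mcvg_tr n (A : T -> 'M[C]_n) L :
  mcvg F A L -> ccvg F (fun t => \tr (A t)) (\tr L).
Proof. by move=> AL; apply: ccvg_sum => i; exact: AL. Qed.

Lemma mcvg_bra n (u v : T -> 'cV[C]_n) (A : T -> 'M[C]_n) u0 v0 L :
  mcvg F u u0 -> mcvg F A L -> mcvg F v v0 ->
  ccvg F (fun t => bra (u t) (A t) (v t)) (bra u0 L v0).
Proof.
move=> uc AL vc; rewrite /bra.
exact: (mcvgM (mcvgM (mcvg_adj uc) AL) vc).
Qed.

Lemma mcvg_unique m n (A : T -> 'M[C]_(m, n)) K L :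
  mcvg F A K -> mcvg F A L -> K = L.
Proof. by move=> AK AL; apply/matrixP => i j; exact: ccvg_unique (AK i j) (AL i j). Qed.

Lemma mcvg_linear m n p q (L : {linear 'M[C]_(m, n) -> 'M[C]_(p, q)})
    (A : T -> 'M[C]_(m, n)) A0 :
  mcvg F A A0 -> mcvg F (fun t => L (A t)) (L A0).
Proof.
have LE B : L B = \sum_i \sum_j B i j *: L (delta_mx i j).
  rewrite {1}(matrix_sum_delta B) linear_sum; apply: eq_bigr => i _.
  by rewrite linear_sum; apply: eq_bigr => j _; rewrite linearZ.
move=> AA0; rewrite LE.
apply: eq_mcvg => [t|]; first by rewrite LE.
by apply: mcvg_sum => i; apply: mcvg_sum => j; apply: mcvgZ (AA0 i j) (mcvg_cst _).
Qed.

Lemma ccvg_ge0 (z : T -> C) l : (\forall t \near F, 0 <= z t) ->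
  ccvg F z l -> 0 <= l.
Proof.
move=> z0 [zl1 zl2]; rewrite lecE /=; apply/andP; split.
  have zl2' : complex.Im (z t) @[t --> F] --> (0 : R).
    have H : (fun=> 0 : R) @ F --> (0 : R) by exact: cvg_cst.
    apply: cvg_trans H; apply: near_eq_cvg.
    by apply: filterS z0 => t /ger0_Im ->.
  by apply/eqP; apply: cvg_unique zl2 zl2'; exact: norm_hausdorff.
by apply: (cvgr_to_ge zl1); apply: filterS z0 => t; exact: Re_ge0.
Qed.

Lemma mcvg_psd n (A : T -> 'M[C]_n) L : (forall t, psd (A t)) -> mcvg F A L -> psd L.
Proof.
move=> A0 AL v; rewrite -/(bra v L v).
apply: (@ccvg_ge0 (fun t => bra v (A t) v)); first by apply: nearW => t; exact: A0.
by apply: mcvg_bra => //; exact: mcvg_cst.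
Qed.

Lemma mcvg_sform n (U : T -> 'M[C]_n) U0 (d : T -> 'I_n -> R) d0 :
  mcvg F U U0 -> (forall i, d t i @[t --> F] --> d0 i) ->
  mcvg F (fun t => sform (U t) (d t)) (sform U0 d0).
Proof.
move=> UU0 dd0 i j; rewrite sformE.
apply: eq_ccvg => [t|]; first by rewrite sformE.
apply: ccvg_sum => k; apply: ccvgM; first exact: ccvg_real.
by apply: ccvgM => //; exact: ccvg_conj.
Qed.

Lemma mcvg_eigvec n (U : T -> 'M[C]_n) U0 i : mcvg F U U0 ->
  mcvg F (fun t => eigvec (U t) i) (eigvec U0 i).
Proof.
move=> UU0; apply: mcvg_adj => j k; rewrite mxE.
by apply: eq_ccvg (UU0 i k) => t; rewrite mxE.
Qed.

End Limits.

(** * Compactness along ultrafilters *)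

Section Ultra.
Variables (R : realType) (T : Type) (F : set_system T).
Hypothesis FU : UltraFilter F.
Local Notation C := R[i].
#[local] Instance ultra_properF : ProperFilter F := @ultra_proper _ _ FU.

Lemma ultra_bounded_cvg (f : T -> R) (M : R) : (forall t, `|f t| <= M) ->
  exists l : R, f t @[t --> F] --> l.
Proof.
move=> fM.
have FfM : F (f @^-1` `[- M, M]).
  apply: (filterS _ filterT) => t _ /=; rewrite in_itv /= -ler_norml; exact: fM.
have [l [_ lcl]] := @segment_compact R (- M) M (f @ F) (fmap_proper_filter f _) FfM.
exists l => B lB; have [//|FnB] := in_ultra_setVsetC (f @^-1` B) FU.
by have [y [/= nBy By]] := lcl (~` B) B FnB lB.
Qed.

Lemma ultra_mcvg m n (A : T -> 'M[C]_(m, n)) (M : R) :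
  (forall t i j, `|complex.Re (A t i j)| <= M /\ `|complex.Im (A t i j)| <= M) ->
  exists L, mcvg F A L.
Proof.
move=> AM.
pose l1 i j := xget 0 [set l : R | complex.Re (A t i j) @[t --> F] --> l].
pose l2 i j := xget 0 [set l : R | complex.Im (A t i j) @[t --> F] --> l].
exists (\matrix_(i, j) Complex (l1 i j) (l2 i j)) => i j; rewrite mxE; split => /=.
- have [l ll] := ultra_bounded_cvg (fun t => proj1 (AM t i j)).
  exact: (@xgetPex _ 0 [set l : R | complex.Re (A t i j) @[t --> F] --> l] (ex_intro _ l ll)).
- have [l ll] := ultra_bounded_cvg (fun t => proj2 (AM t i j)).
  exact: (@xgetPex _ 0 [set l : R | complex.Im (A t i j) @[t --> F] --> l] (ex_intro _ l ll)).
Qed.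

Lemma Re_norm_le (z : C) (M : R) : 0 <= M -> `|z| ^+ 2 <= (M ^+ 2)%:C ->
  `|complex.Re z| <= M /\ `|complex.Im z| <= M.
Proof.
move=> M0; rewrite -add_Re2_Im2 lecR => zM; split; rewrite -(ler_pXn2r (ltn0Sn 1)) ?nnegrE //.
  by rewrite real_normK ?num_real // (le_trans _ zM) // lerDl sqr_ge0.
by rewrite real_normK ?num_real // (le_trans _ zM) // lerDr sqr_ge0.
Qed.

Lemma unitary_entry n (U : 'M[C]_n) i j : U \is unitarymx ->
  `|complex.Re (U i j)| <= 1 /\ `|complex.Im (U i j)| <= 1.
Proof.
move=> Uu; apply: Re_norm_le; first exact: ler01.
rewrite expr1n rmorph1.
have /matrixP/(_ i i) := unitary_adjr Uu; rewrite mxE [RHS]mxE eqxx mulr1n => <-.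
rewrite (bigD1 j) // !mxE -normCK lerDl; apply: sumr_ge0 => k _.
by rewrite !mxE -normCK exprn_ge0.
Qed.

Lemma ultra_unitary n (U : T -> 'M[C]_n) : (forall t, U t \is unitarymx) ->
  exists2 V, V \is unitarymx & mcvg F U V.
Proof.
move=> Uu; have [V UV] := ultra_mcvg (fun t i j => unitary_entry i j (Uu t)).
exists V => //; apply/unitarymxP.
have UU1 : mcvg F (fun t => U t *m (U t)^t*) 1%:M.
  apply: eq_mcvg (mcvg_cst 1%:M) => t; rewrite unitary_adjr //.
exact: (mcvg_unique (mcvgM UV (mcvg_adj UV)) UU1).
Qed.

(** Eigenvectors vary discontinuously, but along an ultrafilter the whole
    eigenbasis converges by compactness of the unitary group. *)
Lemma ultra_spectral n (U : T -> 'M[C]_n) (d : T -> 'I_n -> R) A0 :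
  (forall t, U t \is unitarymx) -> mcvg F (fun t => sform (U t) (d t)) A0 ->
  exists V d0, [/\ V \is unitarymx, A0 = sform V d0, mcvg F U V &
    forall i, d t i @[t --> F] --> d0 i].
Proof.
move=> Uu AA0; have [V Vu UV] := ultra_unitary Uu.
pose d0 i := complex.Re (bra (eigvec V i) A0 (eigvec V i)).
have dd0 i : d t i @[t --> F] --> d0 i.
  have [+ _] := mcvg_bra (mcvg_eigvec i UV) AA0 (mcvg_eigvec i UV).
  have -> // : (fun t => complex.Re (bra (eigvec (U t) i) (sform (U t) (d t)) (eigvec (U t) i)))
      = fun t => d t i.
    by apply/funext => t; rewrite (eigval_bra _ _ (Uu t)).
exists V, d0; split => //.
exact: (mcvg_unique AA0 (mcvg_sform UV dd0)).
Qed.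

(** Function and matrix vary together: along the ultrafilter a diagonalization of
    A t converges to one of A0, and mxfun does not depend on the diagonalization. *)
Lemma mcvg_mxfun n (A : T -> 'M[C]_n) A0 (g : T -> R -> R) (g0 : R -> R) :
  (forall t, posdef (A t)) -> mcvg F A A0 -> posdef A0 ->
  (forall (x : T -> R) (x0 : R), (forall t, 0 < x t) -> 0 < x0 ->
    x t @[t --> F] --> x0 ->
    g t (x t) @[t --> F] --> g0 x0) ->
  mcvg F (fun t => mxfun (g t) (A t)) (mxfun g0 A0).
Proof.
move=> Ap AA0 A00 gg0; have Ah t : (A t)^t* = A t := psd_herm (posdef_psd (Ap t)).
have [|V [d0 [Vu A0E UV dd0]]] := @ultra_spectral _ (fun t => spectralmx (A t))
    (fun t i => complex.Re (spectral_diag (A t) 0 i)) A0 (fun t => spectral_unitarymx (A t)).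
  by apply: eq_mcvg AA0 => t; rewrite -herm_sform.
have d0_gt0 : forall i, 0 < d0 i by apply/(posdef_sform _ Vu); rewrite -A0E.
rewrite A0E (mxfun_sform _ _ Vu).
apply: (@eq_mcvg _ _ _ _ _ (fun t => sform (spectralmx (A t))
  (fun i => g t (complex.Re (spectral_diag (A t) 0 i))))) => [t|].
  by rewrite mxfun_spectral.
apply: mcvg_sform => // i; apply: gg0 => // t.
move: i; apply/(posdef_sform _ (spectral_unitarymx (A t))).
by rewrite -(herm_sform (Ah t)); exact: Ap.
Qed.

End Ultra.

(** * The q-logarithm and its divided differences *)

Section Scalar.
Variable R : realType.
Implicit Types q s x : R.

(** The q-logarithm; its derivative is x^(q-2) for every q, including q = 1. *)
Definition qln q x : R := if q == 1 then ln x else (x `^ (q - 1) - 1) / (q - 1).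

Definition qln_slope q s x : R :=
  if x == s then s `^ (q - 2) else (qln q x - qln q s) / (x - s).

(** The Bregman remainder at s of the convex function x^q / (q (q - 1))
    (of x ln x when q = 1), up to the factor q. *)
Definition bregman q s x : R :=
  x * (qln q x - qln q s) - s `^ (q - 1) * (x - s).

Definition bregman_slope q s x : R :=
  if x == s then q * s `^ (q - 2) / 2 else bregman q s x / (x - s) ^+ 2.

Lemma powRE x a : 0 < x -> x `^ a = expR (a * ln x).
Proof. by move=> x0; rewrite /powR gt_eqF. Qed.

Lemma is_derive_qln q x : 0 < x -> is_derive x (1 : R) (qln q) (x `^ (q - 2)).
Proof.
move=> x0; rewrite /qln; have [->|qn1] := eqVneq q 1.
  have -> : (1 - 2 : R) = - 1 by lra.
  by rewrite powR_inv1 ?ltW //; exact: is_derive1_ln.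
have q1 : q - 1 != 0 by rewrite subr_eq0.
have D := is_derive1_powR (q - 1) x0.
have -> : (fun y : R => (y `^ (q - 1) - 1) / (q - 1)) =
  (q - 1)^-1 \*: ((fun y : R => y `^ (q - 1)) - cst 1).
  by apply/funext => y; rewrite /= mulrC.
apply: is_derive_eq.
rewrite subr0 [LHS]mulKf //; congr (_ `^ _); ring.
Qed.

Lemma qln_slopeE q s x : qln q x - qln q s = qln_slope q s x * (x - s).
Proof.
rewrite /qln_slope; case: eqVneq => [->|xs]; first by rewrite !subrr mulr0.
by rewrite divfK // subr_eq0.
Qed.

Lemma bregman_slopeE q s x : bregman q s x = bregman_slope q s x * (x - s) ^+ 2.
Proof.
rewrite /bregman_slope; case: eqVneq => [->|xs].
  by rewrite /bregman !subrr !mulr0 subrr expr0n mulr0.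
by rewrite divfK // expf_neq0 // subr_eq0.
Qed.

Lemma MVT_pos (f df : R -> R) s x : 0 < s -> 0 < x ->
  (forall y : R, 0 < y -> is_derive y (1 : R) f (df y)) ->
  exists xi, [/\ 0 < xi, x != s -> xi != s, `|xi - s| <= `|x - s| &
    f x - f s = df xi * (x - s)].
Proof.
have ltc (a b : R) : 0 < a -> (forall y : R, 0 < y -> is_derive y (1 : R) f (df y)) ->
    {within `[a, b], continuous f}.
  move=> a0 fdf; apply: derivable_within_continuous => y; rewrite in_itv /= => /andP[ay _].
  by have [] := fdf y (lt_le_trans a0 ay).
move=> s0 x0 fdf.
have drv (a b : R) : 0 < a -> forall y, y \in `]a, b[%R -> is_derive y (1 : R) f (df y).
  by move=> a0 y; rewrite in_itv /= => /andP[ay _]; apply: fdf; exact: lt_trans ay.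
have [sx|xs|->] := ltgtP s x; last first.
- by exists x; rewrite !subrr mulr0 eqxx.
- have [c] := MVT xs (drv x s x0) (ltc x s x0 fdf).
  rewrite in_itv /= => /andP[xc cs] E; exists c; split; [exact: lt_trans xc|by rewrite lt_eqF| |].
    by rewrite !ler0_norm ?subr_le0 ?(ltW cs) ?(ltW xs) // lerN2 lerD2r ltW.
  by rewrite -opprB E; ring.
- have [c] := MVT sx (drv s x s0) (ltc s x s0 fdf).
  rewrite in_itv /= => /andP[xc cs] E; exists c; split; [exact: lt_trans xc|by rewrite gt_eqF| |].
    by rewrite !ger0_norm ?subr_ge0 ?(ltW xc) ?(ltW sx) // lerD2r ltW.
  by rewrite E.
Qed.

Lemma qln_slope_mvt q s x : 0 < s -> 0 < x ->
  exists xi, [/\ 0 < xi, `|xi - s| <= `|x - s| & qln_slope q s x = xi `^ (q - 2)].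
Proof.
move=> s0 x0; rewrite /qln_slope; case: eqVneq => [->|xs].
  by exists s; rewrite lexx.
have [xi [xi0 _ xis E]] := MVT_pos s0 x0 (fun y y0 => is_derive_qln q y0).
by exists xi; split => //; rewrite E mulfK // subr_eq0.
Qed.

Lemma qln_slope_gt0 q s x : 0 < s -> 0 < x -> 0 < qln_slope q s x.
Proof.
by move=> s0 x0; have [xi [xi0 _ ->]] := qln_slope_mvt q s0 x0; exact: powR_gt0.
Qed.

Lemma qln_le q x y : 0 < x -> x <= y -> qln q x <= qln q y.
Proof.
move=> x0 xy; rewrite -subr_ge0 qln_slopeE mulr_ge0 ?subr_ge0 //.
by rewrite ltW // qln_slope_gt0 // (lt_le_trans x0).
Qed.

Lemma powR_qln q x : 0 < x -> x `^ (q - 1) = 1 + (q - 1) * qln q x.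
Proof.
move=> x0; rewrite /qln; case: eqVneq => [->|q1].
  by rewrite subrr powRr0 mul0r addr0.
by rewrite mulrC divfK ?subr_eq0 // addrCA subrr addr0.
Qed.

Lemma is_derive_bregman q s x : 0 < x ->
  is_derive x (1 : R) (bregman q s) (q * (qln q x - qln q s) +
    (x `^ (q - 1) - s `^ (q - 1) - (q - 1) * (qln q x - qln q s))).
Proof.
move=> x0; have D := is_derive_qln q x0.
have -> : bregman q s = (id * (qln q - cst (qln q s))) - s `^ (q - 1) \*: (id - cst s).
  by apply/funext => y.
apply: is_derive_eq.
have -> : x `^ (q - 1) = x * x `^ (q - 2).
  rewrite -[X in X * _]powRr1 ?ltW // -powRD ?(gt_eqF x0) ?implybT //.
  by congr (_ `^ _); ring.
rewrite /= !subr0 /GRing.scale /= !fctE; ring.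
Qed.

Lemma bregman_derive q s x : 0 < s -> 0 < x ->
  is_derive x (1 : R) (bregman q s) (q * (qln q x - qln q s)).
Proof.
move=> s0 x0; have := is_derive_bregman q s x0.
by rewrite !powR_qln // [X in _ + X](_ : _ = 0) ?addr0 //; ring.
Qed.

(** Cauchy's mean value theorem for the pair (bregman, (x - s)^2), followed by
    the ordinary one for the q-logarithm. *)
Lemma bregman_slope_mvt q s x : 0 < s -> 0 < x ->
  exists eta, [/\ 0 < eta, `|eta - s| <= `|x - s| &
    bregman_slope q s x = q * eta `^ (q - 2) / 2].
Proof.
move=> s0 x0; rewrite /bregman_slope; case: eqVneq => [->|xs].
  by exists s; rewrite lexx.
pose c := bregman q s x / (x - s) ^+ 2.
have xs2 : (x - s) ^+ 2 != 0 by rewrite expf_neq0 // subr_eq0.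
pose psi y := bregman q s y - c * (y - s) ^+ 2.
have dpsi (y : R) : 0 < y -> is_derive y (1 : R) psi (q * (qln q y - qln q s) - c * (2 * (y - s))).
  move=> y0; have D := bregman_derive q s0 y0.
  have -> : psi = bregman q s - c \*: ((id - cst s) * (id - cst s)).
    by apply/funext => z; rewrite /psi expr2.
  apply: is_derive_eq.
  by rewrite /= !subr0 /GRing.scale /= !fctE; ring.
have [xi [xi0 /(_ xs) xin xis]] := MVT_pos s0 x0 dpsi.
have -> : psi x - psi s = 0.
  by rewrite /psi /c divfK // /bregman !subrr expr0n /= !mulr0 !subrr.
move=> /esym/eqP; rewrite mulf_eq0 => /orP[|]; last first.
  by rewrite subr_eq0 (negbTE xs).
rewrite qln_slopeE => /eqP E.
have [eta [eta0 etas E']] := qln_slope_mvt q s0 xi0.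
exists eta; split => //; first exact: le_trans xis.
have xi_s : xi - s != 0 by rewrite subr_eq0.
apply: (mulIf xi_s); rewrite -/c -E'.
have E2 : c * (2 * (xi - s)) = q * (qln_slope q s xi * (xi - s)).
  by apply/esym/eqP; rewrite -subr_eq0; apply/eqP.
apply: (mulfI (_ : 2 != 0 :> R)); first by rewrite pnatr_eq0.
by rewrite mulrCA E2; field.
Qed.

Lemma bregman_slope_gt0 q s x : 0 < q -> 0 < s -> 0 < x -> 0 < bregman_slope q s x.
Proof.
move=> q0 s0 x0; have [eta [e0 _ ->]] := bregman_slope_mvt q s0 x0.
by rewrite divr_gt0 ?mulr_gt0 ?powR_gt0.
Qed.

(** With t = (q - 1) ln x the q-logarithm is (e^t - 1) / (q - 1), and 1 + t <= e^t,
    used at t and at - t, squeezes it between ln x and x^(q-1) ln x. *)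
Lemma ln_le_qln q x : 1 <= q -> 0 < x -> ln x <= qln q x.
Proof.
rewrite le_eqVlt => /orP[/eqP <-|q1] x0; rewrite /qln ?eqxx // gt_eqF //.
rewrite ler_pdivlMr ?subr_gt0 // lerBrDl powRE // mulrC.
exact: expR_ge1Dx.
Qed.

Lemma qln_le_ln q x : 1 <= q -> 0 < x -> qln q x <= ln x * x `^ (q - 1).
Proof.
rewrite le_eqVlt => /orP[/eqP <-|q1] x0.
  by rewrite /qln eqxx subrr powRr0 mulr1.
rewrite /qln gt_eqF // ler_pdivrMr ?subr_gt0 // powRE // lerBlDr.
set t := (q - 1) * ln x.
have := expR_ge1Dx (- t); rewrite -(ler_pM2r (expR_gt0 t)) -expRD addNr expR0.
have -> : (1 + - t) * expR t = expR t - t * expR t by ring.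
have -> : ln x * expR t * (q - 1) = t * expR t by rewrite /t; ring.
by rewrite lerBlDr addrC.
Qed.

Lemma ln_ge x : 0 < x -> 1 - x^-1 <= ln x.
Proof.
move=> x0; have := @le_ln1Dx R (x^-1 - 1).
have -> : -1 < x^-1 - 1 by rewrite ltrBDl subrr invr_gt0.
by move=> /(_ isT); rewrite addrC subrK lnV ?posrE // lerNl opprB.
Qed.

Section Limit.
Variables (T : Type) (F : set_system T).
Context {FF : ProperFilter F}.

Lemma powR_cvg2 (x r : T -> R) (x0 r0 : R) : (forall t, 0 < x t) -> 0 < x0 ->
  x t @[t --> F] --> x0 -> r t @[t --> F] --> r0 ->
  x t `^ r t @[t --> F] --> x0 `^ r0.
Proof.
move=> xp x00 xx0 rr0; rewrite powRE //.
under eq_fun do rewrite powRE //.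
apply: continuous_cvg; first exact: continuous_expR.
by apply: cvgM => //; apply: continuous_cvg => //; exact: continuous_ln.
Qed.

Lemma qln_cvg (q x : T -> R) (x0 : R) : (forall t, 1 <= q t) ->
  q t @[t --> F] --> (1 : R) ->
  (forall t, 0 < x t) -> 0 < x0 -> x t @[t --> F] --> x0 ->
  qln (q t) (x t) @[t --> F] --> ln x0.
Proof.
move=> q1 qc xp x00 xx0.
have lnc : ln (x t) @[t --> F] --> ln x0.
  by apply: continuous_cvg => //; exact: continuous_ln.
apply: (@squeeze_cvgr _ _ _ _ (fun t => ln (x t)) (fun t => ln (x t) * x t `^ (q t - 1))).
- by apply: nearW => t; rewrite ln_le_qln // qln_le_ln.
- exact: lnc.
- have qc0 : q t - 1 @[t --> F] --> (0 : R).
    by rewrite -(subrr (1 : R)); apply: cvgB => //; exact: cvg_cst.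
  have pc := powR_cvg2 xp x00 xx0 qc0; rewrite powRr0 in pc.
  by rewrite -[ln x0]mulr1; exact: cvgM.
Qed.

Lemma between_cvg (x s y : T -> R) (s0 : R) : x t @[t --> F] --> s0 ->
  s t @[t --> F] --> s0 -> (forall t, `|y t - s t| <= `|x t - s t|) ->
  y t @[t --> F] --> s0.
Proof.
move=> xs ss ys.
have ysc : y t - s t @[t --> F] --> (0 : R).
  apply/norm_cvg0P; apply: (@squeeze_cvgr _ _ _ _ (fun=> 0) (fun t => `|x t - s t|)).
  - by apply: nearW => t; rewrite normr_ge0 ys.
  - exact: cvg_cst.
  - by apply/norm_cvg0P; rewrite -(subrr s0); exact: cvgB.
have -> : y = (fun t => (y t - s t) + s t) by apply/funext => t; rewrite subrK.
by rewrite -[s0]add0r; exact: cvgD.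
Qed.

Lemma cvg_neq (x s : T -> R) (x0 s0 : R) : x t @[t --> F] --> x0 ->
  s t @[t --> F] --> s0 -> x0 != s0 -> \forall t \near F, x t != s t.
Proof.
move=> xx0 ss0 n0.
have d0 : x t - s t @[t --> F] --> x0 - s0 by exact: cvgB.
have := cvgr_neq0 _ d0; rewrite subr_eq0 => /(_ _ n0).
by apply: filterS => t; rewrite subr_eq0.
Qed.

(** When s0 = x0 the quotient degenerates, and the mean value theorem replaces it
    by a power of an intermediate point, which converges as well. *)
Lemma qln_slope_cvg (q s x : T -> R) (s0 x0 : R) : (forall t, 1 <= q t) ->
  q t @[t --> F] --> (1 : R) ->
  (forall t, 0 < s t) -> 0 < s0 -> s t @[t --> F] --> s0 ->
  (forall t, 0 < x t) -> 0 < x0 -> x t @[t --> F] --> x0 ->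
  qln_slope (q t) (s t) (x t) @[t --> F] --> qln_slope 1 s0 x0.
Proof.
move=> q1 qc sp s00 ss0 xp x00 xx0.
have [x0s0|x0s0] := eqVneq x0 s0.
  have /choice[xi xiE] t := qln_slope_mvt (q t) (sp t) (xp t).
  have -> : (fun t => qln_slope (q t) (s t) (x t)) = fun t => xi t `^ (q t - 2).
    by apply/funext => t; have [] := xiE t.
  rewrite /qln_slope x0s0 eqxx; apply: powR_cvg2 => //.
  - by move=> t; have [] := xiE t.
  - apply: (between_cvg (x := x) (s := s)) => //; first by rewrite -x0s0.
    by move=> t; have [] := xiE t.
  - by apply: cvgB => //; exact: cvg_cst.
rewrite /qln_slope (negbTE x0s0) /qln eqxx.
have H : (qln (q t) (x t) - qln (q t) (s t)) / (x t - s t) @[t --> F] -->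
    (ln x0 - ln s0) / (x0 - s0).
  by apply: cvgM; [apply: cvgB; exact: qln_cvg|apply: cvgV; [rewrite subr_eq0|exact: cvgB]].
apply: cvg_trans H; apply: near_eq_cvg.
by apply: filterS (cvg_neq xx0 ss0 x0s0) => t /negbTE ->.
Qed.

Lemma bregman_slope_cvg (q s x : T -> R) (s0 x0 : R) : (forall t, 1 <= q t) ->
  q t @[t --> F] --> (1 : R) ->
  (forall t, 0 < s t) -> 0 < s0 -> s t @[t --> F] --> s0 ->
  (forall t, 0 < x t) -> 0 < x0 -> x t @[t --> F] --> x0 ->
  bregman_slope (q t) (s t) (x t) @[t --> F] --> bregman_slope 1 s0 x0.
Proof.
move=> q1 qc sp s00 ss0 xp x00 xx0.
have [x0s0|x0s0] := eqVneq x0 s0.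
  have /choice[xi xiE] t := bregman_slope_mvt (q t) (sp t) (xp t).
  have -> : (fun t => bregman_slope (q t) (s t) (x t)) = fun t => q t * xi t `^ (q t - 2) / 2.
    by apply/funext => t; have [] := xiE t.
  rewrite /bregman_slope x0s0 eqxx; apply: cvgMl; apply: cvgM => //.
  apply: powR_cvg2 => //.
  - by move=> t; have [] := xiE t.
  - apply: (between_cvg (x := x) (s := s)) => //; first by rewrite -x0s0.
    by move=> t; have [] := xiE t.
  - by apply: cvgB => //; exact: cvg_cst.
rewrite /bregman_slope (negbTE x0s0).
have H : bregman (q t) (s t) (x t) / (x t - s t) ^+ 2 @[t --> F] -->
    bregman 1 s0 x0 / (x0 - s0) ^+ 2.
  rewrite /bregman /qln eqxx; apply: cvgM.
    apply: cvgB; first by apply: cvgM => //; apply: cvgB; exact: qln_cvg.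
    apply: cvgM; last exact: cvgB.
    by apply: powR_cvg2 => //; apply: cvgB => //; exact: cvg_cst.
  apply: cvgV; first by rewrite expf_neq0 // subr_eq0.
  by rewrite expr2; under eq_fun do rewrite expr2; apply: cvgM; exact: cvgB.
apply: cvg_trans H; apply: near_eq_cvg.
by apply: filterS (cvg_neq xx0 ss0 x0s0) => t /negbTE ->.
Qed.

End Limit.
End Scalar.

(** * Completely positive maps *)

Section PositiveMaps.
Variables (R : realType) (n : nat).
Local Notation C := R[i].
Implicit Types (A B X Y : 'M[C]_n) (v w : 'cV[C]_n).

(** Products B B^* span all matrices, by polarization. *)
Lemma gram_span_ind (Pr : 'M[C]_n -> Prop) :
  (forall B, Pr (B *m B^t*)) -> (forall c X, Pr X -> Pr (c *: X)) ->
  (forall X Y, Pr X -> Pr Y -> Pr (X + Y)) -> forall Y, Pr Y.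
Proof.
move=> PrB PrZ PrD Y.
pose S z := (Y + z%:M) *m (Y + z%:M)^t*.
have SE z : z * Num.conj z = 1 -> z *: S z =
    Y + ((z *: (Y *m Y^t*) + z%:M) + (z * z) *: Y^t*).
  move=> zz; rewrite /S adjD tr_scalar_mx map_scalar_mx mulmxDl !mulmxDr.
  rewrite -[(Num.conj z)%:M]scalemx1 -[z%:M]scalemx1 -!scalemxAl -!scalemxAr.
  rewrite !mulmx1 !mul1mx !scalerDr !scalerA zz scale1r -mulrA zz mulr1.
  by rewrite -addrA addrCA -[in RHS]addrA [in RHS](addrC (z *: 1%:M)).
have ii : 'i * 'i = -1 :> C by rewrite -expr2 sqr_i.
have ci : Num.conj ('i : C) = - 'i by apply/eqP; rewrite eq_complex /= oppr0 !eqxx.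
have E : Y = 4^-1 *: ((1 *: S 1 + (-1) *: S (-1)) + ('i *: S 'i + (- 'i) *: S (- 'i))).
  have nS (z : C) : (- z)%:M = - z%:M :> 'M[C]_n by rewrite raddfN.
  have c1 : 1 * Num.conj 1 = 1 :> C by rewrite rmorph1 mulr1.
  have c2 : -1 * Num.conj (-1) = 1 :> C by rewrite rmorphN rmorph1 mulrNN mulr1.
  have c3 : 'i * Num.conj 'i = 1 :> C by rewrite ci mulrN ii opprK.
  have c4 : - 'i * Num.conj (- 'i) = 1 :> C.
    have -> : Num.conj (- 'i : C) = 'i by apply/eqP; rewrite eq_complex /= !opprK !oppr0 !eqxx.
    by rewrite mulNr ii opprK.
  rewrite (SE _ c1) (SE _ c2) (SE _ c3) (SE _ c4) !mulrNN mulr1 ii !scaleNr !scale1r !nS.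
  set a := Y *m Y^t*; set b := 1%:M; set d := 'i%:M; set e := Y^t*.
  set f := 'i *: a.
  have sum4 (K : comNzRingType) (x y z t u v : K) : x + (y + z + t) + (x + (- y - z + t)) +
      (x + (u + v - t) + (x + (- u - v - t))) = 4 * x by ring.
  have -> : Y + (a + b + e) + (Y + (- a - b + e)) +
      (Y + (f + d - e) + (Y + (- f - d - e))) = 4 *: Y.
    by clearbody f a b d e; apply/matrixP => i j; rewrite !mxE; exact: sum4.
  by rewrite scalerA mulVf ?pnatr_eq0 // scale1r.
by rewrite E; apply: (PrZ); apply: (PrD); apply: (PrD); apply: (PrZ); exact: (PrB).
Qed.

(** The block matrix with blocks c_i c_j^* is a Gram matrix, hence positive; its
    ampliation is evaluated on the vector with blocks a_i. *)
Lemma completely_positive_gram (Phi : 'M[C]_n -> 'M[C]_n) k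
    (c : 'I_k -> 'M[C]_n) (a : 'I_k -> 'cV[C]_n) :
  completely_positive Phi ->
  0 <= \sum_i \sum_j bra (a i) (Phi (c i *m (c j)^t*)) (a j).
Proof.
move=> /(_ k (\mxcol_i c i *m (\mxcol_i c i)^t*) (gram_psd _)).
move=> /(_ (\mxcol_i a i)).
rewrite /ampliation.
have -> : (\mxcol_i c i)^t* = \mxrow_i (c i)^t*.
  by apply/matrixP => i j; rewrite !mxE.
have -> : (\mxcol_i a i)^t* = \mxrow_i (a i)^t*.
  by apply/matrixP => i j; rewrite !mxE.
rewrite mul_mxcol_mxrow.
under eq_mxblock => i j do rewrite mxblockK.
rewrite mul_mxrow_mxblock mul_mxrow_mxcol summxE exchange_big /=.
under eq_bigr do rewrite mulmx_suml summxE.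
by [].
Qed.

Lemma completely_positive_psd (Phi : 'M[C]_n -> 'M[C]_n) A :
  completely_positive Phi -> psd A -> psd (Phi A).
Proof.
move=> cp /psd_gramP[B ->] v.
have := @completely_positive_gram Phi 1 (fun=> B) (fun=> v) cp.
by rewrite !big_ord1.
Qed.

Lemma completely_positive_adj (Phi : {linear 'M[C]_n -> 'M[C]_n}) A :
  completely_positive Phi -> Phi (A^t*) = (Phi A)^t*.
Proof.
move=> cp; elim/gram_span_ind: A => [B|c X IH|X Y IX IY].
- rewrite adjM trmxCK; apply/esym/psd_herm.
  by apply: completely_positive_psd => //; exact: gram_psd.
- have PZ (d : C) (Y : 'M[C]_n) : Phi (d *: Y) = d *: Phi Y by rewrite linearZ.
  by rewrite PZ !adjZ PZ IH.
- have PD (Z W : 'M[C]_n) : Phi (Z + W) = Phi Z + Phi W by rewrite linearD.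
  by rewrite PD !adjD PD IX IY.
Qed.

Lemma psd_entry A i j : psd A ->
  `|complex.Re (A i j)| <= complex.Re (\tr A) /\
  `|complex.Im (A i j)| <= complex.Re (\tr A).
Proof.
move=> /psd_sformP[U [d [Uu -> d0]]]; rewrite sformE tr_sform //=.
have Uij k : `|complex.Re (Num.conj (U k i) * U k j)| <= 1 /\
    `|complex.Im (Num.conj (U k i) * U k j)| <= 1.
  apply: Re_norm_le; first exact: ler01.
  have nU l : `|U k l| ^+ 2 <= 1.
    have /matrixP/(_ k k) := unitary_adjr Uu; rewrite mxE [RHS]mxE eqxx mulr1n => <-.
    rewrite (bigD1 l) // !mxE -normCK lerDl; apply: sumr_ge0 => m _.
    by rewrite !mxE -normCK exprn_ge0.
  rewrite normrM norm_conjC exprMn expr1n rmorph1 -[1]mulr1.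
  by apply: ler_pM; rewrite ?exprn_ge0.
have Imsum (F : 'I_n -> C) : complex.Im (\sum_k F k) = \sum_k complex.Im (F k).
  by apply: (big_morph (@complex.Im R)) => // x y; case: x; case: y.
have ImZ (a : R) (x : C) : complex.Im (a%:C * x) = a * complex.Im x.
  by case: x => x y /=; rewrite mul0r addr0.
rewrite Re_sum Imsum; split; apply: (le_trans (ler_norm_sum _ _ _)).
- apply: ler_sum => k _; rewrite ReZ normrM (ger0_norm (d0 k)).
  by rewrite ler_piMr //; have [] := Uij k.
- apply: ler_sum => k _; rewrite ImZ normrM (ger0_norm (d0 k)).
  by rewrite ler_piMr //; have [] := Uij k.
Qed.

Lemma psd_le_tr A : psd A -> psd ((complex.Re (\tr A))%:C%:M - A).
Proof.
move=> /psd_sformP[U [d [Uu -> d0]]]; rewrite tr_sform //=.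
rewrite -(sform_cst _ Uu) -[- sform U d]scaleN1r -[-1](rmorphN1 (real_complex R)) sformZ sformD.
apply/psd_sform => // i; rewrite mulN1r subr_ge0.
by rewrite (bigD1 i) //= lerDl sumr_ge0.
Qed.

(** A unital completely positive map does not increase the order interval
    [0, c], which bounds all entries uniformly in the map. *)
Lemma unital_cp_bounded Y : exists M : R,
  forall Phi : {linear 'M[C]_n -> 'M[C]_n}, completely_positive Phi ->
    Phi 1%:M = 1%:M -> forall i j,
    `|complex.Re (Phi Y i j)| <= M /\ `|complex.Im (Phi Y i j)| <= M.
Proof.
elim/gram_span_ind: Y => [B|c X [M HM]|X Y [M HM] [N HN]].
- pose c := complex.Re (\tr (B *m B^t*)).
  exists (complex.Re (\tr ((c%:C)%:M : 'M[C]_n))) => Phi cp Phi1 i j.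
  have := completely_positive_psd cp (psd_le_tr (gram_psd B)).
  rewrite -/c linearB -scalemx1 linearZ /= Phi1 scalemx1 => /psd_tr_ge0.
  rewrite linearB /= => /Re_ge0; rewrite ReD ReN subr_ge0 => PhiB.
  have [H1 H2] := psd_entry i j (completely_positive_psd cp (gram_psd B)).
  by split; apply: le_trans PhiB.
- exists ((`|complex.Re c| + `|complex.Im c|) * M) => Phi cp Phi1 i j.
  have [H1 H2] := HM Phi cp Phi1 i j.
  rewrite linearZ !mxE /=; move: H1 H2; case: (Phi X i j) => x y /= H1 H2.
  case: c => a b /=.
  rewrite mulrDl; split.
    apply: (le_trans (ler_normB _ _)); rewrite !normrM.
    by apply: lerD; rewrite ler_wpM2l.
  apply: (le_trans (ler_normD _ _)); rewrite !normrM.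
  by apply: lerD; rewrite ler_wpM2l.
- exists (M + N) => Phi cp Phi1 i j.
  have [H1 H2] := HM Phi cp Phi1 i j; have [K1 K2] := HN Phi cp Phi1 i j.
  rewrite linearD !mxE /=; move: H1 H2 K1 K2.
  case: (Phi X i j) => x y; case: (Phi Y i j) => z t /= *.
  by split; apply: (le_trans (ler_normD _ _)); apply: lerD.
Qed.

End PositiveMaps.

(** * Generators of quantum Markov semigroups *)

Lemma mcvg_near (R : realType) (T : Type) (F : set_system T) {FF : ProperFilter F}
    m n (A B : T -> 'M[R[i]]_(m, n)) L :
  (\forall t \near F, A t = B t) -> mcvg F A L -> mcvg F B L.
Proof.
move=> AB AL i j; have [AL1 AL2] := AL i j; split.
  apply: cvg_trans AL1; apply: near_eq_cvg.
  by apply: filterS AB => t ->.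
apply: cvg_trans AL2; apply: near_eq_cvg.
by apply: filterS AB => t ->.
Qed.

Lemma mxBE (V : zmodType) m n (A B : 'M[V]_(m, n)) i j :
  (A - B) i j = A i j - B i j.
Proof. by rewrite !mxE. Qed.

(** For small e > 0 the linear term dominates the quadratic one. *)
Lemma linear_small_quad_ge0 (R : realFieldType) (b c : R) :
  0 <= b -> (forall e, 0 <= - e * b + e ^+ 2 * c) -> b = 0.
Proof.
move=> b0 H; apply/eqP; rewrite eq_le b0 andbT leNgt; apply/negP => b_gt0.
have := H (b / (2 * (b + `|c|))).
have bc : 0 < b + `|c| by rewrite ltr_wpDr.
set e := b / _; have e0 : 0 < e by rewrite divr_gt0 // mulr_gt0.
have eE : e * (2 * (b + `|c|)) = b by rewrite /e divfK // gt_eqF // mulr_gt0.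
have := ler_norm c; nra.
Qed.

Section Generator.
Variables (R : realType) (n : nat).
Local Notation C := R[i].
Variables (P : R -> {linear 'M[C]_n -> 'M[C]_n}) (L : {linear 'M[C]_n -> 'M[C]_n}).
Hypothesis P_qms : quantum_markov_semigroup P.
Hypothesis L_gen : generator P L.
Implicit Types (A B X Y Q : 'M[C]_n) (v w : 'cV[C]_n).

Lemma hs_norm_entry X i j :
  `|complex.Re (X i j)| <= hs_norm X /\ `|complex.Im (X i j)| <= hs_norm X.
Proof.
have ipE : hs_ip X X = \sum_k \sum_l `|X l k| ^+ 2.
  rewrite /hs_ip /mxtrace; apply: eq_bigr => k _; rewrite mxE; apply: eq_bigr => l _.
  by rewrite !mxE normCK mulrC.
have ip0 : 0 <= hs_ip X X.
  by rewrite ipE; do 2 apply: sumr_ge0 => ? _; rewrite exprn_ge0.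
apply: Re_norm_le; first exact: sqrtr_ge0.
rewrite /hs_norm sqr_sqrtr; last exact: Re_ge0.
rewrite -(ge0_ReP ip0) ipE; apply: (@le_trans _ _ (\sum_l `|X l j| ^+ 2)).
  by rewrite (bigD1 i) // lerDl; apply: sumr_ge0 => l _; rewrite exprn_ge0.
rewrite [leRHS](bigD1 j) // lerDl.
by do 2 apply: sumr_ge0 => ? _; rewrite exprn_ge0.
Qed.

Lemma generator_mcvg X :
  mcvg (0 : R)^'+ (fun t => (t^-1)%:C *: (P t X - X)) (L X).
Proof.
have H := L_gen X; move=> i j.
have lim (f : R -> R) (l : R) :
    (forall t, `|f t - l| <= hs_norm ((t^-1)%:C *: (P t X - X) - L X)) ->
    f t @[t --> (0 : R)^'+] --> l.
  move=> fl; apply/cvgrPdist_le => e e0.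
  move/cvgrPdist_le: (H) => /(_ _ e0); apply: filterS => t.
  rewrite sub0r normrN ger0_norm ?sqrtr_ge0 // => le_e.
  by rewrite distrC (le_trans (fl t)).
have ImB (x y : C) : complex.Im (x - y) = complex.Im x - complex.Im y.
  by case: x; case: y.
split; apply: lim => t.
- rewrite -ReN -ReD; have := hs_norm_entry ((t^-1)%:C *: (P t X - X) - L X) i j.
  by rewrite mxBE => -[].
- rewrite -ImB; have := hs_norm_entry ((t^-1)%:C *: (P t X - X) - L X) i j.
  by rewrite mxBE => -[].
Qed.

Lemma generator1 : L 1%:M = 0.
Proof.
apply: (mcvg_unique (generator_mcvg 1%:M)).
apply: (mcvg_near _ (mcvg_cst 0)); near=> t.
rewrite (qms_unital P_qms) ?subrr ?scaler0 //.
Unshelve. all: by end_near. Qed.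

Lemma generator_adj X : L (X^t*) = (L X)^t*.
Proof.
apply: (mcvg_unique (generator_mcvg (X^t*))).
apply: (mcvg_near _ (mcvg_adj (generator_mcvg X))); near=> t.
have cp : completely_positive (P t) by apply: (qms_cp P_qms).
by rewrite adjZ adjD adjN (completely_positive_adj _ cp) conj_real.
Unshelve. all: by end_near. Qed.

(** At time 0 the Gram test of complete positivity vanishes on these families,
    so its derivative there is nonnegative. *)
Lemma generator_gram k (c : 'I_k -> 'M[C]_n) (a : 'I_k -> 'cV[C]_n) :
  \sum_i (c i)^t* *m a i = 0 ->
  0 <= \sum_i \sum_j bra (a i) (L (c i *m (c j)^t*)) (a j).
Proof.
move=> ca0.
pose D t i j := (t^-1)%:C *: (P t (c i *m (c j)^t*) - c i *m (c j)^t*).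
have lim : ccvg (0 : R)^'+ (fun t => \sum_i \sum_j bra (a i) (D t i j) (a j))
    (\sum_i \sum_j bra (a i) (L (c i *m (c j)^t*)) (a j)).
  apply: ccvg_sum => i; apply: ccvg_sum => j.
  by apply: mcvg_bra; [exact: mcvg_cst|exact: generator_mcvg|exact: mcvg_cst].
apply: ccvg_ge0 lim; near=> t.
have t0 : 0 < t by [].
have cp : completely_positive (P t) by apply: (qms_cp P_qms); exact: ltW.
have -> : \sum_i \sum_j bra (a i) (D t i j) (a j) =
    (t^-1)%:C * \sum_i \sum_j bra (a i) (P t (c i *m (c j)^t*)) (a j)
    - (t^-1)%:C * \sum_i \sum_j bra (a i) (c i *m (c j)^t*) (a j).
  rewrite -mulrBr -sumrB mulr_sumr; apply: eq_bigr => i _.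
  rewrite -sumrB mulr_sumr; apply: eq_bigr => j _.
  by rewrite /D braZ braB.
have -> : \sum_i \sum_j bra (a i) (c i *m (c j)^t*) (a j) = 0.
  have -> : \sum_i \sum_j bra (a i) (c i *m (c j)^t*) (a j) =
      ((\sum_i (c i)^t* *m a i)^t* *m (\sum_i (c i)^t* *m a i)) 0 0.
    rewrite mulmx_sumr summxE exchange_big; apply: eq_bigr => j _ /=.
    rewrite raddf_sum map_mx_sum mulmx_suml summxE; apply: eq_bigr => i _.
    by rewrite adjM trmxCK /bra !mulmxA.
  by rewrite ca0 mulmx0 mxE.
rewrite mulr0 subr0 mulr_ge0 //; last exact: completely_positive_gram.
by rewrite ler0c invr_ge0 ltW.
Unshelve. all: by end_near. Qed.

(** The Gram test with a single term: the factor B of X = B B^* kills w. *)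
Lemma generator_pos X w : psd X -> bra w X w = 0 -> 0 <= bra w (L X) w.
Proof.
move=> /psd_gramP[B ->].
rewrite braMl -[B^t*]mul1mx braMr mul1mx => /bra1_eq0 Bw.
have := @generator_gram 1 (fun=> B) (fun=> w).
by rewrite !big_ord1 => /(_ Bw).
Qed.

Lemma generator_gram2 (c0 c1 : 'M[C]_n) (a0 a1 : 'cV[C]_n) :
  c0^t* *m a0 + c1^t* *m a1 = 0 ->
  0 <= (bra a0 (L (c0 *m c0^t*)) a0 + bra a0 (L (c0 *m c1^t*)) a1)
     + (bra a1 (L (c1 *m c0^t*)) a0 + bra a1 (L (c1 *m c1^t*)) a1).
Proof.
move=> ca0.
pose c (i : 'I_2) := if i == ord0 then c0 else c1.
pose a (i : 'I_2) := if i == ord0 then a0 else a1.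
have E (V : nmodType) (f : 'I_2 -> V) : \sum_i f i = f ord0 + f (lift ord0 ord0).
  by rewrite !big_ord_recl big_ord0 addr0.
have := @generator_gram 2 c a.
rewrite E; move/(_ ca0); rewrite E.
by rewrite (E _ (fun j => bra (a ord0) _ (a j))) (E _ (fun j => bra (a (lift _ _)) _ (a j))).
Qed.

(** The carre du champ L(X^* Y) - X^* L(Y) - L(X^* ) Y is a positive form, so
    where it vanishes on the diagonal it vanishes altogether. *)
Lemma generator_kernel Q w : Q^t* = Q -> Q *m Q = Q -> Q *m w = 0 ->
  bra w (L Q) w = 0 -> forall X, L (X *m Q) *m w = X *m L Q *m w.
Proof.
move=> Qh QQ Qw w0 X; apply/eqP; rewrite -subr_eq0; apply/eqP.
set v := _ - _; pose u := X^t* *m v.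
have vE : complex.Re (bra v (L (X *m Q)) w) - complex.Re (bra u (L Q) w) =
    complex.Re (bra v 1%:M v).
  rewrite -ReN -ReD; congr complex.Re.
  have -> : bra u (L Q) w = bra v (X *m L Q) w by rewrite braMl.
  by rewrite -braB -[L _ - _]mul1mx braMr mulmxBl.
clearbody v; apply: bra1_eq0; apply: (etrans (ge0_ReP (bra1_ge0 v))).
suff -> : complex.Re (bra v 1%:M v) = 0 by [].
set b := complex.Re (bra v 1%:M v).
suff H (e : R) : 0 <= - e * (2 * b) + e ^+ 2 * complex.Re
    (bra u (L Q) u - bra u (L (Q *m X^t*)) v - bra v (L (X *m Q)) u
     + bra v (L (X *m Q *m X^t*)) v).
  have /eqP : 2 * b = 0.
    apply: linear_small_quad_ge0 H; rewrite mulr_ge0 // Re_ge0 //; exact: bra1_ge0.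
  by rewrite mulf_eq0 pnatr_eq0 => /eqP.
have Qu : Q *m u = (X *m Q)^t* *m v by rewrite adjM Qh /u mulmxA.
have LXQ : (X *m Q)^t* = Q *m X^t* by rewrite adjM Qh.
have cvg0 : Q^t* *m (w + e%:C *: u) + (X *m Q)^t* *m ((- e)%:C *: v) = 0.
  by rewrite Qh mulmxDr Qw add0r -!scalemxAr Qu -scalerDl -rmorphD subrr scale0r.
have := generator_gram2 cvg0.
have QQX : Q *m (Q *m X^t*) = Q *m X^t* by rewrite mulmxA QQ.
have XQQ : X *m Q *m Q = X *m Q by rewrite -mulmxA QQ.
have XQX : X *m Q *m (Q *m X^t*) = X *m Q *m X^t* by rewrite mulmxA XQQ.
rewrite !LXQ Qh QQ QQX XQQ XQX.
have Re1 : complex.Re (bra w (L Q) u) = complex.Re (bra u (L Q) w).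
  by rewrite -[in LHS]Qh generator_adj bra_adj Re_conj.
have Re2 : complex.Re (bra w (L (Q *m X^t*)) v) = complex.Re (bra v (L (X *m Q)) w).
  by rewrite -LXQ (generator_adj (X *m Q)) bra_adj; exact: Re_conj.
rewrite !(braDl, braDr, braZl, braZr) !conj_real w0 => /Re_ge0.
rewrite /b -vE; move: Re1 Re2.
move: (bra w (L Q) u) (bra u (L Q) w) (bra u (L Q) u) (bra w (L (Q *m X^t*)) v).
move: (bra u (L (Q *m X^t*)) v) (bra v (L (X *m Q)) w) (bra v (L (X *m Q)) u).
move: (bra v (L (X *m Q *m X^t*)) v).
case=> x1 y1 [x2 y2] [x3 y3] [x4 y4] [x5 y5] [x6 y6] [x7 y7] [x8 y8] /= -> ->.
by apply: etrans; congr (0 <= _); ring.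
Qed.

End Generator.

(** * Functionals annihilated by the generator *)

Section Invariance.
Variables (R : realType) (n : nat).
Local Notation C := R[i].
Variables (P : R -> {linear 'M[C]_n -> 'M[C]_n}) (L : {linear 'M[C]_n -> 'M[C]_n}).
Hypothesis P_qms : quantum_markov_semigroup P.
Hypothesis L_gen : generator P L.
Implicit Types (A B X Y Q rho : 'M[C]_n).

(** A functional killed by the generator is invariant: over m steps of length
    t / m its variation is m * o(t / m), uniformly because the orbit is bounded. *)
Lemma generator_invariant rho : (forall Y, \tr (rho *m L Y) = 0) ->
  forall t Y, 0 <= t -> \tr (rho *m P t Y) = \tr (rho *m Y).
Proof.
move=> rhoL.
pose z (i j : 'I_n) (h : R) : C := \tr (rho *m (P h (delta_mx i j) - delta_mx i j)).
pose phi h : R := \sum_i \sum_j (`|complex.Re (z i j h)| + `|complex.Im (z i j h)|).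
have phi0 : h^-1 * phi h @[h --> (0 : R)^'+] --> (0 : R).
  have zc i j : ccvg (0 : R)^'+ (fun h => (h^-1)%:C * z i j h) 0.
    rewrite -(rhoL (delta_mx i j)).
    apply: (eq_ccvg _ (mcvg_tr (mcvgM (mcvg_cst rho) (generator_mcvg L_gen (delta_mx i j))))).
    by move=> h /=; rewrite -scalemxAr linearZ.
  have normc (f : R -> R) : f h @[h --> (0 : R)^'+] --> (0 : R) ->
      `|f h| @[h --> (0 : R)^'+] --> (0 : R) by move=> H; apply/norm_cvg0P.
  have lim0 : ccvg (0 : R)^'+ (fun h => \sum_i \sum_j
      (`|complex.Re ((h^-1)%:C * z i j h)| + `|complex.Im ((h^-1)%:C * z i j h)|)%:C)
      (\sum_(i < n) \sum_(j < n) (0 + 0 : R)%:C).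
    apply: ccvg_sum => i; apply: ccvg_sum => j; apply: ccvg_real.
    by have [H1 H2] := zc i j; apply: cvgD; exact: normc.
  have [+ _] := lim0; rewrite addr0 big1 => [|i _]; last by rewrite big1.
  apply: cvg_trans; apply: near_eq_cvg; near=> h.
  have h0 : 0 < h by [].
  rewrite Re_sum mulr_sumr; apply: eq_bigr => i _.
  rewrite Re_sum mulr_sumr; apply: eq_bigr => j _.
  rewrite /=; case: (z i j h) => a b /=.
  by rewrite !mul0r subr0 addr0 !normrM gtr0_norm ?invr_gt0 // mulrDr.
have step h (Z : 'M[C]_n) (M : R) :
    (forall i j, `|complex.Re (Z i j)| <= M /\ `|complex.Im (Z i j)| <= M) ->
    `|complex.Re (\tr (rho *m P h Z)) - complex.Re (\tr (rho *m Z))| <= M * phi h.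
  move=> ZM; rewrite -ReN -ReD -linearB /= -mulmxBr.
  have -> : \tr (rho *m (P h Z - Z)) = \sum_i \sum_j Z i j * z i j h.
    rewrite {1 2}(matrix_sum_delta Z) linear_sum -sumrB mulmx_sumr linear_sum.
    apply: eq_bigr => i _ /=; rewrite linear_sum -sumrB mulmx_sumr linear_sum.
    apply: eq_bigr => j _ /=.
    by rewrite linearZ -scalerBr -scalemxAr linearZ.
  rewrite Re_sum (le_trans (ler_norm_sum _ _ _)) // mulr_sumr ler_sum // => i _.
  rewrite Re_sum (le_trans (ler_norm_sum _ _ _)) // mulr_sumr ler_sum // => j _.
  have [H1 H2] := ZM i j; move: (z i j h) H1 H2; case: (Z i j) => a b [c d] /= H1 H2.
  rewrite (le_trans (ler_normB _ _)) // !normrM mulrDr.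
  by apply: lerD; rewrite ler_wpM2r.
have ReE (t : R) (Y : 'M[C]_n) : 0 <= t ->
    complex.Re (\tr (rho *m P t Y)) = complex.Re (\tr (rho *m Y)).
  rewrite le_eqVlt => /orP[/eqP <-|t0]; first by rewrite (qms0 P_qms).
  have [M HM] := unital_cp_bounded Y.
  have PM s : 0 <= s ->
      forall i j, `|complex.Re (P s Y i j)| <= M /\ `|complex.Im (P s Y i j)| <= M.
    move=> s0; apply: HM; [exact: (qms_cp P_qms)|exact: (qms_unital P_qms)].
  have tele h k : 0 <= h ->
      `|complex.Re (\tr (rho *m P (k%:R * h) Y)) - complex.Re (\tr (rho *m Y))|
      <= k%:R * (M * phi h).
    move=> h0; elim: k => [|k IH].
      by rewrite !mul0r (qms0 P_qms) subrr normr0.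
    have kh0 : 0 <= k%:R * h by rewrite mulr_ge0.
    have -> : k.+1%:R * h = h + k%:R * h by rewrite -natr1 mulrDl mul1r addrC.
    rewrite (qmsD P_qms) //.
    have := step h _ M (PM _ kh0).
    rewrite -natr1 mulrDl mul1r => S1.
    have := ler_normD
      (complex.Re (\tr (rho *m P h (P (k%:R * h) Y))) - complex.Re (\tr (rho *m P (k%:R * h) Y)))
      (complex.Re (\tr (rho *m P (k%:R * h) Y)) - complex.Re (\tr (rho *m Y))).
    rewrite subrKA; move: IH S1; lra.
  have M0 : `|M| * t >= 0 by rewrite mulr_ge0 // ltW.
  apply/eqP; rewrite -subr_eq0 -normr_le0; apply/ler_addgt0Pr => e e0; rewrite add0r.
  have c0 : 0 < e / (`|M| * t + 1) by rewrite divr_gt0 // ltr_wpDl.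
  have [d /= d0 Hd] : \forall h \near (0 : R)^'+, `|h^-1 * phi h| <= e / (`|M| * t + 1).
    by have /cvgrPdist_le/(_ _ c0) := phi0; apply: filterS => h; rewrite sub0r normrN.
  (* enough steps for their length t / k to fall within the radius d *)
  pose k := (Num.bound (t / d)).+1.
  have k0 : 0 < k%:R :> R by rewrite ltr0n.
  have kd : t / k%:R < d.
    rewrite ltr_pdivrMr // mulrC -ltr_pdivrMr //.
    apply: (lt_le_trans (archi_boundP (ltW (divr_gt0 t0 d0)))).
    by rewrite ler_nat.
  have h0 : 0 < t / k%:R by rewrite divr_gt0.
  have := Hd (t / k%:R).
  rewrite /= sub0r normrN gtr0_norm // => /(_ kd h0) le_c.
  have := tele (t / k%:R) k (ltW h0); rewrite mulrC divfK ?gt_eqF // => /le_trans; apply.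
  set c := e / _ in le_c; set h := t / k%:R in le_c h0 *.
  have phih : phi h <= c * h.
    by rewrite mulrC -ler_pdivrMl // (le_trans (ler_norm _)).
  have phi_ge0 : 0 <= phi h by do 2 apply: sumr_ge0 => ? _; rewrite addr_ge0.
  have kh : k%:R * h = t by rewrite /h mulrC divfK // gt_eqF.
  apply: (@le_trans _ _ (k%:R * (`|M| * (c * h)))).
    apply: ler_wpM2l; first exact: ltW.
    apply: (@le_trans _ _ (`|M| * phi h)); first by rewrite ler_wpM2r // ler_norm.
    by rewrite ler_wpM2l.
  have -> : k%:R * (`|M| * (c * h)) = c * (`|M| * t) by rewrite -kh; ring.
  rewrite /c mulrAC ler_pdivrMr ?ltr_wpDl // ler_pM2l // lerDl ler01.
  exact.
move=> t Y t0; apply/eqP; rewrite eq_complex ReE // eqxx /=.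
(* the imaginary part at Y is minus the real part at i Y *)
have Imi (x : C) : complex.Im x = - complex.Re ('i * x).
  by case: x => a b /=; rewrite mul0r mul1r sub0r opprK.
have iE (A : 'M[C]_n) : 'i * \tr (rho *m A) = \tr (rho *m ('i *: A)).
  by rewrite -scalemxAr linearZ.
have PZ (c : C) : P t (c *: Y) = c *: P t Y by rewrite linearZ.
by rewrite !Imi !iE -PZ ReE.
Unshelve. all: by end_near. Qed.

End Invariance.

(** * Real powers of positive definite matrices *)

Lemma mul_swap2 (D : idomainType) (a b w : D) : a * w = b * w -> a = b \/ w = 0.
Proof. by rewrite (mulrC b); exact: mul_swap. Qed.

Section MatrixPowers.
Variables (R : realType) (n : nat).
Local Notation C := R[i].
Implicit Types (A X : 'M[C]_n) (a b : R).

Lemma mxpowE A a : mxpow A a = mxfun (fun x => x `^ a) A.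
Proof. by []. Qed.

Lemma mxlogE A : mxlog A = mxfun (@ln R) A.
Proof. by []. Qed.

Lemma mxpowD A a b : posdef A -> mxpow A a *m mxpow A b = mxpow A (a + b).
Proof.
move=> A0; rewrite /mxpow mxfunM; apply: eq_mxfun => // x x0.
by rewrite powRD // (gt_eqF x0) implybT.
Qed.

Lemma mxpow0 A : mxpow A 0 = 1%:M.
Proof.
rewrite /mxpow (_ : (fun x : R => x `^ 0) = fun=> 1); last by apply/funext => x; rewrite powRr0.
by rewrite mxfun_cst.
Qed.

Lemma mxpow1 A : posdef A -> mxpow A 1 = A.
Proof.
move=> A0; rewrite -[RHS](mxfun_id (psd_herm (posdef_psd A0))).
by apply: eq_mxfun => // x x0; rewrite powRr1 // ltW.
Qed.

Lemma mxpow_posdef A a : posdef A -> posdef (mxpow A a).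
Proof. by move=> A0; apply: posdef_mxfun => // x x0; exact: powR_gt0. Qed.

Lemma mxpow_herm A a : (mxpow A a)^t* = mxpow A a.
Proof. exact: mxfun_herm. Qed.

Lemma mxpow_mulVr A a : posdef A -> mxpow A a *m mxpow A (- a) = 1%:M.
Proof. by move=> A0; rewrite mxpowD // subrr mxpow0. Qed.

Lemma mxpow_mulVl A a : posdef A -> mxpow A (- a) *m mxpow A a = 1%:M.
Proof. by move=> A0; rewrite mxpowD // addNr mxpow0. Qed.

Lemma mxpowN1 A : posdef A -> mxpow A (- 1) = invmx A.
Proof.
move=> A0; apply: (can_inj (mulmxK (posdef_unit A0))).
by rewrite mulVmx ?posdef_unit // -{2}(mxpow1 A0) mxpow_mulVl.
Qed.

Lemma mxpow_unit A a : posdef A -> mxpow A a \in unitmx.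
Proof. by move=> A0; apply: posdef_unit; exact: mxpow_posdef. Qed.

Lemma conj_sform_entry (U : 'M[C]_n) (d e : 'I_n -> R) X i j : U \is unitarymx ->
  (U *m (sform U d *m X *m sform U e) *m U^t*) i j =
  (d i)%:C * (e j)%:C * (U *m X *m U^t*) i j.
Proof.
move=> Uu; have UU := unitary_adjr Uu.
have -> : U *m (sform U d *m X *m sform U e) *m U^t* =
    diag_mx (\row_i (d i)%:C) *m (U *m X *m U^t*) *m diag_mx (\row_i (e i)%:C).
  rewrite /sform !mulmxA UU mul1mx -!mulmxA UU mulmx1.
  by rewrite !mulmxA.
by rewrite mul_mx_diag mul_diag_mx !mxE mulrAC.
Qed.

Lemma conj_unitary_inj (U : 'M[C]_n) : U \is unitarymx ->
  injective (fun X => U *m X *m U^t*).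
Proof.
move=> Uu X Y E; have UU := unitary_adjl Uu.
have inv (Z : 'M[C]_n) : U^t* *m (U *m Z *m U^t*) *m U = Z.
  by rewrite !mulmxA UU mul1mx -mulmxA UU mulmx1.
by rewrite -(inv X) E inv.
Qed.

(** An operator commuting with the modular automorphism A^-1 X A preserves its
    eigenspaces, hence commutes with all its real powers. *)
Lemma commute_modular_power (L : {linear 'M[C]_n -> 'M[C]_n}) A (s : R) : posdef A ->
  (forall X, L (invmx A *m X *m A) = invmx A *m L X *m A) ->
  forall X, L (mxpow A (- s) *m X *m mxpow A s) = mxpow A (- s) *m L X *m mxpow A s.
Proof.
move=> A0 H X; have := H; rewrite -(mxpowN1 A0) -{2 4}(mxpow1 A0).
move: A0 => /posdef_sformP[U [d [Uu AE d0]]].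
have powE a : mxpow A a = sform U (fun i => d i `^ a).
  by rewrite AE; exact: (mxfun_sform _ _ Uu).
pose W k l := U^t* *m delta_mx k l *m U.
have WE k l : U *m W k l *m U^t* = delta_mx k l.
  by rewrite /W !mulmxA (unitary_adjr Uu) mul1mx -mulmxA (unitary_adjr Uu) mulmx1.
have powW a k l : mxpow A (- a) *m W k l *m mxpow A a =
    (d k `^ (- a) * d l `^ a)%:C *: W k l.
  apply: (conj_unitary_inj Uu); apply/matrixP => i j.
  rewrite !powE conj_sform_entry // WE -scalemxAr -scalemxAl WE !mxE.
  have [->|_] := eqVneq i k; last by rewrite andFb !mulr0.
  have [->|_] := eqVneq j l; last by rewrite andbF !mulr0.
  by rewrite rmorphM.
clearbody W; have LZ c Z : L (c *: Z) = c *: L Z by rewrite linearZ.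
move=> {}H.
have LW k l : L (mxpow A (- s) *m W k l *m mxpow A s) =
    mxpow A (- s) *m L (W k l) *m mxpow A s.
  have E := etrans (congr1 L (esym (powW 1 k l))) (H (W k l)).
  apply: etrans (congr1 L (powW s k l)) _; rewrite LZ; rewrite LZ in E.
  move: (L (W k l)) E => N E.
  rewrite !powE in E *.
  apply: (conj_unitary_inj Uu); apply/matrixP => i j.
  have ZE c Z : (U *m (c *: Z) *m U^t*) i j = c * (U *m Z *m U^t*) i j.
    by rewrite -scalemxAr -scalemxAl mxE.
  have := etrans (esym (ZE _ N)) (etrans (congr1 (fun Z => (U *m Z *m U^t*) i j) E)
    (conj_sform_entry _ _ N i j Uu)).
  move=> E1; apply: (etrans (ZE _ N)); apply: (etrans _ (esym (conj_sform_entry _ _ N i j Uu))).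
  move: ((U *m N *m U^t*) i j) E1 => x; rewrite -!rmorphM.
  move=> /mul_swap2.
  case=> [/complexI|->]; last by rewrite !mulr0.
  move=> E'; congr (_%:C * _).
  have lnE a k' l' : d k' `^ (- a) * d l' `^ a = expR (a * (ln (d l') - ln (d k'))).
    by rewrite !powRE // -expRD; congr expR; ring.
  move: E'; rewrite !lnE => /expR_inj; rewrite !mul1r => E'.
  by rewrite E'.
have -> : X = \sum_k \sum_l (U *m X *m U^t*) k l *: W k l.
  apply: (conj_unitary_inj Uu); rewrite [LHS]matrix_sum_delta.
  rewrite mulmx_sumr mulmx_suml; apply: eq_bigr => k _.
  rewrite mulmx_sumr mulmx_suml; apply: eq_bigr => l _.
  by rewrite -scalemxAr -scalemxAl WE.
have sumP (f : 'I_n -> 'M[C]_n) :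
    (forall k, L (mxpow A (- s) *m f k *m mxpow A s) = mxpow A (- s) *m L (f k) *m mxpow A s) ->
    L (mxpow A (- s) *m (\sum_k f k) *m mxpow A s) =
    mxpow A (- s) *m L (\sum_k f k) *m mxpow A s.
  move=> Hf; rewrite mulmx_sumr mulmx_suml raddf_sum (raddf_sum L) mulmx_sumr mulmx_suml.
  by apply: eq_bigr => k _; exact: Hf.
apply: (sumP) => k; apply: (sumP) => l.
by rewrite -scalemxAr -scalemxAl !LZ LW -scalemxAr -scalemxAl.
Qed.

End MatrixPowers.

(** * GNS detailed balance *)

Lemma trmx_mul_inj (K : comNzRingType) n (A B : 'M[K]_n) :
  (forall X, \tr (A *m X) = \tr (B *m X)) -> A = B.
Proof.
move=> H; apply/matrixP => i j.
have E (D : 'M[K]_n) : \tr (D *m delta_mx j i) = D i j.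
  rewrite /mxtrace (bigD1 i) //= big1 ?addr0 => [|k ki].
    rewrite mxE (bigD1 j) //= big1 ?addr0 => [|l lj]; first by rewrite mxE !eqxx mulr1.
    by rewrite mxE (negbTE lj) mulr0.
  by rewrite mxE big1 // => l _; rewrite mxE (negbTE ki) andbF mulr0.
by rewrite -!E H.
Qed.

Section AbstractDetailedBalance.
Variables (K : fieldType) (n : nat) (s : 'M[K]_n) (L : 'M[K]_n -> 'M[K]_n).
Hypothesis su : s \in unitmx.
Hypothesis L_sym : forall A Y, \tr (s *m A *m L Y) = \tr (s *m L A *m Y).

(** Symmetry for (A, Y) |-> Tr(s A Y), used for both orders of A and Y, forces L
    to commute with the modular operator A |-> s^-1 A s. *)
Lemma symmetric_modular A : L (invmx s *m A *m s) = invmx s *m L A *m s.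
Proof.
apply: (can_inj (mulKmx su)); apply: trmx_mul_inj => Y.
have s1 Z : s *m (invmx s *m Z *m s) = Z *m s.
  by rewrite !mulmxA (mulmxV su) mul1mx.
rewrite -L_sym !s1 -(mulmxA A s) (mxtrace_mulC A) -L_sym.
by rewrite mxtrace_mulC mulmxA.
Qed.

(** Taking adjoints for the trace form Tr(s A Y), and removing the powers of s
    with the modular identity, moves Q and Q' from the right to the left. *)
Lemma symmetric_block (Q Q' : 'M[K]_n) : (forall X, L (X *m Q) *m Q' = X *m L Q *m Q') ->
  forall A, Q *m L (Q' *m A) = L Q *m Q' *m A.
Proof.
move=> H.
have step1 A : Q *m s *m L (invmx s *m Q' *m s *m A) = L Q *m Q' *m s *m A.
  apply: trmx_mul_inj => X; set M := invmx s *m Q' *m s *m A.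
  have -> : \tr (Q *m s *m L M *m X) = \tr (s *m L M *m (X *m Q)).
    by rewrite -!mulmxA mxtrace_mulC -!mulmxA.
  rewrite -L_sym /M.
  have -> : s *m (invmx s *m Q' *m s *m A) = Q' *m (s *m A).
    by rewrite !mulmxA (mulmxV su) mul1mx.
  rewrite -mulmxA mxtrace_mulC -(mulmxA (s *m A)) H.
  by rewrite -(mulmxA X) (mulmxA (s *m A)) mxtrace_mulC !mulmxA.
move=> A; apply: (can_inj (mulmxK su)); have := step1 (invmx s *m A *m s).
have -> : invmx s *m Q' *m s *m (invmx s *m A *m s) = invmx s *m (Q' *m A) *m s.
  by rewrite !mulmxA -(mulmxA (invmx s *m Q')) (mulmxV su) mulmx1.
rewrite symmetric_modular.
have s1 Z W : Z *m s *m (invmx s *m W *m s) = Z *m W *m s.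
  by rewrite !mulmxA -(mulmxA Z) (mulmxV su) mulmx1.
by rewrite !s1.
Qed.

(** With L(1) = 0 and complementary projections, the two block identities leave
    no room for a nonzero row block of L(Q). *)
Lemma symmetric_projection (Q : 'M[K]_n) : 2%:R != 0 :> K -> Q *m Q = Q ->
  L (1%:M - Q) = - L Q ->
  (forall X : 'M[K]_n, L (X *m Q) *m (1%:M - Q) = X *m L Q *m (1%:M - Q)) ->
  Q *m L Q = 0 /\ L Q *m Q = L Q.
Proof.
move=> two QQ L1 H; pose Q' : 'M[K]_n := 1%:M - Q; rewrite -/Q' in L1 H.
have Q'Q : Q' *m Q = 0 by rewrite /Q' mulmxBl mul1mx QQ subrr.
have := symmetric_block H 1%:M; rewrite !mulmx1 L1 mulmxN => E.
have QLQ : Q *m L Q *m Q = 0.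
  by rewrite -[LHS]opprK -mulNmx E -mulmxA Q'Q mulmx0 oppr0.
have QL : Q *m L Q = 0.
  have : Q *m (- (Q *m L Q)) = Q *m (L Q *m Q') by rewrite E.
  rewrite mulmxN !mulmxA QQ /Q' mulmxBr mulmx1 QLQ subr0 => /esym/eqP.
  rewrite -addr_eq0 -mulr2n -scaler_nat scaler_eq0 (negbTE two) => /eqP; exact.
split=> //; apply/esym/eqP; rewrite -subr_eq0.
by rewrite -[X in X - _]mulmx1 -mulmxBr -E QL oppr0.
Qed.

End AbstractDetailedBalance.

Section DetailedBalance.
Variables (R : realType) (n : nat).
Local Notation C := R[i].
Variables (P : R -> {linear 'M[C]_n -> 'M[C]_n}) (L : {linear 'M[C]_n -> 'M[C]_n}).
Variable sigma : 'M[C]_n.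
Hypothesis P_qms : quantum_markov_semigroup P.
Hypothesis L_gen : generator P L.
Hypothesis P_prim : primitive P sigma.
Hypothesis L_gns : gns_detailed_balance sigma L.
Implicit Types (A B X Y Q rho : 'M[C]_n).

Lemma invariant_posdef : posdef sigma.
Proof.
have [[[s0 _] _] _ rk] := P_prim; apply: psd_unit_posdef => //.
by rewrite -row_full_unit /row_full rk.
Qed.
Let s_pos := invariant_posdef.

Lemma invariant_tr1 : \tr sigma = 1.
Proof. by have [[[_ ]]] := P_prim. Qed.

Lemma gns_symmetric A Y : \tr (sigma *m A *m L Y) = \tr (sigma *m L A *m Y).
Proof.
have := L_gns (A^t*) Y; rewrite /gns_ip (generator_adj P_qms L_gen) !trmxCK.
exact: esym.
Qed.

Lemma generator_tr0 Y : \tr (sigma *m L Y) = 0.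
Proof.
have := gns_symmetric 1%:M Y.
by rewrite (generator1 P_qms L_gen) !mulmx1 mulmx0 mul0mx linear0.
Qed.

Let su : sigma \in unitmx := posdef_unit s_pos.

(** Both products differ by a half power of the modular operator, with which L
    commutes. *)
Lemma kms_symmetric A Y :
  \tr (mxpow sigma (2^-1) *m A *m mxpow sigma (2^-1) *m L Y) =
  \tr (mxpow sigma (2^-1) *m L A *m mxpow sigma (2^-1) *m Y).
Proof.
have half Z : mxpow sigma (2^-1) *m Z *m mxpow sigma (2^-1) =
    sigma *m (mxpow sigma (- 2^-1) *m Z *m mxpow sigma (2^-1)).
  have e : sigma *m mxpow sigma (- 2^-1) = mxpow sigma (2^-1).
    rewrite -{1}(mxpow1 s_pos) (mxpowD _ _ s_pos); congr (mxpow sigma); lra.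
  by rewrite 2!(mulmxA sigma) e.
by rewrite (half A) (half (L A)) gns_symmetric
  (commute_modular_power (2^-1) s_pos (symmetric_modular su gns_symmetric) A).
Qed.

(** A projection whose complement it leaks nothing into is a fixed point: by the
    vanishing of the carre du champ and by detailed balance, no quantum jump
    connects the two blocks in either direction. *)
Lemma generator_projection Q : Q^t* = Q -> Q *m Q = Q ->
  (forall X : 'M[C]_n, L (X *m Q) *m (1%:M - Q) = X *m L Q *m (1%:M - Q)) -> L Q = 0.
Proof.
move=> Qh QQ H.
have two : 2%:R != 0 :> C by rewrite pnatr_eq0.
have L1 : L (1%:M - Q) = - L Q.
  by rewrite linearB (generator1 P_qms L_gen); exact: sub0r.
have [QL <-] := symmetric_projection su gns_symmetric two QQ L1 H.
have := congr1 (fun Z : 'M[C]_n => Z^t*) QL.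
by rewrite adjM -(generator_adj P_qms L_gen) Qh trmx0 map_mx0.
Qed.

End DetailedBalance.

(** * Irreducibility *)

Section Irreducibility.
Variables (R : realType) (n : nat).
Local Notation C := R[i].
Variables (P : R -> {linear 'M[C]_n -> 'M[C]_n}) (L : {linear 'M[C]_n -> 'M[C]_n}).
Variable sigma : 'M[C]_n.
Hypothesis P_qms : quantum_markov_semigroup P.
Hypothesis L_gen : generator P L.
Hypothesis P_prim : primitive P sigma.
Hypothesis L_gns : gns_detailed_balance sigma L.
Implicit Types (A B X Y Q rho : 'M[C]_n).

Let s_pos : posdef sigma := invariant_posdef P_prim.

Lemma invariant_unique rho : psd rho -> (forall Y, \tr (rho *m L Y) = 0) ->
  rho = \tr rho *: sigma.
Proof.
move=> rho0 rhoL; have [tr0|trn0] := eqVneq (\tr rho) 0.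
  rewrite tr0 scale0r; apply/matrixP => i j; rewrite mxE.
  have [] := psd_entry i j rho0; rewrite tr0 /= !normr_le0.
  by case: (rho i j) => a b /= /eqP -> /eqP ->.
have tr_gt0 : 0 < \tr rho by rewrite lt_neqAle eq_sym trn0 psd_tr_ge0.
have [_ uniq _] := P_prim.
rewrite -(uniq ((\tr rho)^-1 *: rho)); first by rewrite scalerA mulfV // scale1r.
split; first split.
- move=> v; rewrite -/(bra v _ v) braZ; apply: mulr_ge0; last exact: rho0.
  by rewrite invr_ge0 ltW.
- by rewrite linearZ /= mulVf.
move=> t t0; apply/matrixP => i j; rewrite mxE /hs_ip.
have cp : completely_positive (P t) by apply: (qms_cp P_qms).
rewrite -(completely_positive_adj _ cp) trmx_delta map_delta_mx.
rewrite -scalemxAr linearZ /= mxtrace_mulC.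
rewrite (generator_invariant P_qms L_gen rhoL) // mxE; congr (_ * _).
rewrite /mxtrace (bigD1 i) //= big1 ?addr0 => [|k ki].
  rewrite mxE (bigD1 j) //= big1 ?addr0 => [|l lj]; first by rewrite mxE !eqxx mulr1.
  by rewrite mxE (negbTE lj) mulr0.
by rewrite mxE big1 // => l _; rewrite mxE (negbTE ki) andbF mulr0.
Qed.

(** By KMS symmetry sigma^(1/2) Q sigma^(1/2) is again an invariant functional, so
    primitivity makes it a multiple of sigma. *)
Lemma generator_fixed_scalar Q : psd Q -> L Q = 0 -> exists c, Q = c%:M.
Proof.
move=> Q0 LQ; pose h := mxpow sigma (2^-1); pose h' := mxpow sigma (- 2^-1).
have hh' : h *m h' = 1%:M := mxpow_mulVr _ s_pos.
have h'h : h' *m h = 1%:M := mxpow_mulVl _ s_pos.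
have sE : sigma = h *m h.
  rewrite -[LHS](mxpow1 s_pos) /h (mxpowD _ _ s_pos); congr (mxpow sigma); lra.
have rho0 : psd (h *m Q *m h).
  by have := psd_conj h Q0; rewrite (mxpow_herm sigma (2^-1) : h^t* = h).
have rhoL Y : \tr (h *m Q *m h *m L Y) = 0.
  by rewrite (kms_symmetric P_qms L_gen P_prim L_gns) LQ mulmx0 !mul0mx linear0.
exists (\tr (h *m Q *m h)); have := invariant_unique rho0 rhoL.
move: (\tr _) => c; rewrite sE; clear -hh' h'h; move: h h' hh' h'h => h h' hh' h'h E.
have : h' *m (h *m Q *m h) *m h' = h' *m (c *: (h *m h)) *m h' by rewrite E.
rewrite -scalemxAr -scalemxAl !mulmxA h'h !mul1mx -mulmxA hh' mulmx1.
by rewrite scalemx1.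
Qed.

Lemma mulmx_sform A U (d : 'I_n -> R) : U \is unitarymx ->
  A *m sform U d = \sum_i (d i)%:C *: (A *m eigvec U i *m (eigvec U i)^t*).
Proof.
move=> Uu; rewrite -[LHS]mulmx1 -(sum_eigvec Uu) mulmx_sumr.
apply: eq_bigr => i _; rewrite mulmxA -(mulmxA A) (sform_eigvec _ _ Uu).
by rewrite -scalemxAr -scalemxAl.
Qed.

(** Mass flows into the kernel of every singular nonzero state: this is what
    makes the Dirichlet form infinite at the boundary. If nothing flowed into the
    kernel projection Q, the carre du champ of Q would vanish outside the kernel,
    so L Q = 0 by detailed balance and Q would be a scalar. *)
Lemma generator_irreducible U (d : 'I_n -> R) i0 j0 : U \is unitarymx ->
  (forall i, 0 <= d i) -> d i0 = 0 -> d j0 != 0 ->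
  0 < complex.Re (\tr (L (sform U (fun i => (d i == 0)%:R)) *m sform U d)).
Proof.
move=> Uu d0 di0 dj0.
set Q := sform U (fun i => (d i == 0)%:R).
have Qh : Q^t* = Q := sform_adj _ _.
have QQ : Q *m Q = Q.
  rewrite /Q (sformM _ _ Uu); apply: eq_sform => i.
  by case: (d i == 0); rewrite ?mulr1 ?mulr0.
have Q0 : psd Q by apply/(psd_sform _ Uu) => i; rewrite ler0n.
have Qe i : Q *m eigvec U i = ((d i == 0)%:R)%:C *: eigvec U i := sform_eigvec _ _ Uu.
have Qe0 i : d i != 0 -> Q *m eigvec U i = 0.
  by move=> di; rewrite Qe (negbTE di) scale0r.
have braQ i : d i != 0 -> 0 <= bra (eigvec U i) (L Q) (eigvec U i).
  move=> di; apply: (generator_pos P_qms L_gen) => //.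
  by rewrite /bra -mulmxA Qe0 // mulmx0 mxE.
have PE : 1%:M - Q = sform U (fun i => (d i != 0)%:R).
  rewrite -(sform_cst 1 Uu) -[- Q]scaleN1r -[-1](rmorphN1 (real_complex R)).
  rewrite sformZ sformD; apply: eq_sform => i.
  by case: (d i == 0); rewrite mulN1r ?subrr ?subr0.
clearbody Q; have trE : \tr (L Q *m sform U d) =
    \sum_i (d i)%:C * bra (eigvec U i) (L Q) (eigvec U i).
  rewrite (tr_bra _ Uu); apply: eq_bigr => i _.
  by rewrite braMr (sform_eigvec _ _ Uu) braZr.
have term0 i : 0 <= (d i)%:C * bra (eigvec U i) (L Q) (eigvec U i).
  have [->|di] := eqVneq (d i) 0; first by rewrite mul0r.
  by apply: mulr_ge0; [rewrite ler0c|exact: braQ].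
suff n0 : \tr (L Q *m sform U d) != 0.
  apply: Re_gt0; rewrite lt_neqAle eq_sym n0 trE; exact: sumr_ge0.
apply/eqP; rewrite trE => /eqP; rewrite psumr_eq0 => [/allP all0|//].
have bra0 i : d i != 0 -> bra (eigvec U i) (L Q) (eigvec U i) = 0.
  move=> di; have := all0 i (mem_index_enum i).
  by rewrite mulf_eq0 => /orP[/eqP/complexI/eqP|/eqP //]; rewrite (negbTE di).
have LQ : L Q = 0.
  apply: (generator_projection P_qms L_gen P_prim L_gns Qh QQ) => X.
  rewrite PE !(mulmx_sform _ _ Uu); apply: eq_bigr => i _.
  have [_|di] := eqVneq (d i) 0; first by rewrite !scale0r.
  by rewrite (generator_kernel P_qms L_gen Qh QQ (Qe0 _ di) (bra0 _ di) X).
have [c Qc] := generator_fixed_scalar Q0 LQ.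
have := Qe j0; rewrite Qc mul_scalar_mx (negbTE dj0) scale0r => /eqP.
rewrite scaler_eq0 (negbTE (eigvec_neq0 _ Uu)) orbF => /eqP c0.
have := Qe i0; rewrite Qc c0 mul_scalar_mx scale0r di0 eqxx scale1r => /esym/eqP.
by rewrite (negbTE (eigvec_neq0 _ Uu)).
Qed.

End Irreducibility.

(** * Both functionals through the q-logarithm *)

Lemma tr_sandwich (K : comNzRingType) n (W h X : 'M[K]_n) :
  \tr (W *m (h *m X *m h)) = \tr (h *m W *m h *m X).
Proof. by rewrite mulmxA mxtrace_mulC !mulmxA. Qed.

Lemma mulmx_regroup (K : comNzRingType) n (a b h W : 'M[K]_n) :
  a *m b = h -> b *m a = h -> a *m (b *m W *m b) *m a = h *m W *m h.
Proof. by move=> ab ba; rewrite !mulmxA ab -[_ *m b *m a]mulmxA ba. Qed.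

Section Functionals.
Variables (R : realType) (n : nat).
Local Notation C := R[i].
Variables (sigma : 'M[C]_n) (L : {linear 'M[C]_n -> 'M[C]_n}).
Implicit Types (A X Y Z : 'M[C]_n) (q c s t : R).

(** With Y = Gamma^(1/q) X and S = sigma^(1/q), this is ln_q Y - ln_q S. It puts
    the Beckner functionals (q > 1) and those of the modified log-Sobolev
    inequality (q = 1) in one formula. *)
Definition qlog_diff q X : 'M[C]_n :=
  mxfun (qln q) (Gamma sigma q^-1 X) - mxfun (qln q) (mxpow sigma q^-1).

Definition qdirichlet q X : R :=
  - (q ^+ 2 / 4) * complex.Re (\tr (qlog_diff q X *m Gamma sigma q^-1 (L X))).

Definition qentropy q X : R :=
  q * complex.Re (\tr (qlog_diff q X *m Gamma sigma q^-1 X)).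

Definition qbeckner q a : Prop := forall X, posdef X -> \tr (sigma *m X) = 1 ->
  a * qentropy q X <= qdirichlet q X.

Hypothesis s_pos : posdef sigma.
Hypothesis s_tr1 : \tr sigma = 1.
Hypothesis L_tr0 : forall Y, \tr (sigma *m L Y) = 0.

Lemma GammaE s X : Gamma sigma s X = mxpow sigma (s / 2) *m X *m mxpow sigma (s / 2).
Proof. by []. Qed.

Lemma Gamma_herm s A : A^t* = A -> (Gamma sigma s A)^t* = Gamma sigma s A.
Proof.
have := mxpow_herm sigma (s / 2); rewrite GammaE.
by move: (mxpow sigma (s / 2)) => h hh Ah; rewrite !adjM hh Ah mulmxA.
Qed.

Lemma Gamma_posdef s X : posdef X -> posdef (Gamma sigma s X).
Proof.
move=> X0; have := posdef_conj (mxpow_unit (s / 2) s_pos) X0.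
by rewrite mxpow_herm.
Qed.

Lemma GammaZ s (z : C) X : Gamma sigma s (z *: X) = z *: Gamma sigma s X.
Proof. by rewrite !GammaE -scalemxAr -scalemxAl. Qed.

Lemma mxpow_sandwich s t : mxpow sigma (s / 2) *m mxpow sigma t *m mxpow sigma (s / 2)
  = mxpow sigma (t + s).
Proof.
rewrite (mxpowD _ _ s_pos) (mxpowD _ _ s_pos); congr (mxpow sigma); lra.
Qed.

Lemma tr_mxpow_Gamma s t X :
  \tr (mxpow sigma t *m Gamma sigma s X) = \tr (mxpow sigma (t + s) *m X).
Proof.
have := mxpow_sandwich s t; rewrite GammaE.
move: (mxpow sigma (s / 2)) (mxpow sigma t) (mxpow sigma (t + s)) => h A B <-.
exact: tr_sandwich.
Qed.

Lemma tr_Gamma1 X : \tr (Gamma sigma 1 X) = \tr (sigma *m X).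
Proof.
by rewrite -[Gamma _ _ _]mul1mx -(mxpow0 sigma) tr_mxpow_Gamma add0r (mxpow1 s_pos).
Qed.

Lemma GammaK t : cancel (Gamma sigma t) (Gamma sigma (- t)).
Proof.
move=> X; rewrite !GammaE mulNr.
have := mxpow_mulVl (t / 2) s_pos; have := mxpow_mulVr (t / 2) s_pos.
move: (mxpow sigma (t / 2)) (mxpow sigma (- (t / 2))) => a a' aa' a'a.
by rewrite !mulmxA a'a mul1mx -mulmxA aa' mulmx1.
Qed.

Lemma mxpow_mxpow s t : mxpow (mxpow sigma s) t = mxpow sigma (s * t).
Proof.
rewrite !mxpowE mxfun_comp; apply: eq_mxfun => // x x0 /=.
by rewrite powRrM.
Qed.

Lemma tr_mxpow_mass q X : q != 0 ->
  \tr (mxpow (mxpow sigma q^-1) (q - 1) *m Gamma sigma q^-1 X) = \tr (sigma *m X).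
Proof.
move=> q0; rewrite mxpow_mxpow tr_mxpow_Gamma.
have -> : q^-1 * (q - 1) + q^-1 = 1 by field.
by rewrite (mxpow1 s_pos).
Qed.

Lemma mxfun_qln q A : posdef A -> q != 1 ->
  mxfun (qln q) A = ((q - 1)^-1)%:C *: (mxpow A (q - 1) - 1%:M).
Proof.
move=> A0 q1; rewrite mxpowE -(mxfun_cst 1 A) mxfunB mxfunZ.
by apply: eq_mxfun => // x x0; rewrite /qln (negbTE q1) mulrC.
Qed.

Lemma sigmaq_posdef q : posdef (mxpow sigma q^-1).
Proof. exact: mxpow_posdef. Qed.

Lemma tr_qlog_diff q X Z : posdef X -> q != 1 ->
  \tr (qlog_diff q X *m Z) = ((q - 1)^-1)%:C *
    (\tr (mxpow (Gamma sigma q^-1 X) (q - 1) *m Z)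
     - \tr (mxpow (mxpow sigma q^-1) (q - 1) *m Z)).
Proof.
move=> X0 q1; rewrite /qlog_diff (mxfun_qln (Gamma_posdef _ X0) q1).
rewrite (mxfun_qln (sigmaq_posdef q) q1) -scalerBr -scalemxAl linearZ /=.
by congr (_ * _); rewrite opprB addrA subrK mulmxBl linearB.
Qed.

Lemma tr_qlog_diff_mass q X Z : posdef X -> q != 0 -> q != 1 ->
  \tr (qlog_diff q X *m Gamma sigma q^-1 Z) = ((q - 1)^-1)%:C *
    (\tr (mxpow (Gamma sigma q^-1 X) (q - 1) *m Gamma sigma q^-1 Z) - \tr (sigma *m Z)).
Proof.
move=> X0 q0 q1; apply: (etrans (tr_qlog_diff (Gamma sigma q^-1 Z) X0 q1)).
exact: (congr1 (fun x => _ * (_ - x)) (tr_mxpow_mass Z q0)).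
Qed.

Lemma dirichlet_pE q X : 1 < q -> posdef X ->
  dirichlet_p sigma L q X = qdirichlet q X.
Proof.
move=> q1 X0; have qn1 : q != 1 by rewrite gt_eqF.
have q0 : q != 0 by rewrite gt_eqF // (lt_trans ltr01).
have qn1' : q - 1 != 0 by rewrite subr_eq0.
rewrite /dirichlet_p /qdirichlet /kms_ip (tr_qlog_diff_mass (L X) X0 q0 qn1).
rewrite (L_tr0 X) subr0.
set W := mxpow (Gamma sigma q^-1 X) (q - 1).
have Wh : W^t* = W := mxpow_herm _ _.
rewrite (Gamma_herm _ Wh).
have -> : mxpow sigma (2^-1) *m Gamma sigma (- (hat q)^-1) W *m mxpow sigma (2^-1) =
    mxpow sigma (q^-1 / 2) *m W *m mxpow sigma (q^-1 / 2).
  have e : mxpow sigma (2^-1) *m mxpow sigma (- (hat q)^-1 / 2) = mxpow sigma (q^-1 / 2).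
    rewrite (mxpowD _ _ s_pos); congr (mxpow sigma); rewrite /hat.
    by field; rewrite q0 qn1'.
  have e' : mxpow sigma (- (hat q)^-1 / 2) *m mxpow sigma (2^-1) = mxpow sigma (q^-1 / 2).
    rewrite (mxpowD _ _ s_pos); congr (mxpow sigma); rewrite /hat.
    by field; rewrite q0 qn1'.
  exact: (mulmx_regroup W e e').
rewrite -(tr_sandwich W (mxpow sigma (q^-1 / 2)) (L X)) -GammaE ReZ /hat.
move: (complex.Re _) => r; field.
by [].
Qed.

Lemma mxfun_scale f A (c : R) : posdef A -> mxfun f (c%:C *: A) = mxfun (fun x => f (c * x)) A.
Proof.
move=> /posdef_sformP[U [d [Uu -> _]]].
by rewrite sformZ !(mxfun_sform _ _ Uu).
Qed.

Lemma qln_mul q c x : 0 < c -> 0 < x ->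
  qln q (c * x) = c `^ (q - 1) * qln q x + qln q c.
Proof.
move=> c0 x0; rewrite /qln; have [->|q1] := eqVneq q 1.
  by rewrite subrr powRr0 mul1r lnM ?posrE // addrC.
rewrite powRM ?ltW //; field.
by rewrite subr_eq0.
Qed.

Lemma mxfun_qln_shift q c A : 0 < c -> posdef A ->
  mxfun (fun=> qln q c) A - mxfun (qln q) A =
  - ((c `^ (q - 1))%:C *: mxfun (qln q) A) + (qln q c)%:C *: mxpow A (q - 1).
Proof.
move=> c0 A0; rewrite -scaleNr -rmorphN.
apply: (etrans (mxfunB _ _ A)); apply/esym; apply: (etrans (congr2 +%R
  (mxfunZ (- c `^ (q - 1)) (qln q) A) (mxfunZ (qln q c) (fun x => x `^ (q - 1)) A))).
apply: (etrans (mxfunD _ _ A)).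
by apply: eq_mxfun => // x x0; rewrite !powR_qln //; ring.
Qed.

(** ln_q(c Y) - ln_q S is c^(q-1) (ln_q Y - ln_q S) + ln_q(c) S^(q-1), and S^(q-1)
    pairs to zero with Z. *)
Lemma qlog_diff_scale q c X Z : 0 < c -> posdef X ->
  \tr (mxpow (mxpow sigma q^-1) (q - 1) *m Z) = 0 ->
  \tr (qlog_diff q (c%:C *: X) *m Z) = (c `^ (q - 1))%:C * \tr (qlog_diff q X *m Z).
Proof.
move=> c0 X0 Z0.
have Yp := Gamma_posdef q^-1 X0; have Sp := sigmaq_posdef q.
suff -> : qlog_diff q (c%:C *: X) = (c `^ (q - 1))%:C *: qlog_diff q X +
    (qln q c)%:C *: mxpow (mxpow sigma q^-1) (q - 1).
  by rewrite mulmxDl -!scalemxAl linearD !linearZ /= Z0 mulr0 addr0.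
rewrite /qlog_diff GammaZ mxfun_scale //.
have -> : mxfun (fun x => qln q (c * x)) (Gamma sigma q^-1 X) =
    (c `^ (q - 1))%:C *: mxfun (qln q) (Gamma sigma q^-1 X) +
    mxfun (fun=> qln q c) (mxpow sigma q^-1).
  rewrite mxfun_cst -(mxfun_cst _ (Gamma sigma q^-1 X)) mxfunZ mxfunD.
  by apply: eq_mxfun => // x x0; rewrite qln_mul.
rewrite scalerBr -!addrA; congr (_ + _).
exact: mxfun_qln_shift.
Qed.

Lemma qdirichlet_scale q c X : 0 < c -> q != 0 -> posdef X ->
  qdirichlet q (c%:C *: X) = c `^ q * qdirichlet q X.
Proof.
move=> c0 q0 X0; rewrite /qdirichlet.
have -> : L (c%:C *: X) = c%:C *: L X by rewrite linearZ.
have := qlog_diff_scale c0 X0 (etrans (tr_mxpow_mass (L X) q0) (L_tr0 X)).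
rewrite (GammaZ q^-1 (c%:C) (L X)).
move: (qlog_diff q (c%:C *: X)) (Gamma sigma q^-1 (L X)) => A B AB.
rewrite -scalemxAr mxtraceZ AB !ReZ.
have -> : c `^ q = c * c `^ (q - 1).
  rewrite -{2}(powRr1 (ltW c0)) -powRD ?(gt_eqF c0) ?implybT //.
  by rewrite addrC subrK.
by move: (complex.Re _) => r; ring.
Qed.

Lemma mxabs_posdef A : posdef A -> mxabs A = A.
Proof.
move=> /posdef_sformP[U [d [Uu -> d0]]].
rewrite /mxabs sform_adj (sformM _ _ Uu) (mxfun_sform _ _ Uu).
by apply: eq_sform => i /=; rewrite -expr2 sqrtr_sqr ger0_norm // ltW.
Qed.

Lemma tr_posdef_ge0 A : posdef A -> 0 <= complex.Re (\tr A).
Proof. by move=> /posdef_psd/psd_tr_ge0/Re_ge0. Qed.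

Lemma pnorm_pow q X : 0 < q -> posdef X ->
  pnorm sigma q X `^ q = complex.Re (\tr (mxpow (Gamma sigma q^-1 X) q)).
Proof.
move=> q0 X0; have Yp := Gamma_posdef q^-1 X0.
rewrite /pnorm mxabs_posdef // -powRrM mulVf ?gt_eqF // powRr1 //.
by apply: tr_posdef_ge0; exact: mxpow_posdef.
Qed.

Lemma pnorm1 X : posdef X -> pnorm sigma 1 X = complex.Re (\tr (sigma *m X)).
Proof.
move=> X0; have := pnorm_pow ltr01 X0.
have Yp := Gamma_posdef 1^-1 X0.
rewrite mxpow1 // powRr1 ?powR_ge0 // => ->.
by rewrite invr1 tr_Gamma1.
Qed.

Lemma mxpow_scale A c s : 0 < c -> posdef A -> mxpow (c%:C *: A) s = (c `^ s)%:C *: mxpow A s.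
Proof.
move=> c0 A0; rewrite !mxpowE mxfun_scale // mxfunZ.
by apply: eq_mxfun => // x x0; rewrite powRM // ltW.
Qed.

Lemma posdef_scale A c : 0 < c -> posdef A -> posdef (c%:C *: A).
Proof.
move=> c0 A0 v v0; rewrite -/(bra v _ v) braZ mulr_gt0 ?ltcR //.
exact: A0.
Qed.

(** At mass 1 one has Tr(S^(q-1) Y) = Tr(sigma X) = 1, so subtracting ln_q S from
    ln_q Y under the trace with Y subtracts exactly the 1-norm term. *)
Lemma beckner_entropyE q c X : 1 < q -> 0 < c -> posdef X -> \tr (sigma *m X) = 1 ->
  hat q * (pnorm sigma q (c%:C *: X) `^ q - pnorm sigma 1 (c%:C *: X) `^ q)
  = c `^ q * qentropy q X.
Proof.
move=> q1 c0 X0 X1; have qn1 : q != 1 by rewrite gt_eqF.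
have q0 : 0 < q by rewrite (lt_trans ltr01).
have Yp := Gamma_posdef q^-1 X0; have cXp := posdef_scale c0 X0.
apply: (etrans (congr2 (fun a b => hat q * (a - b `^ q)) (pnorm_pow q0 cXp) (pnorm1 cXp))).
rewrite (GammaZ q^-1 c%:C X) (mxpow_scale q c0 Yp).
rewrite mxtraceZ ReZ -(scalemxAr c%:C sigma X) mxtraceZ X1 mulr1.
rewrite /qentropy (tr_qlog_diff_mass X X0 (lt0r_neq0 q0) qn1) X1.
have -> : mxpow (Gamma sigma q^-1 X) (q - 1) *m Gamma sigma q^-1 X = mxpow (Gamma sigma q^-1 X) q.
  move: (Gamma sigma q^-1 X) Yp => A A0.
  by rewrite -{2}(mxpow1 A0) (mxpowD _ _ A0) subrK.
rewrite ReZ ReD ReN /hat /=; move: (complex.Re _) => r.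
by field; rewrite subr_eq0.
Qed.

Lemma normalize X : posdef X ->
  exists c X', [/\ 0 < c, posdef X', \tr (sigma *m X') = 1 & X = c%:C *: X'].
Proof.
move=> X0; have Yp := Gamma_posdef 1 X0.
have trE : \tr (sigma *m X) = \tr (Gamma sigma 1 X) := esym (tr_Gamma1 X).
have n0 : (0 < n)%N.
  rewrite lt0n; apply/eqP => n0; have /eqP := s_tr1; rewrite /mxtrace big1 => [|i _].
    by rewrite eq_sym oner_eq0.
  by have := ltn_ord i; rewrite [X in (_ < X)%N]n0.
have := posdef_tr_gt0 n0 Yp; rewrite -trE => tr_gt0.
pose c := complex.Re (\tr (sigma *m X)); have c0 : 0 < c by exact: Re_gt0.
have cE : \tr (sigma *m X) = c%:C by apply: ge0_ReP; exact: ltW.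
exists c, ((c^-1)%:C *: X); split.
- exact: c0.
- by apply: posdef_scale; rewrite ?invr_gt0.
- by rewrite -scalemxAr mxtraceZ cE -rmorphM mulVf ?gt_eqF.
- by rewrite scalerA -rmorphM mulfV ?gt_eqF // scale1r.
Qed.

(** Both sides are homogeneous of degree q, so mass 1 is no restriction. *)
Lemma qbecknerP q a : 1 < q -> beckner sigma L q a <-> qbeckner q a.
Proof.
move=> q1; have q0 : q != 0 by rewrite gt_eqF // (lt_trans ltr01).
split=> H X X0.
  move=> X1; have := H _ (posdef_scale ltr01 X0).
  have := congr1 ( *%R a) (beckner_entropyE q1 ltr01 X0 X1); rewrite mulrA => ->.
  by rewrite rmorph1 scale1r powR1 mul1r (dirichlet_pE q1 X0).
have [c [X' [c0 X'0 X'1 XE]]] := normalize X0.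
have HX := H X' X'0 X'1; rewrite XE; clear XE.
rewrite (dirichlet_pE q1 (posdef_scale c0 X'0)) (qdirichlet_scale c0 q0 X'0).
apply: (le_trans _ (ler_wpM2l (powR_ge0 c q) HX)).
have E := congr1 ( *%R a) (beckner_entropyE q1 c0 X'0 X'1).
by rewrite mulrA in E; rewrite E mulrCA.
Qed.

Lemma dirichlet_1E X : dirichlet_1 sigma L X = qdirichlet 1 X.
Proof.
rewrite /dirichlet_1 /qdirichlet /qlog_diff /kms_ip invr1 expr1n mul1r.
have -> : qln (1 : R) = @ln R by apply/funext => x; rewrite /qln eqxx.
rewrite (mxpow1 s_pos) !mxlogE.
have := mxfun_herm (@ln R) (Gamma sigma 1 X); have := mxfun_herm (@ln R) sigma.
move: (mxfun _ sigma) (mxfun _ (Gamma sigma 1 X)) => A B Ah Bh.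
have e : (1 / 2 : R) = 2^-1 by rewrite mul1r.
rewrite adjD adjN Ah Bh GammaE e; congr (- _ * complex.Re _).
move: (B - A) (mxpow sigma (2^-1)) (L X) => W h Z.
by rewrite -tr_sandwich.
Qed.

Lemma ent_1E c X : 0 < c -> posdef X -> \tr (sigma *m X) = 1 ->
  ent_1 sigma (c%:C *: X) = c * qentropy 1 X.
Proof.
move=> c0 X0 X1; have cXp := posdef_scale c0 X0.
have Yp := Gamma_posdef 1 X0.
rewrite /ent_1 /qentropy /qlog_diff pnorm1 // invr1 mul1r.
have -> : qln (1 : R) = @ln R by apply/funext => x; rewrite /qln eqxx.
rewrite -scalemxAr mxtraceZ X1 mulr1 (mxpow1 s_pos) !mxlogE GammaZ.
have -> : mxfun (@ln R) (c%:C *: Gamma sigma 1 X) =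
    mxfun (@ln R) (Gamma sigma 1 X) + (ln c)%:C *: 1%:M.
  rewrite mxfun_scale // scalemx1 -(mxfun_cst _ (Gamma sigma 1 X)) mxfunD.
  by apply: eq_mxfun => // x x0; rewrite lnM ?posrE // addrC.
have trY : \tr (Gamma sigma 1 X) = 1 := etrans (tr_Gamma1 X) X1.
move: trY (mxfun (@ln R) (Gamma sigma 1 X)) (mxfun (@ln R) sigma).
move: (Gamma sigma 1 X) => Y trY A B.
rewrite addrAC mulmxDr -!scalemxAl -!scalemxAr mulmx1 mxtraceD !mxtraceZ trY.
rewrite (mxtrace_mulC Y) ReD !ReZ mulr1 /=.
by move: (complex.Re _) => r; ring.
Qed.

Lemma mlsiP a : mlsi sigma L a <-> qbeckner 1 a.
Proof.
split=> H X X0.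
  move=> X1; have := H _ (posdef_scale ltr01 X0).
  by rewrite (ent_1E ltr01 X0 X1) rmorph1 scale1r mul1r dirichlet_1E.
have [c [X' [c0 X'0 X'1 ->]]] := normalize X0.
rewrite dirichlet_1E (ent_1E c0 X'0 X'1) (qdirichlet_scale c0 (oner_neq0 R) X'0).
by rewrite (powRr1 (ltW c0)) mulrCA ler_pM2l //; exact: H.
Qed.

End Functionals.

(** * Both functionals as quadratic forms *)

Lemma mulmx_commute_sub (K : comNzRingType) n (A : 'M[K]_n) (s : K) (v : 'cV[K]_n) B :
  B *m v = s *: v -> (A - B) *m v = (A - s%:M) *m v.
Proof. by move=> Bv; rewrite !mulmxBl Bv mul_scalar_mx. Qed.

Section QuadraticForms.
Variables (R : realType) (n : nat).
Local Notation C := R[i].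
Variables (sigma : 'M[C]_n) (L : {linear 'M[C]_n -> 'M[C]_n}).
Variables (V : 'M[C]_n) (m : 'I_n -> R).
Hypothesis Vu : V \is unitarymx.
Hypothesis sigmaE : sigma = sform V m.
Hypothesis m_gt0 : forall j, 0 < m j.
Hypothesis s_tr1 : \tr sigma = 1.
Hypothesis L1 : L 1%:M = 0.
Implicit Types (A X Y Z : 'M[C]_n) (q c s t : R).

Let s_pos : posdef sigma.
Proof. by rewrite sigmaE; apply/posdef_sform. Qed.

Local Notation v := (eigvec V).

Lemma mxpow_sigma t : mxpow sigma t = sform V (fun j => m j `^ t).
Proof. by rewrite sigmaE; exact: (mxfun_sform _ _ Vu). Qed.

Lemma mxpow_sigma_eigvec t j : mxpow sigma t *m v j = (m j `^ t)%:C *: v j.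
Proof. by rewrite mxpow_sigma; exact: sform_eigvec. Qed.

Lemma mxfun_mxpow_eigvec f t j : mxfun f (mxpow sigma t) *m v j = (f (m j `^ t))%:C *: v j.
Proof. by rewrite mxpow_sigma (mxfun_sform _ _ Vu); exact: sform_eigvec. Qed.

Lemma Gamma1 t : Gamma sigma t 1%:M = mxpow sigma t.
Proof. by rewrite -(mxpow0 sigma) GammaE (mxpow_sandwich s_pos) add0r. Qed.

Lemma GammaB t X Y : Gamma sigma t (X - Y) = Gamma sigma t X - Gamma sigma t Y.
Proof. by rewrite !GammaE mulmxBr mulmxBl. Qed.

Lemma Gamma_sub1_eigvec t X j :
  Gamma sigma t (X - 1%:M) *m v j = (Gamma sigma t X - ((m j `^ t)%:C)%:M) *m v j.
Proof.
by rewrite GammaB Gamma1; apply: mulmx_commute_sub; exact: mxpow_sigma_eigvec.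
Qed.

(** The q-logarithms of Y and S differ, on each eigenvector of S, by the divided
    difference of the q-logarithm in Y applied to Y - S. *)
Lemma qlog_diff_eigvec q X j : posdef X ->
  qlog_diff sigma q X *m v j =
  mxfun (qln_slope q (m j `^ q^-1)) (Gamma sigma q^-1 X)
    *m (Gamma sigma q^-1 (X - 1%:M) *m v j).
Proof.
move=> X0; rewrite Gamma_sub1_eigvec /qlog_diff.
rewrite (mulmx_commute_sub _ (mxfun_mxpow_eigvec (qln q) q^-1 j)).
have := Gamma_posdef s_pos q^-1 X0; move: (Gamma sigma q^-1 X) => Y Y0.
rewrite mulmxA; congr (_ *m _).
rewrite mxfun_subC (sub_scalar_mxfun _ (psd_herm (posdef_psd Y0))) mxfunM.
by apply: (eq_mxfun Y0) => x _; rewrite qln_slopeE.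
Qed.

Lemma qdirichletE q X : posdef X ->
  qdirichlet sigma L q X = - (q ^+ 2 / 4) * complex.Re (\sum_j
    bra (v j) (Gamma sigma q^-1 (L (X - 1%:M)))
      (mxfun (qln_slope q (m j `^ q^-1)) (Gamma sigma q^-1 X)
        *m (Gamma sigma q^-1 (X - 1%:M) *m v j))).
Proof.
move=> X0; rewrite /qdirichlet mxtrace_mulC (tr_bra _ Vu).
congr (_ * complex.Re _); apply: eq_bigr => j _.
rewrite braMr (qlog_diff_eigvec q j X0).
by rewrite (_ : L X = L (X - 1%:M)) // linearB L1; exact: (esym (subr0 _)).
Qed.

(** At mass 1 the matrix S^(q-1) has trace 0 against Y - S, which may thus be
    subtracted: the first-order term disappears and a Bregman remainder is left,
    quadratic in Y - S = Gamma^(1/q)(X - 1). *)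
Lemma qentropyE q X : 1 <= q -> posdef X -> \tr (sigma *m X) = 1 ->
  qentropy sigma q X = q * complex.Re (\sum_j
    bra (Gamma sigma q^-1 (X - 1%:M) *m v j)
      (mxfun (bregman_slope q (m j `^ q^-1)) (Gamma sigma q^-1 X))
      (Gamma sigma q^-1 (X - 1%:M) *m v j)).
Proof.
move=> q1 X0 X1; rewrite /qentropy; congr (_ * complex.Re _).
have q0 : q != 0 by rewrite gt_eqF // (lt_le_trans ltr01).
pose Sq := mxpow (mxpow sigma q^-1) (q - 1).
have trB : \tr (Sq *m Gamma sigma q^-1 (X - 1%:M)) = 0.
  rewrite (tr_mxpow_mass s_pos _ q0) mulmxBr mulmx1 linearB /= X1 s_tr1.
  exact: subrr.
have -> : \tr (qlog_diff sigma q X *m Gamma sigma q^-1 X) =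
    \tr (Gamma sigma q^-1 X *m qlog_diff sigma q X - Gamma sigma q^-1 (X - 1%:M) *m Sq).
  rewrite linearB /= mxtrace_mulC [X in _ = _ - X]mxtrace_mulC trB.
  exact: (esym (subr0 _)).
rewrite (tr_bra _ Vu); apply: eq_bigr => j _.
apply: (etrans (braB _ _ _ _)).
apply: (etrans (congr2 (fun x y => x - y) (braMr _ _ _ _) (braMr _ _ _ _))).
apply: (etrans (congr1 (fun z => bra _ _ z - _) (qlog_diff_eigvec q j X0))).
have Sv : Sq *m v j = ((m j `^ q^-1) `^ (q - 1))%:C *: v j.
  by rewrite /Sq mxpowE; exact: mxfun_mxpow_eigvec.
apply: (etrans (congr1 (fun z => _ - bra _ _ z) Sv)).
have := Gamma_posdef s_pos q^-1 X0.
have : (Gamma sigma q^-1 (X - 1%:M))^t* = Gamma sigma q^-1 (X - 1%:M).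
  apply: Gamma_herm; rewrite adjD adjN adj1 (psd_herm (posdef_psd X0)) //.
have := Gamma_sub1_eigvec q^-1 X j.
move: (Gamma sigma q^-1 X) (Gamma sigma q^-1 (X - 1%:M)) (v j) (m j `^ q^-1) => Y B w s Bw Bh Y0.
have Yh := psd_herm (posdef_psd Y0).
have -> : bra (B *m w) (mxfun (bregman_slope q s) Y) (B *m w) =
    bra w (mxfun (bregman q s) Y) w.
  rewrite Bw (sub_scalar_mxfun _ Yh) -{1}(mxfun_herm _ Y) -braMl -braMr !mxfunM.
  apply: (congr1 (fun Z => bra w Z w)); apply: (eq_mxfun Y0) => x _.
  by rewrite bregman_slopeE; ring.
have wB : bra w B w = bra w (mxfun (fun x => x - s) Y) w.
  by rewrite -[B]mul1mx braMr Bw -braMr mul1mx (sub_scalar_mxfun _ Yh).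
have wY (k : R -> R) : bra w Y (mxfun k Y *m (B *m w)) =
    bra w (mxfun (fun x => x * (k x * (x - s))) Y) w.
  have e := etrans (congr2 mulmx (esym (mxfun_id Yh)) (mxfunM k (fun x => x - s) Y))
    (mxfunM id _ Y).
  have e2 : B *m w = mxfun (fun x => x - s) Y *m w.
    by apply: (etrans Bw); rewrite (sub_scalar_mxfun _ Yh).
  apply: (etrans (congr1 (fun z => bra w Y (mxfun k Y *m z)) e2)).
  apply: (etrans (congr1 (bra w Y) (mulmxA _ _ _))).
  apply: (etrans (esym (braMr _ _ _ _))).
  exact: (congr1 (fun Z => bra w Z w) e).
rewrite braZr wB wY -braZ -braB mxfunZ mxfunB.
apply: (congr1 (fun Z => bra w Z w)); apply: (eq_mxfun Y0) => x _.
by rewrite /bregman qln_slopeE.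
Qed.

End QuadraticForms.

(** * Second-order limits of the functionals *)

Section GammaLimits.
Variables (R : realType) (n : nat).
Local Notation C := R[i].
Variable sigma : 'M[C]_n.
Hypothesis s_pos : posdef sigma.
Variables (T : Type) (F : set_system T).
Context {FF : ProperFilter F}.
Variables (r : T -> R) (r0 : R).
Hypothesis rr0 : r t @[t --> F] --> r0.

Lemma mxpow_mcvg : mcvg F (fun t => mxpow sigma (r t)) (mxpow sigma r0).
Proof.
have [V [m [Vu sigmaE m_gt0]]] := posdef_sformP s_pos.
rewrite (mxpow_sigma Vu sigmaE).
apply: (eq_mcvg (fun t => esym (mxpow_sigma Vu sigmaE (r t)))).
apply: mcvg_sform; first exact: mcvg_cst.
by move=> i; apply: powR_cvg2 => //; exact: cvg_cst.
Qed.

End GammaLimits.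

Lemma Gamma_mcvg (R : realType) n (sigma : 'M[R[i]]_n) (s_pos : posdef sigma)
    (T : Type) (F : set_system T) {FF : ProperFilter F} (r : T -> R) (r0 : R)
    (A : T -> 'M[R[i]]_n) A0 : r t @[t --> F] --> r0 ->
  mcvg F A A0 -> mcvg F (fun t => Gamma sigma (r t) (A t)) (Gamma sigma r0 A0).
Proof.
move=> rr0 AA0.
have h : mcvg F (fun t => mxpow sigma (r t / 2)) (mxpow sigma (r0 / 2)).
  by apply: (mxpow_mcvg s_pos); exact: cvgMl.
exact: (mcvgM (mcvgM h AA0) h).
Qed.

Section MainLimit.
Variables (R : realType) (n : nat).
Local Notation C := R[i].
Variables (sigma : 'M[C]_n) (L : {linear 'M[C]_n -> 'M[C]_n}).
Variables (V : 'M[C]_n) (m : 'I_n -> R).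
Hypothesis Vu : V \is unitarymx.
Hypothesis sigmaE : sigma = sform V m.
Hypothesis m_gt0 : forall j, 0 < m j.
Hypothesis s_tr1 : \tr sigma = 1.
Hypothesis L1 : L 1%:M = 0.
Variables (T : Type) (F : set_system T).
Hypothesis FU : UltraFilter F.
Variable q : T -> R.
Hypothesis q_ge1 : forall t, 1 <= q t.
Hypothesis q_cvg1 : q t @[t --> F] --> (1 : R).

Let FP : ProperFilter F := @ultra_proper _ _ FU.
#[local] Existing Instance FP.
Local Notation v := (eigvec V).

Let s_pos : posdef sigma.
Proof. by rewrite sigmaE; apply/posdef_sform. Qed.

Lemma qV_cvg : (q t)^-1 @[t --> F] --> (1 : R).
Proof. by rewrite -[X in _ --> X]invr1; apply: cvgV => //; exact: oner_neq0. Qed.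

Lemma eigval_powR_cvg j : m j `^ (q t)^-1 @[t --> F] --> m j.
Proof.
rewrite -[X in _ --> X](powRr1 (ltW (m_gt0 j))).
by apply: powR_cvg2 => //; [exact: cvg_cst|exact: qV_cvg].
Qed.

(** At Xi = X0 - 1 these two forms are the entropy and the Dirichlet form of X0
    for q = 1; for X0 = 1 they are half their second derivatives at equilibrium
    in the direction Xi. *)
Definition entropy_form X0 (Xi : 'M[C]_n) : R := complex.Re (\sum_j
  bra (Gamma sigma 1 Xi *m v j) (mxfun (bregman_slope 1 (m j)) (Gamma sigma 1 X0))
    (Gamma sigma 1 Xi *m v j)).

Definition dirichlet_form X0 (Xi : 'M[C]_n) : R := - 4^-1 * complex.Re (\sum_j
  bra (v j) (Gamma sigma 1 (L Xi)) (mxfun (qln_slope 1 (m j)) (Gamma sigma 1 X0)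
    *m (Gamma sigma 1 Xi *m v j))).

Variables (X : T -> 'M[C]_n) (X0 Xi : 'M[C]_n) (b : T -> R).
Hypothesis X_posdef : forall t, posdef (X t).
Hypothesis X_mass : forall t, \tr (sigma *m X t) = 1.
Hypothesis X_cvg : mcvg F X X0.
Hypothesis X0_posdef : posdef X0.
Hypothesis b_gt0 : forall t, 0 < b t.
Hypothesis Xi_cvg : mcvg F (fun t => ((b t)^-1)%:C *: (X t - 1%:M)) Xi.

Lemma mxfun_slope_cvg (f : R -> R -> R -> R) j :
  (forall (s x : T -> R) (s0 x0 : R),
    (forall t, 0 < s t) -> 0 < s0 -> s t @[t --> F] --> s0 ->
    (forall t, 0 < x t) -> 0 < x0 -> x t @[t --> F] --> x0 ->
    f (q t) (s t) (x t) @[t --> F] --> f 1 s0 x0) ->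
  mcvg F (fun t => mxfun (f (q t) (m j `^ (q t)^-1)) (Gamma sigma (q t)^-1 (X t)))
    (mxfun (f 1 (m j)) (Gamma sigma 1 X0)).
Proof.
move=> fc; apply: (mcvg_mxfun FU).
- by move=> t; exact: (Gamma_posdef s_pos _ (X_posdef t)).
- by apply: (Gamma_mcvg s_pos) => //; exact: qV_cvg.
- exact: (Gamma_posdef s_pos _ X0_posdef).
- move=> x x0 xp x00 xx0; apply: fc => //; last exact: eigval_powR_cvg.
  by move=> t; exact: powR_gt0.
Qed.

Lemma Gamma_scaled_cvg j : mcvg F
  (fun t => Gamma sigma (q t)^-1 (((b t)^-1)%:C *: (X t - 1%:M)) *m v j) (Gamma sigma 1 Xi *m v j).
Proof.
by apply: mcvgM (mcvg_cst (v j)); apply: (Gamma_mcvg s_pos) => //; exact: qV_cvg.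
Qed.

(** In the quadratic formulas q and X enter only through powers of sigma and
    through divided differences, which are continuous up to q = 1. The scale b
    is free: b = 1 gives continuity in q, b = |X - 1| the behaviour near 1. *)
Lemma qentropy_cvg :
  (b t)^-1 ^+ 2 * qentropy sigma (q t) (X t) @[t --> F] --> entropy_form X0 Xi.
Proof.
pose B t j := Gamma sigma (q t)^-1 (((b t)^-1)%:C *: (X t - 1%:M)) *m v j.
pose H t j := mxfun (bregman_slope (q t) (m j `^ (q t)^-1)) (Gamma sigma (q t)^-1 (X t)).
have -> : (fun t => (b t)^-1 ^+ 2 * qentropy sigma (q t) (X t)) =
    fun t => q t * complex.Re (\sum_j bra (B t j) (H t j) (B t j)).
  apply/funext => t.
  rewrite (qentropyE Vu sigmaE m_gt0 s_tr1 (q_ge1 t) (X_posdef t) (X_mass t)).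
  rewrite mulrCA -ReZ; congr (_ * complex.Re _); rewrite mulr_sumr; apply: eq_bigr => j _.
  rewrite /B GammaZ -scalemxAl braZl braZr conj_real mulrA -rmorphM -expr2.
  by [].
rewrite -[X in _ --> X]mul1r; apply: cvgM => //.
suff [] : ccvg F (fun t => \sum_j bra (B t j) (H t j) (B t j)) (\sum_j
    bra (Gamma sigma 1 Xi *m v j) (mxfun (bregman_slope 1 (m j)) (Gamma sigma 1 X0))
    (Gamma sigma 1 Xi *m v j)) by [].
apply: ccvg_sum => j; apply: mcvg_bra; [exact: Gamma_scaled_cvg| |exact: Gamma_scaled_cvg].
by apply: mxfun_slope_cvg => s x s0 x0 *; exact: bregman_slope_cvg.
Qed.

Lemma qdirichlet_cvg :
  (b t)^-1 ^+ 2 * qdirichlet sigma L (q t) (X t) @[t --> F] --> dirichlet_form X0 Xi.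
Proof.
pose B t j := Gamma sigma (q t)^-1 (((b t)^-1)%:C *: (X t - 1%:M)) *m v j.
pose H t j := mxfun (qln_slope (q t) (m j `^ (q t)^-1)) (Gamma sigma (q t)^-1 (X t)).
pose Z t := Gamma sigma (q t)^-1 (L (((b t)^-1)%:C *: (X t - 1%:M))).
have -> : (fun t => (b t)^-1 ^+ 2 * qdirichlet sigma L (q t) (X t)) =
    fun t => - (q t ^+ 2 / 4) * complex.Re (\sum_j bra (v j) (Z t) (H t j *m B t j)).
  apply/funext => t.
  rewrite (qdirichletE Vu sigmaE m_gt0 L1 (q t) (X_posdef t)).
  rewrite mulrCA -ReZ; congr (_ * complex.Re _); rewrite mulr_sumr; apply: eq_bigr => j _.
  rewrite /B /Z; have -> : L (((b t)^-1)%:C *: (X t - 1%:M)) = ((b t)^-1)%:C *: L (X t - 1%:M).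
    by rewrite linearZ.
  rewrite !GammaZ -scalemxAl -scalemxAr braZr braZ mulrA -rmorphM -expr2.
  by [].
apply: cvgM.
  rewrite -[X in _ --> - X]mul1r -(expr1n R 2); apply: cvgN; apply: cvgMl.
  by rewrite expr2; under eq_fun do rewrite expr2; exact: cvgM.
suff [] : ccvg F (fun t => \sum_j bra (v j) (Z t) (H t j *m B t j)) (\sum_j
  bra (v j) (Gamma sigma 1 (L Xi)) (mxfun (qln_slope 1 (m j)) (Gamma sigma 1 X0)
    *m (Gamma sigma 1 Xi *m v j))) by [].
apply: ccvg_sum => j; apply: mcvg_bra; first exact: mcvg_cst.
  by apply: (Gamma_mcvg s_pos); [exact: qV_cvg|exact: mcvg_linear].
apply: mcvgM; last exact: Gamma_scaled_cvg.
by apply: mxfun_slope_cvg => s x s0 x0 *; exact: qln_slope_cvg.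
Qed.

(** The Bregman slopes are positive and Gamma is injective. *)
Lemma entropy_form_gt0 : Xi != 0 -> 0 < entropy_form X0 Xi.
Proof.
move=> Xi0; have Yp := Gamma_posdef s_pos 1 X0_posdef.
have hp j : posdef (mxfun (bregman_slope 1 (m j)) (Gamma sigma 1 X0)).
  by apply: posdef_mxfun => // x x0; exact: bregman_slope_gt0.
have [j Bj] : exists j, Gamma sigma 1 Xi *m v j != 0.
  apply/existsP; rewrite -negb_forall; apply: contra Xi0 => /forallP B0.
  have B : Gamma sigma 1 Xi = 0.
    rewrite -[LHS]mulmx1 -(sum_eigvec Vu) mulmx_sumr big1 // => j _.
    by rewrite mulmxA (eqP (B0 j)) mul0mx.
  apply/eqP; apply: (etrans (esym (GammaK s_pos 1 Xi))).
  by rewrite B GammaE mulmx0; exact: mul0mx.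
rewrite /entropy_form Re_sum (bigD1 j) //= ltr_wpDr //.
  by apply: sumr_ge0 => i _; apply: Re_ge0; exact: (posdef_psd (hp i)).
by apply: Re_gt0; exact: hp.
Qed.

End MainLimit.

(** * Eventually bounded functions *)

Definition eventually_bounded (R : realType) (T : Type) (F : set_system T)
    (g : T -> R) : Prop :=
  exists M, \forall t \near F, `|g t| <= M.

Section EventuallyBounded.
Variables (R : realType) (T : Type) (F : set_system T).
Context {FF : ProperFilter F}.
Implicit Types g h : T -> R.

Lemma cvg_ebounded g (l : R) : g t @[t --> F] --> l -> eventually_bounded F g.
Proof.
move=> gl; exists (`|l| + 1).
have /cvgrPdist_le/(_ _ ltr01) := gl; apply: filterS => t lg.
by rewrite -[g t](subKr l) (le_trans (ler_normB _ _)) // lerD2l.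
Qed.

Lemma eboundedM g h : eventually_bounded F g -> eventually_bounded F h ->
  eventually_bounded F (fun t => g t * h t).
Proof.
move=> [M gM] [N hN]; exists (M * N); apply: filterS2 gM hN => t gM hN.
by rewrite normrM; apply: ler_pM.
Qed.

Lemma eboundedD g h : eventually_bounded F g -> eventually_bounded F h ->
  eventually_bounded F (fun t => g t + h t).
Proof.
move=> [M gM] [N hN]; exists (M + N); apply: filterS2 gM hN => t gM hN.
by rewrite (le_trans (ler_normD _ _)) // lerD.
Qed.

Lemma ebounded_sum (I : finType) (g : I -> T -> R) :
  (forall i, eventually_bounded F (g i)) ->
  eventually_bounded F (fun t => \sum_i g i t).
Proof.
move=> gB; elim: (index_enum I) => [|i s [M IH]].
  by exists 0; apply: nearW => t; rewrite big_nil normr0.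
have [N gN] := gB i; exists (N + M); apply: filterS2 gN IH => t gN gM.
by rewrite big_cons (le_trans (ler_normD _ _)) // lerD.
Qed.

(** If all terms are bounded above and one tends to minus infinity, the sum
    cannot stay bounded below. *)
Lemma sum_to_minus_infinity (I : finType) (g : I -> T -> R) i0 (c : R) :
  (forall i, exists M, \forall t \near F, g i t <= M) ->
  (forall K, \forall t \near F, g i0 t <= - K) ->
  ~ \forall t \near F, c <= \sum_i g i t.
Proof.
move=> gU gi0 H.
have [M gM] : exists M, \forall t \near F, \sum_(i | i != i0) g i t <= M.
  elim: (index_enum I) => [|i s [M IH]].
    by exists 0; apply: nearW => t; rewrite big_nil.
  have [N gN] := gU i; exists (`|N| + M); apply: filterS2 gN IH => t gN gM.
  rewrite big_cons; case: ifP => _; last by rewrite (le_trans gM) // lerDr.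
  by rewrite lerD // (le_trans gN) // ler_norm.
have : \forall t \near F, False.
  apply: filterS3 H gM (gi0 (M - c + 1)) => t; rewrite (bigD1 i0) //=; lra.
by move=> /filter_ex[].
Qed.

(** For every q >= 1 the q-logarithm is increasing, so it suffices to compare with
    its value at one small d, where it converges to ln d. *)
Lemma qln_minus_infinity (q x : T -> R) : (forall t, 1 <= q t) ->
  q t @[t --> F] --> (1 : R) -> (forall t, 0 < x t) -> x t @[t --> F] --> (0 : R) ->
  forall K, \forall t \near F, qln (q t) (x t) <= - K.
Proof.
move=> q1 qc xp x0 K; pose d : R := expR (- K - 1).
have d0 : 0 < d := expR_gt0 _.
have dc : qln (q t) d @[t --> F] --> ln d by apply: qln_cvg => //; exact: cvg_cst.
have xd : \forall t \near F, x t <= d by apply: (cvgr_le _ x0).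
have qd : \forall t \near F, qln (q t) d <= - K.
  by apply: (cvgr_le _ dc); rewrite expRK; lra.
have H t : x t <= d -> qln (q t) d <= - K -> qln (q t) (x t) <= - K.
  by move=> xd1; apply: le_trans; exact: qln_le.
exact: (filterS2 _ H xd qd).
Qed.

(** For x <= 1 the product lies between x ln x and 0, and x ln x >= x - 1. *)
Lemma qln_mul_ebounded (q x : T -> R) (x0 : R) : (forall t, 1 <= q t) ->
  q t @[t --> F] --> (1 : R) -> (forall t, 0 < x t) -> 0 <= x0 ->
  x t @[t --> F] --> x0 -> eventually_bounded F (fun t => qln (q t) (x t) * x t).
Proof.
move=> q1 qc xp; rewrite le_eqVlt => /orP[/eqP <-|x00] xc; last first.
  apply: (@cvg_ebounded _ (ln x0 * x0)); apply: cvgM => //; exact: qln_cvg.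
exists 1.
have x1 : \forall t \near F, x t <= 1 by apply: (cvgr_le _ xc); exact: ltr01.
have f0 := qln_minus_infinity q1 qc xp xc 0.
apply: filterS2 x1 f0 => t x1; rewrite oppr0 => f0.
rewrite ler0_norm; last by rewrite mulr_le0_ge0 // ltW.
have := ln_le_qln (q1 t) (xp t); have := ln_ge (xp t).
rewrite -(ler_pM2r (xp t)) mulrBl mulVf ?gt_eqF // mul1r => h1.
rewrite -(ler_pM2r (xp t)) => h2; have := xp t; lra.
Qed.

End EventuallyBounded.

(** * Compactness of normalized operators *)

Section Compactness.
Variables (R : realType) (n : nat).
Local Notation C := R[i].
Variables (P : R -> {linear 'M[C]_n -> 'M[C]_n}) (L : {linear 'M[C]_n -> 'M[C]_n}).
Variable sigma : 'M[C]_n.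
Hypothesis P_qms : quantum_markov_semigroup P.
Hypothesis L_gen : generator P L.
Hypothesis P_prim : primitive P sigma.
Hypothesis L_gns : gns_detailed_balance sigma L.
Variables (T : Type) (F : set_system T).
Hypothesis FU : UltraFilter F.
Let FP : ProperFilter F := @ultra_proper _ _ FU.
#[local] Existing Instance FP.

Let s_pos : posdef sigma := invariant_posdef P_prim.
Let s_tr1 : \tr sigma = 1 := invariant_tr1 P_prim.
Variable X : T -> 'M[C]_n.
Hypothesis X_posdef : forall t, posdef (X t).
Hypothesis X_mass : forall t, \tr (sigma *m X t) = 1.

(** Gamma (X t) is a density matrix, whose entries are bounded by its trace; its
    limit is transported back to X by the inverse of Gamma. *)
Lemma density_mcvg : exists X0, [/\ mcvg F X X0, psd X0 & \tr (sigma *m X0) = 1].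
Proof.
have [rho rhoc] : exists rho, mcvg F (fun t => Gamma sigma 1 (X t)) rho.
  apply: (ultra_mcvg FU (M := 1)) => t i j.
  have := psd_entry i j (posdef_psd (Gamma_posdef s_pos 1 (X_posdef t))).
  by rewrite (tr_Gamma1 s_pos) X_mass.
have Xc : mcvg F X (Gamma sigma (- 1) rho).
  apply: (eq_mcvg (fun t => GammaK s_pos 1 (X t))).
  by apply: (Gamma_mcvg s_pos) => //; exact: cvg_cst.
exists (Gamma sigma (- 1) rho); split => //.
  by apply: mcvg_psd Xc => t; exact: posdef_psd.
apply: (ccvg_unique (mcvg_tr (mcvgM (mcvg_cst sigma) Xc))).
by apply: (eq_ccvg (fun t => esym (X_mass t))); exact: ccvg_cst.
Qed.

(** Split Y = Gamma^s A into its part along the eigenvector u, which contributes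
    the left side, and the rest, which vanishes on u and is positive, so that the
    generator can only create mass from it along u. *)
Lemma eigenvector_rate s U (d : 'I_n -> R) A i : U \is unitarymx -> (forall k, 0 < d k) ->
  Gamma sigma s A = sform U d ->
  d i * complex.Re (bra (eigvec U i)
     (Gamma sigma s (L (Gamma sigma (- s) (eigvec U i *m (eigvec U i)^t*)))) (eigvec U i))
  <= complex.Re (bra (eigvec U i) (Gamma sigma s (L A)) (eigvec U i)).
Proof.
move=> Uu d0 YE.
pose d' k := if k == i then 0 else d k.
pose Y' := sform U d'; pose u := eigvec U i.
have uE : u *m u^t* = sform U (fun k => (k == i)%:R).
  rewrite -[LHS]mulmx1 -[RHS]mul1mx.
  rewrite (mulmx_sform _ _ Uu) (bigD1 i) //= eqxx scale1r big1 ?addr0 => [|k ki].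
    by rewrite mul1mx mulmx1.
  by rewrite (negbTE ki) scale0r.
have GD r B D : Gamma sigma r (B + D) = Gamma sigma r B + Gamma sigma r D.
  by rewrite GammaE mulmxDr mulmxDl.
have AE : A = (d i)%:C *: Gamma sigma (- s) (u *m u^t*) + Gamma sigma (- s) Y'.
  rewrite -[LHS](GammaK s_pos s) YE uE -GammaZ sformZ.
  rewrite -GD sformD; apply: (congr1 (Gamma sigma (- s))); apply: eq_sform => k.
  by rewrite /d'; case: eqVneq => [->|_]; rewrite ?mulr1 ?mulr0 ?addr0 ?add0r.
have Y'0 : psd Y'.
  by apply/(psd_sform _ Uu) => k; rewrite /d'; case: ifP => // _; exact: ltW.
pose h := mxpow sigma (s / 2).
have braG B : bra u (Gamma sigma s B) u = bra (h *m u) B (h *m u).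
  by rewrite GammaE braMr -/h braMl (mxpow_herm sigma (s / 2) : h^t* = h).
have X'0 : psd (Gamma sigma (- s) Y').
  have := psd_conj (mxpow sigma (- s / 2)) Y'0.
  by rewrite mxpow_herm.
have rate0 : 0 <= bra u (Gamma sigma s (L (Gamma sigma (- s) Y'))) u.
  rewrite braG; apply: (generator_pos P_qms L_gen X'0).
  rewrite -braG -{1}(opprK s) (GammaK s_pos).
  rewrite -[Y']mul1mx braMr (sform_eigvec d' i Uu) braZr /d' eqxx.
  exact: mul0r.
have LA : L A = (d i)%:C *: L (Gamma sigma (- s) (u *m u^t*)) + L (Gamma sigma (- s) Y').
  by rewrite {1}AE linearD linearZ.
have GLA : Gamma sigma s (L A) = (d i)%:C *: Gamma sigma s (L (Gamma sigma (- s) (u *m u^t*)))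
    + Gamma sigma s (L (Gamma sigma (- s) Y')).
  rewrite LA; apply: (etrans (GD s _ _)).
  exact: (congr1 (fun Z => Z + _) (GammaZ sigma s _ _)).
by rewrite GLA braD braZ ReD ReZ -/u lerDl Re_ge0.
Qed.

End Compactness.

(** * Limits of operators violating the inequality *)

Lemma near_ler_cvg (T : Type) (F : set_system T) (FF : ProperFilter F) (R : realFieldType)
    (f g : T -> R) (l k : R) : f t @[t --> F] --> l -> g t @[t --> F] --> k ->
  (\forall t \near F, f t <= g t) -> l <= k.
Proof.
move=> fl gk fg; rewrite -subr_ge0; apply: (cvgr_to_ge (cvgB gk fl)).
by apply: filterS fg => t; rewrite subr_ge0.
Qed.

(** The violated inequality, with Dirichlet form - (q^2 / 4) (G - k) and entropy
    q (H - l), solved for G. *)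
Lemma sum_lower_bound (R : realFieldType) (q a G k H l M : R) : 0 < q ->
  - M <= k + - (4 * a) * (q^-1 * (H + -1 * l)) ->
  - (q ^+ 2 / 4) * (G - k) < a * (q * (H - l)) -> - M <= G.
Proof.
move=> q0 HM; rewrite -subr_gt0 => HX; apply: (le_trans HM); rewrite -subr_ge0.
have -> : G - (k + - (4 * a) * (q^-1 * (H + -1 * l))) =
    (4 / q ^+ 2) * (a * (q * (H - l)) - - (q ^+ 2 / 4) * (G - k)).
  by field; rewrite gt_eqF.
by rewrite mulr_ge0 ?(ltW HX) // divr_ge0 // exprn_ge0 // ltW.
Qed.

Lemma mulr_le_opp (R : realFieldType) (K z0 z f : R) : 0 < z0 -> z0 / 2 <= z ->
  f <= - (`|K| / (z0 / 2)) -> f * z <= - K.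
Proof.
move=> z00 z0z fK; have z2 : 0 < z0 / 2 by rewrite divr_gt0.
set K' := `|K| / _ in fK; have K'0 : 0 <= K' by rewrite divr_ge0 // ltW.
apply: (@le_trans _ _ (- K' * z)).
  by rewrite ler_wpM2r // (le_trans _ z0z) // ltW.
rewrite mulNr lerN2 (le_trans (ler_norm K)) //.
have -> : `|K| = K' * (z0 / 2) by rewrite /K' divfK // gt_eqF.
by rewrite ler_wpM2l.
Qed.

Lemma tr_sform_mul (R : realType) n (U Z : 'M[R[i]]_n) (e : 'I_n -> R) : U \is unitarymx ->
  complex.Re (\tr (sform U e *m Z)) =
  \sum_i e i * complex.Re (bra (eigvec U i) Z (eigvec U i)).
Proof.
move=> Uu; rewrite mxtrace_mulC (tr_bra _ Uu) Re_sum; apply: eq_bigr => i _.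
by rewrite braMr (sform_eigvec e i Uu) braZr ReZ.
Qed.

Section ViolatingFamilies.
Variables (R : realType) (n : nat).
Local Notation C := R[i].
Variables (P : R -> {linear 'M[C]_n -> 'M[C]_n}) (L : {linear 'M[C]_n -> 'M[C]_n}).
Variable sigma : 'M[C]_n.
Hypothesis P_qms : quantum_markov_semigroup P.
Hypothesis L_gen : generator P L.
Hypothesis P_prim : primitive P sigma.
Hypothesis L_gns : gns_detailed_balance sigma L.
Variables (T : Type) (F : set_system T).
Hypothesis FU : UltraFilter F.
Variable q : T -> R.
Hypothesis q_ge1 : forall t, 1 <= q t.
Hypothesis q_cvg1 : q t @[t --> F] --> (1 : R).
Let FP : ProperFilter F := @ultra_proper _ _ FU.
#[local] Existing Instance FP.

Let s_pos : posdef sigma := invariant_posdef P_prim.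
Let s_tr1 : \tr sigma = 1 := invariant_tr1 P_prim.
Let L1 : L 1%:M = 0 := generator1 P_qms L_gen.

Variable X : T -> 'M[C]_n.
Hypothesis X_posdef : forall t, posdef (X t).
Hypothesis X_mass : forall t, \tr (sigma *m X t) = 1.
Variables (X0 : 'M[C]_n) (a : R).
Hypothesis X_cvg : mcvg F X X0.
Hypothesis X_bad : \forall t \near F,
  qdirichlet sigma L (q t) (X t) < a * qentropy sigma (q t) (X t).

Let q_inv_cvg : (q t)^-1 @[t --> F] --> (1 : R).
Proof. by rewrite -[X in _ --> X]invr1; apply: cvgV => //; exact: oner_neq0. Qed.

Let Y t := Gamma sigma (q t)^-1 (X t).
Let U t := spectralmx (Y t).
Let d t i := complex.Re (spectral_diag (Y t) 0 i).

Let Y_posdef t : posdef (Y t).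
Proof. exact: (Gamma_posdef s_pos _ (X_posdef t)). Qed.

Let YE t : Y t = sform (U t) (d t).
Proof. exact: (herm_sform (psd_herm (posdef_psd (Y_posdef t)))). Qed.

Let Uu t : U t \is unitarymx := spectral_unitarymx (Y t).

Let d_gt0 t i : 0 < d t i.
Proof. by move: i; apply/(posdef_sform _ (Uu t)); rewrite -YE; exact: Y_posdef. Qed.

Let Z t := Gamma sigma (q t)^-1 (L (X t)).
Let z i t := complex.Re (bra (eigvec (U t) i) (Z t) (eigvec (U t) i)).
Let S t := mxfun (qln (q t)) (mxpow sigma (q t)^-1).

Lemma qdirichlet_spectral t : qdirichlet sigma L (q t) (X t) =
  - (q t ^+ 2 / 4) * (\sum_i qln (q t) (d t i) * z i t - complex.Re (\tr (S t *m Z t))).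
Proof.
rewrite /qdirichlet /qlog_diff; congr (_ * _).
rewrite mulmxBl linearB ReD ReN; congr (_ - _).
rewrite -/(Y t) -/(Z t) mxfun_spectral -/(U t).
exact: (tr_sform_mul (Z t) (fun i => qln (q t) (d t i)) (Uu t)).
Qed.

Lemma qentropy_spectral t : qentropy sigma (q t) (X t) =
  q t * (\sum_i qln (q t) (d t i) * d t i - complex.Re (\tr (S t *m Y t))).
Proof.
rewrite /qentropy /qlog_diff; congr (_ * _).
rewrite mulmxBl linearB ReD ReN; congr (_ - _).
rewrite -/(Y t) mxfun_spectral -/(U t).
apply: (etrans (tr_sform_mul (Y t) (fun i => qln (q t) (d t i)) (Uu t))).
apply: eq_bigr => i _; congr (_ * _).
by rewrite [X in bra _ X _]YE (eigval_bra (d t) i (Uu t)).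
Qed.

(** If X0 were singular, some eigenvalues d of Y t would tend to 0 and their
    q-logarithms to minus infinity. The entropy sees d ln_q d only and stays
    bounded. The Dirichlet form weighs ln_q d with the flow z into the eigenvector;
    as z is at least d times a bounded rate, every term ln_q d * z is bounded
    above, and irreducibility provides one eigenvector of the kernel with z
    bounded below by a positive constant. So the Dirichlet form tends to plus
    infinity, which contradicts the violated inequality. *)
Lemma limit_posdef : psd X0 -> \tr (sigma *m X0) = 1 -> posdef X0.
Proof.
move=> X00 X01; apply: contrapT => X0n.
have GG := @Gamma_mcvg _ _ sigma s_pos T F FP.
have Yc : mcvg F Y (Gamma sigma 1 X0) by apply: GG.
have Zc : mcvg F Z (Gamma sigma 1 (L X0)) by exact: (GG _ _ _ _ q_inv_cvg (mcvg_linear L X_cvg)).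
have Sc : mcvg F S (mxfun (@ln R) (mxpow sigma 1)).
  apply: (mcvg_mxfun FU).
  - by move=> t; exact: mxpow_posdef.
  - exact: (mxpow_mcvg s_pos q_inv_cvg).
  - exact: mxpow_posdef.
  - by move=> x x0 xp x00 xx0; exact: qln_cvg.
have [W [w [Wu rhoE UW dw]]] :
    exists V d0, [/\ V \is unitarymx, Gamma sigma 1 X0 = sform V d0, mcvg F U V &
      forall i, d t i @[t --> F] --> d0 i].
  by apply: (ultra_spectral FU Uu); apply: eq_mcvg Yc.
have w_ge0 i : 0 <= w i.
  by apply: (cvgr_to_ge (dw i)); apply: nearW => t; exact: ltW.
have ec i : mcvg F (fun t => eigvec (U t) i) (eigvec W i) by exact: mcvg_eigvec.
pose z0 i := complex.Re (bra (eigvec W i) (Gamma sigma 1 (L X0)) (eigvec W i)).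
have zc i : z i t @[t --> F] --> z0 i by have [] := mcvg_bra (ec i) Zc (ec i).
pose r i t := complex.Re (bra (eigvec (U t) i) (Gamma sigma (q t)^-1
  (L (Gamma sigma (- (q t)^-1) (eigvec (U t) i *m (eigvec (U t) i)^t*)))) (eigvec (U t) i)).
have rB i : eventually_bounded F (r i).
  have pc : mcvg F (fun t => eigvec (U t) i *m (eigvec (U t) i)^t*)
      (eigvec W i *m (eigvec W i)^t*).
    by apply: mcvgM; [exact: ec|apply: mcvg_adj; exact: ec].
  have nq : - (q t)^-1 @[t --> F] --> (- 1 : R) by exact: cvgN.
  have gl : mcvg F (fun t => L (Gamma sigma (- (q t)^-1) (eigvec (U t) i *m (eigvec (U t) i)^t*)))
      (L (Gamma sigma (- 1) (eigvec W i *m (eigvec W i)^t*))).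
    by apply: mcvg_linear; exact: GG nq pc.
  have gc := GG _ _ _ _ q_inv_cvg gl.
  by have [+ _] := mcvg_bra (ec i) gc (ec i); exact: cvg_ebounded.
have rate i t : d t i * r i t <= z i t.
  by apply: (eigenvector_rate P_qms L_gen P_prim i (Uu t) (d_gt0 t)); exact: YE.
have dlnB i : eventually_bounded F (fun t => qln (q t) (d t i) * d t i).
  by apply: qln_mul_ebounded (dw i).
have [i0 wi0] : exists i0, w i0 = 0.
  apply: contrapT => nw; apply: X0n.
  have rp : posdef (Gamma sigma 1 X0).
    rewrite rhoE; apply/(posdef_sform _ Wu) => i; rewrite lt_neqAle w_ge0 andbT eq_sym.
    by apply/eqP => wi; apply: nw; exists i.
  rewrite -(GammaK s_pos 1 X0); exact: Gamma_posdef.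
have [j0 wj0] : exists j0, w j0 != 0.
  apply/existsP; rewrite -negb_forall; apply/negP => /forallP w0.
  have := tr_Gamma1 s_pos X0; rewrite X01 rhoE (tr_sform _ Wu) big1 => [|i _].
    by move=> /eqP; rewrite eq_sym oner_eq0.
  exact/eqP.
have [i1 [wi1 zi1]] : exists i1, w i1 = 0 /\ 0 < z0 i1.
  apply: contrapT => nz.
  have := generator_irreducible P_qms L_gen P_prim L_gns Wu w_ge0 wi0 wj0.
  rewrite -rhoE.
  set Q := sform W _.
  have -> : \tr (L Q *m Gamma sigma 1 X0) = \tr (Q *m Gamma sigma 1 (L X0)).
    have := kms_symmetric P_qms L_gen P_prim L_gns Q X0.
    rewrite !GammaE !tr_sandwich mul1r.
    by [].
  rewrite (tr_sform_mul _ _ Wu) ltNge => /negP; apply; apply: sumr_le0 => i _.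
  case: eqVneq => [wi|_]; last by rewrite mul0r.
  by rewrite mul1r leNgt; apply/negP => zi; apply: nz; exists i; split.
have [c cH] : exists c, \forall t \near F, c <= \sum_i qln (q t) (d t i) * z i t.
  have kB : eventually_bounded F (fun t => complex.Re (\tr (S t *m Z t))).
    by have [+ _] := mcvg_tr (mcvgM Sc Zc); exact: cvg_ebounded.
  have lB : eventually_bounded F (fun t => complex.Re (\tr (S t *m Y t))).
    by have [+ _] := mcvg_tr (mcvgM Sc Yc); exact: cvg_ebounded.
  have cB (c : R) : eventually_bounded F (fun=> c : R).
    by apply: (@cvg_ebounded _ _ _ _ _ c); exact: cvg_cst.
  have [M HM] : eventually_bounded F (fun t => complex.Re (\tr (S t *m Z t)) +
      (- (4 * a)) * ((q t)^-1 *
        (\sum_i qln (q t) (d t i) * d t i + (- 1) * complex.Re (\tr (S t *m Y t))))).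
    apply: (eboundedD kB); apply: (eboundedM (cB _)); apply: eboundedM.
      exact: cvg_ebounded q_inv_cvg.
    by apply: eboundedD; [exact: ebounded_sum|exact: (eboundedM (cB _) lB)].
  exists (- M); apply: filterS2 HM X_bad => t.
  rewrite qdirichlet_spectral qentropy_spectral ler_norml => /andP[HM _].
  have q0 : 0 < q t by exact: lt_le_trans (q_ge1 t).
  exact: sum_lower_bound.
apply: (sum_to_minus_infinity (i0 := i1) _ _ cH).
- move=> i.
  (* an eigenvalue with positive limit has a convergent q-logarithm *)
  have [wi|wi] := eqVneq (w i) 0; last first.
    have [M HM] : eventually_bounded F (fun t => qln (q t) (d t i) * z i t).
      apply: eboundedM; last exact: cvg_ebounded (zc i).
      apply: (@cvg_ebounded _ _ _ _ _ (ln (w i))).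
      apply: (qln_cvg q_ge1 q_cvg1 (fun t => d_gt0 t i)) (dw i).
      by rewrite lt_neqAle eq_sym wi w_ge0.
    by exists M; apply: filterS HM => t; exact: le_trans (ler_norm _).
  have [M HM] := eboundedM (dlnB i) (rB i).
  have dw0 : d t i @[t --> F] --> (0 : R) by rewrite -wi.
  have f0 : \forall t \near F, qln (q t) (d t i) <= - 0.
    by apply: (qln_minus_infinity q_ge1 q_cvg1 (fun t => d_gt0 t i) dw0).
  exists M; apply: filterS2 HM f0 => t HM; rewrite oppr0 => f0.
  apply: (@le_trans _ _ (qln (q t) (d t i) * (d t i * r i t))).
    by rewrite ler_wnM2l.
  by rewrite mulrA (le_trans (ler_norm _)).
- move=> K.
  have dw0 : d t i1 @[t --> F] --> (0 : R) by rewrite -wi1.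
  pose K' := `|K| / (z0 i1 / 2).
  have f0 : \forall t \near F, qln (q t) (d t i1) <= - K'.
    by apply: (qln_minus_infinity q_ge1 q_cvg1 (fun t => d_gt0 t i1) dw0).
  have zhalf : \forall t \near F, z0 i1 / 2 <= z i1 t.
    by apply: (cvgr_ge _ (zc i1)); lra.
  apply: filterS2 zhalf f0 => t zt ft.
  exact: mulr_le_opp zi1 zt ft.
Qed.

(** Any norm would do: it sets the scale at which X t approaches 1. *)
Let size1 (A : 'M[C]_n) : R :=
  \sum_i \sum_j (`|complex.Re (A i j)| + `|complex.Im (A i j)|).

Let size1_entry (A : 'M[C]_n) i j :
  `|complex.Re (A i j)| <= size1 A /\ `|complex.Im (A i j)| <= size1 A.
Proof.
have e : `|complex.Re (A i j)| + `|complex.Im (A i j)| <= size1 A.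
  rewrite /size1 (bigD1 i) //= (bigD1 j) //= -addrA lerDl addr_ge0 //.
    by apply: sumr_ge0 => k _; rewrite addr_ge0.
  by do 2 apply: sumr_ge0 => ? _; rewrite addr_ge0.
by split; apply: (le_trans _ e); rewrite ?lerDl ?lerDr.
Qed.

Let size1_eq0 (A : 'M[C]_n) : size1 A = 0 -> A = 0.
Proof.
move=> A0; apply/matrixP => i j; rewrite mxE.
have [] := size1_entry A i j; rewrite A0 !normr_le0.
by case: (A i j) => x y /= /eqP -> /eqP ->.
Qed.

Let size1Z (c : R) (A : 'M[C]_n) : 0 < c -> size1 (c%:C *: A) = c * size1 A.
Proof.
move=> c0; rewrite /size1 mulr_sumr; apply: eq_bigr => i _.
rewrite mulr_sumr; apply: eq_bigr => j _; rewrite mxE.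
case: (A i j) => x y /=; rewrite !mul0r subr0 addr0 !normrM gtr0_norm //.
by rewrite mulrDr.
Qed.

Let size1_cvg (A : T -> 'M[C]_n) A0 : mcvg F A A0 -> size1 (A t) @[t --> F] --> size1 A0.
Proof.
move=> Ac.
have [+ _] : ccvg F (fun t => \sum_i \sum_j
    (`|complex.Re (A t i j)| + `|complex.Im (A t i j)|)%:C)
    (\sum_i \sum_j (`|complex.Re (A0 i j)| + `|complex.Im (A0 i j)|)%:C).
  apply: ccvg_sum => i; apply: ccvg_sum => j; apply: ccvg_real.
  by have [H1 H2] := Ac i j; apply: cvgD; exact: cvg_norm.
have E (B : 'M[C]_n) : complex.Re (\sum_i \sum_j
    (`|complex.Re (B i j)| + `|complex.Im (B i j)|)%:C) = size1 B.
  by rewrite Re_sum; apply: eq_bigr => i _; rewrite Re_sum.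
by rewrite E; under eq_fun do rewrite E.
Qed.

(** Divided by the squared size of X t - 1, entropy and Dirichlet form have the
    same limits whether the exponent is q t or constantly 1, and the limit of the
    entropies is positive because the limit direction Xi is not 0. The division
    matters at X0 = 1, where both functionals vanish. The inequality at exponent 1
    passes to the limit with constant a' and the violated one with a < a'. *)
Lemma limit_singular a' : a < a' -> qbeckner sigma L 1 a' -> ~ posdef X0.
Proof.
move=> aa' H1 X00.
have [V [m [Vu sE m0]]] := posdef_sformP s_pos.
(* the value 1 at X t = 1, an event excluded below, keeps b positive *)
pose b t := if X t == 1%:M then 1 else size1 (X t - 1%:M).
have b_gt0 t : 0 < b t.
  rewrite /b; case: eqVneq => [_|n1]; first exact: ltr01.
  rewrite lt_neqAle; apply/andP; split; last first.
    by do 2 apply: sumr_ge0 => ? _; rewrite addr_ge0.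
  by apply: contra n1 => /eqP/esym/size1_eq0/eqP; rewrite subr_eq0.
have bV_gt0 t : 0 < (b t)^-1 by rewrite invr_gt0.
have bounded t : size1 (((b t)^-1)%:C *: (X t - 1%:M)) <= 1.
  rewrite size1Z // /b; case: eqVneq => [->|n1].
    rewrite invr1 mul1r subrr /size1 big1 // => i _; rewrite big1 // => j _.
    by rewrite mxE /= normr0 addr0.
  have := b_gt0 t; rewrite /b (negbTE n1) => s0.
  by rewrite mulVf ?gt_eqF.
have [Xi Xic] : exists Xi, mcvg F (fun t => ((b t)^-1)%:C *: (X t - 1%:M)) Xi.
  apply: (ultra_mcvg FU (M := 1)) => t i j.
  have [h1 h2] := size1_entry (((b t)^-1)%:C *: (X t - 1%:M)) i j.
  by split; apply: le_trans (bounded t).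
have qE0 t : X t = 1%:M -> qentropy sigma (q t) (X t) = 0 /\ qdirichlet sigma L (q t) (X t) = 0.
  move=> X1; rewrite (qentropyE Vu sE m0 s_tr1 (q_ge1 t) (X_posdef t) (X_mass t)).
  rewrite (qdirichletE Vu sE m0 L1 (q t) (X_posdef t)) X1 subrr.
  have G0 : Gamma sigma (q t)^-1 0 = 0 by rewrite GammaE mulmx0 mul0mx.
  have L0 : L 0 = 0 by exact: linear0.
  rewrite L0 G0; split.
    rewrite big1 ?mulr0 // => j _; rewrite mul0mx -(scale0r (0 : 'cV[C]_n)) braZr mul0r.
    by [].
  rewrite big1 ?mulr0 // => j _; rewrite mul0mx mulmx0 -(scale0r (0 : 'cV[C]_n)) braZr mul0r.
  by [].
have Xn1 : \forall t \near F, X t != 1%:M.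
  apply: filterS X_bad => t; apply: contraL => /eqP X1.
  by have [-> ->] := qE0 t X1; rewrite mulr0 ltxx.
have Xi0 : Xi != 0.
  apply/eqP => Xi0.
  have sc := size1_cvg Xic.
  have : (1 : R) <= size1 Xi.
    apply: (cvgr_to_ge sc); apply: filterS Xn1 => t n1.
    rewrite size1Z // /b (negbTE n1) mulVf //.
    by have := b_gt0 t; rewrite /b (negbTE n1) => /gt_eqF ->.
  rewrite Xi0 /size1 big1 ?ler10 // => i _; rewrite big1 // => j _.
  by rewrite mxE /= normr0 addr0.
have q1c : (fun=> 1 : R) t @[t --> F] --> (1 : R) by exact: cvg_cst.
have q11 (t : T) : 1 <= (fun=> 1 : R) t by [].
have Dq := qentropy_cvg Vu sE m0 s_tr1 FU q_ge1 q_cvg1 X_posdef X_mass X_cvg X00 Xic.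
have Eq := qdirichlet_cvg Vu sE m0 L1 FU q_ge1 q_cvg1 X_posdef X_cvg X00 Xic.
have D1 := qentropy_cvg Vu sE m0 s_tr1 FU q11 q1c X_posdef X_mass X_cvg X00 Xic.
have E1 := qdirichlet_cvg Vu sE m0 L1 FU q11 q1c X_posdef X_cvg X00 Xic.
have D_gt0 := entropy_form_gt0 Vu sE m0 X00 Xi0.
have b2 t : 0 < (b t)^-1 ^+ 2 by rewrite exprn_gt0.
have le1 : a' * entropy_form sigma V m X0 Xi <= dirichlet_form sigma L V m X0 Xi.
  have aD1 : a' * ((b t)^-1 ^+ 2 * qentropy sigma 1 (X t)) @[t --> F] -->
      a' * entropy_form sigma V m X0 Xi by apply: cvgM D1; exact: cvg_cst.
  have H : \forall t \near F, a' * ((b t)^-1 ^+ 2 * qentropy sigma 1 (X t)) <=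
      (b t)^-1 ^+ 2 * qdirichlet sigma L 1 (X t).
    apply: nearW => t; rewrite (mulrCA a') (ler_pM2l (b2 t)).
    exact: (H1 _ (X_posdef t) (X_mass t)).
  refine (@near_ler_cvg T F _ R _ _ _ _ aD1 E1 H).
have le2 : dirichlet_form sigma L V m X0 Xi <= a * entropy_form sigma V m X0 Xi.
  have aDq : a * ((b t)^-1 ^+ 2 * qentropy sigma (q t) (X t)) @[t --> F] -->
      a * entropy_form sigma V m X0 Xi by apply: cvgM Dq; exact: cvg_cst.
  have H : \forall t \near F, (b t)^-1 ^+ 2 * qdirichlet sigma L (q t) (X t) <=
      a * ((b t)^-1 ^+ 2 * qentropy sigma (q t) (X t)).
    apply: filterS X_bad => t /ltW bad.
    by rewrite (mulrCA a ((b t)^-1 ^+ 2)) (ler_pM2l (b2 t)).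
  refine (@near_ler_cvg T F _ R _ _ _ _ Eq aDq H).
have := le_trans le1 le2; rewrite ler_pM2r // leNgt aa'.
by [].
Qed.

End ViolatingFamilies.

(** * The limit of the optimal constants *)

Lemma cvg_ereal (R : realType) (T : Type) (F : set_system T) (FF : Filter F)
    (f : T -> \bar R) (l : \bar R) :
  (forall r : R, (l < r%:E)%E -> \forall t \near F, (f t <= r%:E)%E) ->
  (forall r : R, (r%:E < l)%E -> \forall t \near F, (r%:E <= f t)%E) ->
  f t @[t --> F] --> l.
Proof.
move=> up lo; case: l up lo => [l| |] up lo.
- apply/fine_cvgP; have near1 : \forall t \near F, (l%:E - 1%:E <= f t <= l%:E + 1%:E)%E.
    have u1 := up (l + 1); have l1 := lo (l - 1).
    rewrite lte_fin ltrDl ltr01 in u1; rewrite lte_fin ltrBlDr ltrDl ltr01 in l1.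
    by apply: filterS2 (u1 isT) (l1 isT) => t u v; rewrite -EFinB -EFinD v u.
  split.
    apply: filterS near1 => t; case: (f t) => //=; rewrite -EFinD ?leeNy_eq ?leye_eq ?andbF //.
  apply/cvgrPdist_le => e e0.
  have u1 := up (l + e); have l1 := lo (l - e).
  rewrite lte_fin ltrDl e0 in u1; rewrite lte_fin ltrBlDr ltrDl e0 in l1.
  apply: filterS2 (u1 isT) (l1 isT) => t.
  rewrite /comp; case: (f t) => [x| |] //=; rewrite !lee_fin ler_norml => h1 h2.
  by apply/andP; split; lra.
- apply/cvgeyPge => A; exact: lo (ltry A).
- apply/cvgeNyPle => A; exact: up (ltNyr A).
Qed.

(** The trace of F on the complement of G is proper, hence contained in an
    ultrafilter. *)
Lemma not_near_ultra (T : Type) (F : set_system T) (FF : Filter F) (G : set T) :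
  ~ (\forall t \near F, G t) ->
  exists U : set_system T, [/\ UltraFilter U, F `<=` U & U (~` G)].
Proof.
move=> nG; pose K := within (~` G) F.
have KP : ProperFilter K.
  apply: Build_ProperFilter_ex => A KA; apply: contrapT => nA; apply: nG.
  have {}KA : \forall t \near F, (~` G) t -> A t by exact: KA.
  apply: filterS KA => t At; apply: contrapT => nGt; apply: nA; exists t.
  exact: At.
have [U [UU KU]] := ultraFilterLemma KP.
exists U; split => //.
  by move=> A FA; apply: KU; apply: filterS FA => t At _.
by apply: KU; rewrite /K /within /=; exact: filterE.
Qed.

Section Limit.
Variables (R : realType) (n : nat).
Local Notation C := R[i].
Variables (P : R -> {linear 'M[C]_n -> 'M[C]_n}) (L : {linear 'M[C]_n -> 'M[C]_n}).
Variable sigma : 'M[C]_n.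
Hypothesis P_qms : quantum_markov_semigroup P.
Hypothesis L_gen : generator P L.
Hypothesis P_prim : primitive P sigma.
Hypothesis L_gns : gns_detailed_balance sigma L.

Let s_pos : posdef sigma := invariant_posdef P_prim.
Let s_tr1 : \tr sigma = 1 := invariant_tr1 P_prim.
Let L_tr0 : forall Y, \tr (sigma *m L Y) = 0 := generator_tr0 P_qms L_gen L_gns.
Let L1 : L 1%:M = 0 := generator1 P_qms L_gen.

Lemma qentropy_ge0 q X : 1 <= q -> posdef X -> \tr (sigma *m X) = 1 ->
  0 <= qentropy sigma q X.
Proof.
move=> q1 X0 X1; have [V [m [Vu sE m0]]] := posdef_sformP s_pos.
rewrite (qentropyE Vu sE m0 s_tr1 q1 X0 X1) mulr_ge0 ?(le_trans ler01 q1) //.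
rewrite Re_sum; apply: sumr_ge0 => j _; apply: Re_ge0.
have h : posdef (mxfun (bregman_slope q (m j `^ q^-1)) (Gamma sigma q^-1 X)).
  apply: posdef_mxfun; first exact: (Gamma_posdef s_pos _ X0).
  by move=> x x0; exact: (bregman_slope_gt0 (lt_le_trans ltr01 q1) (powR_gt0 _ (m0 j)) x0).
exact: (posdef_psd h).
Qed.

Lemma qbeckner_le q a b : 1 <= q -> a <= b -> qbeckner sigma L q b -> qbeckner sigma L q a.
Proof.
move=> q1 ab H X X0 X1; apply: le_trans (H X X0 X1).
by rewrite ler_wpM2r // qentropy_ge0.
Qed.

(** The limit lemmas ask for exponents at least 1 everywhere, whereas ultrafilters
    finer than the right neighbourhoods of 1 give p > 1 only eventually. *)
Let q (p : R) : R := Num.max p 1.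

Let q_ge1 p : 1 <= q p.
Proof. by rewrite /q le_max lexx orbT. Qed.

Section Ultrafilter.
Variable U : set_system R.
Hypothesis UU : UltraFilter U.
Hypothesis U1 : (1 : R)^'+ `<=` U.
Let UP : ProperFilter U := @ultra_proper _ _ UU.
#[local] Existing Instance UP.

Let U_gt1 : \forall p \near U, 1 < p.
Proof. by apply: U1; exact: nbhs_right_gt. Qed.

Let qE p : 1 < p -> q p = p.
Proof. by move=> p1; rewrite /q max_l // ltW. Qed.

Let q_cvg1 : q p @[p --> U] --> (1 : R).
Proof.
have idc : p @[p --> U] --> (1 : R).
  by apply: (@cvg_trans _ ((1 : R)^'+)); [exact: U1|exact: cvg_at_right_filter].
apply: cvg_trans idc; apply: near_eq_cvg; apply: filterS U_gt1 => p /qE.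
by [].
Qed.

(** For fixed X both functionals are continuous at q = 1: this is the limit of the
    quadratic forms with the constant family X and scale 1. *)
Lemma qbeckner_limit r : (\forall p \near U, qbeckner sigma L p r) -> qbeckner sigma L 1 r.
Proof.
move=> H X X0 X1.
have [V [m [Vu sE m0]]] := posdef_sformP s_pos.
have XP (p : R) : posdef X by [].
have XM (p : R) : \tr (sigma *m X) = 1 by [].
have Xc : mcvg U (fun=> X) X by exact: mcvg_cst.
have b0 (p : R) : 0 < (1 : R) by [].
have Xic : mcvg U (fun p => ((1 : R)^-1)%:C *: (X - 1%:M)) (X - 1%:M).
  by rewrite invr1 scale1r; exact: mcvg_cst.
have one1 (p : R) : 1 <= (1 : R) by [].
have onec : (fun=> 1 : R) p @[p --> U] --> (1 : R) by exact: cvg_cst.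
have D := qentropy_cvg Vu sE m0 s_tr1 UU q_ge1 q_cvg1 XP XM Xc X0 Xic.
have E := qdirichlet_cvg Vu sE m0 L1 UU q_ge1 q_cvg1 XP Xc X0 Xic.
have D1 := qentropy_cvg Vu sE m0 s_tr1 UU one1 onec XP XM Xc X0 Xic.
have E1 := qdirichlet_cvg Vu sE m0 L1 UU one1 onec XP Xc X0 Xic.
have <- : entropy_form sigma V m X (X - 1%:M) = qentropy sigma 1 X.
  apply: (norm_cvg_unique D1).
  rewrite invr1 (expr1n R 2) (mul1r (qentropy sigma 1 X)).
  exact: cvg_cst.
have <- : dirichlet_form sigma L V m X (X - 1%:M) = qdirichlet sigma L 1 X.
  apply: (norm_cvg_unique E1).
  rewrite invr1 (expr1n R 2) (mul1r (qdirichlet sigma L 1 X)).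
  exact: cvg_cst.
have rD : r * ((1 : R)^-1 ^+ 2 * qentropy sigma (q p) X) @[p --> U] -->
    r * entropy_form sigma V m X (X - 1%:M) by apply: cvgM D; exact: cvg_cst.
have H' : \forall p \near U, r * ((1 : R)^-1 ^+ 2 * qentropy sigma (q p) X) <=
    (1 : R)^-1 ^+ 2 * qdirichlet sigma L (q p) X.
  apply: filterS2 U_gt1 H => p p1 Hp.
  rewrite (qE p1); move: (Hp X X0 X1).
  move: (qentropy sigma p X) (qdirichlet sigma L p X) => D' E'.
  by rewrite invr1 expr1n !mul1r.
refine (@near_ler_cvg R U _ R _ _ _ _ rD E H').
Qed.

(** Otherwise normalized operators violating the inequality at p exist for almost
    every p; their limit would be both positive definite and not. *)
Lemma qbeckner_near a' r : r < a' -> qbeckner sigma L 1 a' ->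
  ~ (\forall p \near U, ~ qbeckner sigma L p r).
Proof.
move=> ra H1 bad.
have one_good : posdef (1%:M : 'M[C]_n) /\ \tr (sigma *m 1%:M) = 1.
  split; last by rewrite mulmx1.
  by rewrite -(mxpow0 sigma); exact: mxpow_posdef.
have choose p : exists X : 'M[C]_n, [/\ posdef X, \tr (sigma *m X) = 1 &
    ~ qbeckner sigma L p r -> qdirichlet sigma L p X < r * qentropy sigma p X].
  have [ok|nok] := pselect (qbeckner sigma L p r).
    by exists 1%:M; have [? ?] := one_good; split.
  apply: contrapT => no; apply: nok => X X0 X1.
  rewrite leNgt; apply/negP => lt; apply: no; exists X; split => //.
have [X XP] := choice choose.
have X0 p : posdef (X p) by have [] := XP p.
have X1 p : \tr (sigma *m X p) = 1 by have [] := XP p.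
have Xbad : \forall p \near U, qdirichlet sigma L (q p) (X p) < r * qentropy sigma (q p) (X p).
  apply: filterS2 U_gt1 bad => p /qE -> nb.
  by have [_ _] := XP p; apply.
have [Y [Yc Y0 Y1]] := density_mcvg P_prim UU X0 X1.
have := limit_posdef P_qms L_gen P_prim L_gns UU q_ge1 q_cvg1 X0 Yc Xbad Y0 Y1.
exact: (limit_singular P_qms L_gen P_prim UU q_ge1 q_cvg1 X0 X1 Yc Xbad ra H1).
Qed.

End Ultrafilter.

(** Above the limit, r > alpha_1, a family of exponents with alpha_p > r would make
    r valid at exponent 1; below it, r < alpha_1, some constant larger than r is
    valid at exponent 1 and qbeckner_near applies. *)
Lemma alpha_cvg : alpha_p sigma L p @[p --> (1 : R)^'+] --> alpha_1 sigma L.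
Proof.
apply: cvg_ereal => r.
- move=> lt; apply: contrapT => /not_near_ultra[U [UU U1 bad]].
  have UP := @ultra_proper _ _ UU.
  suff /(mlsiP s_pos s_tr1 L_tr0) H : qbeckner sigma L 1 r.
    move: lt; rewrite ltNge => /negP; apply.
    by apply: ereal_sup_ubound; exists r.
  apply: (qbeckner_limit UU U1).
  have gt1 : \forall p \near U, 1 < p by apply: U1; exact: nbhs_right_gt.
  apply: filterS2 gt1 bad => p p1 /= /negP; rewrite -ltNge.
  move=> /ereal_sup_gt[_ [b Hb <-]]; rewrite lte_fin => rb.
  by apply: (qbeckner_le (ltW p1) (ltW rb)); apply/qbecknerP.
- move=> /ereal_sup_gt[_ [b Hb <-]]; rewrite lte_fin => rb.
  have {}Hb : qbeckner sigma L 1 b by apply/mlsiP.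
  apply: contrapT => /not_near_ultra[U [UU U1 bad]].
  have UP := @ultra_proper _ _ UU.
  apply: (qbeckner_near UU U1 rb Hb).
  have gt1 : \forall p \near U, 1 < p by apply: U1; exact: nbhs_right_gt.
  apply: filterS2 gt1 bad => p p1 /= nle Hp; apply: nle.
  by apply: ereal_sup_ubound; exists r => //; apply/qbecknerP.
Qed.

End Limit.


Theorem theorem3p25 (R : realType) (n : nat)
    (P : R -> {linear 'M[R[i]]_n -> 'M[R[i]]_n})
    (L : {linear 'M[R[i]]_n -> 'M[R[i]]_n})
    (sigma : 'M[R[i]]_n)
    (P_qms : quantum_markov_semigroup P)
    (L_gen : generator P L)
    (P_prim : primitive P sigma)
    (L_gns : gns_detailed_balance sigma L) :
  alpha_p sigma L p @[p --> (1 : R)^'+] --> alpha_1 sigma L.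
Proof. exact: alpha_cvg P_qms L_gen P_prim L_gns. Qed.
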